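(* Let $d\ge2$ and $z\in\mathbb{R}$. As $N\to\infty$, under $P$, the point processes $\mathcal{N}_N^z$ converge weakly (in the topology of point processes) to a Poisson point process on $(\mathbb{R}/\mathbb{Z})^d\times\mathbb{R}$ of intensity $\exp(-z)\lambda$, where $\lambda$ denotes Lebesgue measure on $(\mathbb{R}/\mathbb{Z})^d\times\{0\}$.
   Context: Fix an integer $d\ge2$. $\mathbb{T}_N=(\mathbb{Z}/N\mathbb{Z})^d$ and $E_N=\mathbb{T}_N\times\mathbb{Z}$ is the discrete cylinder (nearest-neighbour graph). $P$ (depending on $N$) is the law of discrete time simple random walk $(X_n)_{n\ge0}$ on $E_N$ whose starting point is uniform on $\mathbb{T}_N\times\{0\}$. $H_x=\inf\{n\ge0:X_n=x\}$, and $L_n=|\{i\in[0,n]:X_i\in\mathbb{T}_N\times\{0\}\}|$ is the local time at the zero level. $g(x)=\sum_{n\ge0}P_x^{\mathbb{Z}^{d+1}}(X_n=0)$ is the Green function of simple random walk on $\mathbb{Z}^{d+1}$. For $z\in\mathbb{R}$ put $u(z)=g(0)\{\log|\mathbb{T}_N\times\{0\}|+z\}$ and define the point process on $(\mathbb{R}/\mathbb{Z})^d\times\mathbb{R}$ $$\mathcal{N}_N^z=\sum_{x\in\mathbb{T}_N\times\{0\}}\delta_{x/N}\,1_{\{L_{H_x}>N^du(z)\}}.$$ *)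

(* Defs.v *)
From HB Require Import structures.
From mathcomp Require Import all_boot all_order all_algebra.
From mathcomp Require Import all_classical all_reals all_analysis measurable_realfun.

Set Implicit Arguments.
Unset Strict Implicit.
Unset Printing Implicit Defensive.

Import Order.TTheory GRing.Theory Num.Theory.
Import numFieldNormedType.Exports.

Local Open Scope classical_set_scope.
Local Open Scope ring_scope.

Section random_walk.
Context {R : realType} {V : eqType} (nbrs : V -> seq V).

Definition srw_step (x y : V) : R :=
  (y \in nbrs x)%:R / (size (nbrs x))%:R.

(* P_x(X_n = y), by decomposition on the first step. *)
Fixpoint srw_prob (n : nat) (x y : V) : R :=
  if n is m.+1 then \sum_(v <- nbrs x) srw_step x v * srw_prob m v y
  else (x == y)%:R.

Definition green (x y : V) : \bar R :=
  (\sum_(0 <= n <oo) (srw_prob n x y)%:E)%E.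

Definition is_srw d (Om : measurableType d) (P : probability Om R)
    (init : V -> R) (X : nat -> Om -> V) : Prop :=
  (forall n v, measurable [set w | X n w = v]) /\
  (forall n (x : nat -> V),
     P [set w | forall k, (k <= n)%N -> X k w = x k] =
     (init (x 0%N) * \prod_(k < n) srw_step (x k) (x k.+1))%:E).

(* H_x = +oo when x is never visited. *)
Definition hitting_time (X : nat -> V) (x : V) : \bar R :=
  ereal_inf [set n%:R%:E | n in [set n | X n = x]].

End random_walk.

Section lattices.

(* Neighbours in the nearest-neighbour graph on A^n: A = int gives Z^n, and
   A = 'Z_N gives (Z/NZ)^n.  For N <= 2, x + e_i and x - e_i may coincide. *)
Definition lattice_nbrs (A : nzRingType) n (x : 'rV[A]_n) : seq 'rV[A]_n :=
  undup (flatten [seq [:: x + delta_mx 0 i; x - delta_mx 0 i] | i <- enum 'I_n]).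

(* 'Z_N is Z/NZ only for N >= 2; N = 0 and N = 1 play no role as N -> oo. *)
Definition torus (d N : nat) := 'rV['Z_N]_d.
Definition cylinder (d N : nat) : Type := (torus d N * int)%type.

Definition cylinder_nbrs d N (x : cylinder d N) : seq (cylinder d N) :=
  [seq (y, x.2) | y <- lattice_nbrs x.1] ++ [:: (x.1, x.2 + 1); (x.1, x.2 - 1)].

Definition at_zero d N (y : torus d N) : cylinder d N := (y, 0).

Definition zero_level d N : set (cylinder d N) := [set x | x.2 = 0].

Definition uniform_zero_level {R : realType} d N (x : cylinder d N) : R :=
  (x.2 == 0)%:R / #|{: torus d N}|%:R.

(* L_t = #{i in [0, t] : X_i in T_N x {0}}, for t possibly infinite. *)
Definition local_time {R : realType} d N (X : nat -> cylinder d N) (t : \bar R)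
    : \bar R :=
  counting [set i : nat | (i%:R%:E <= t)%E /\ zero_level (X i)].

(* u(z) = g(0) (log |T_N x {0}| + z), g the Green function of Z^(d+1) *)
Definition level {R : realType} d N (z : R) : \bar R :=
  (green (@lattice_nbrs int d.+1) 0%R 0%R * (ln #|{: torus d N}|%:R + z)%:E)%E.

End lattices.

Section point_processes.
Variables (R : realType) (d : nat).

Definition integers : {pred R} := fun x => x \is a Num.int.

Lemma integers_zmod_closed : zmod_closed integers.
Proof. by split=> [|x y xZ yZ]; [exact: rpred0 | exact: rpredB]. Qed.

HB.instance Definition _ :=
  GRing.isZmodClosed.Build R integers integers_zmod_closed.

Definition R_mod_Z := quotient_topology (Quotient.quot integers).

Definition mod_Z (t : R) : R_mod_Z := (\pi_(R_mod_Z) t)%qT.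

Definition state := ('rV[R_mod_Z]_d * R)%type.

(* [state] with its Borel sigma-algebra *)
Definition borel_state := g_sigma_algebraType (@open state).

(* Locally finite, integer-valued Borel measures *)
Record point_measure := PointMeasure {
  pm_measure :> {measure set borel_state -> \bar R};
  pm_integer : forall A : set borel_state, measurable A ->
    pm_measure A = +oo%E \/ exists k : nat, pm_measure A = k%:R%:E;
  pm_locally_finite : forall K : set state, compact K ->
    (pm_measure K < +oo)%E }.

HB.instance Definition _ := gen_eqMixin point_measure.
HB.instance Definition _ := gen_choiceMixin point_measure.

Definition compactly_supported :=
  {f : state -> R | continuous f /\ compact (closure [set x | f x != 0])}.

Definition pm_integrals (m : point_measure) : {ptws compactly_supported -> R} :=
  fun f => \int[m]_x sval f x.

(* The vague topology: the coarsest one making all maps m |-> \int f dm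
   continuous, f continuous with compact support *)
HB.instance Definition _ :=
  Topological.copy point_measure (initial_topology pm_integrals).

(* Weak convergence of the laws of xi N, each on its own probability space *)
Definition cvg_in_law
    (disp : nat -> measure_display) (Om : forall N, measurableType (disp N))
    (P : forall N, probability (Om N) R) (xi : forall N, Om N -> point_measure)
    disp' (Om' : measurableType disp') (Q : probability Om' R)
    (eta : Om' -> point_measure) : Prop :=
  forall F : point_measure -> R, continuous F ->
    (exists B : R, forall m, `|F m| <= B) ->
    ('E_(P N)[F \o xi N])%E @[N --> \oo] --> ('E_Q[F \o eta])%E.

(* [poisson_prob r k] does not depend on its argument k. *)
Definition poisson_point_process disp (Om : measurableType disp)
    (Q : probability Om R) (mu : set borel_state -> \bar R)
    (eta : Om -> point_measure) : Prop :=
  [/\ forall A : set borel_state, measurable A ->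
        measurable_fun [set: Om] (fun w => eta w A),
      forall A : set borel_state, measurable A -> (mu A < +oo)%E ->
        forall k : nat, Q [set w | eta w A = k%:R%:E] =
                        poisson_prob (fine (mu A)) 0%N [set k],
      forall A : set borel_state, measurable A -> mu A = +oo%E ->
        Q [set w | eta w A = +oo%E] = 1%E
    & forall n (A : 'I_n -> set borel_state), (forall i, measurable (A i)) ->
        trivIset [set: 'I_n] A -> forall k : 'I_n -> \bar R,
        Q [set w | forall i, eta w (A i) = k i] =
        (\prod_(i < n) Q [set w | eta w (A i) = k i])%E].

Definition cube_cons n (p : measurableTypeR R * n.-tuple R) : n.+1.-tuple R :=
  cons_tuple p.1 p.2.

Lemma measurable_cube_cons n : measurable_fun setT (@cube_cons n).
Proof. exact: measurable_cons. Qed.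

HB.instance Definition _ n :=
  isMeasurableFun.Build _ _ _ _ (@cube_cons n) (@measurable_cube_cons n).

(* Lebesgue measure on [0, 1]^n *)
Fixpoint lebesgue_cube n : probability (n.-tuple R) R :=
  if n is m.+1 then
    distribution (uniform_prob (@ltr01 R) \x lebesgue_cube m)%E
      (@cube_cons m)
  else \d_[tuple].

(* Lebesgue measure on (R/Z)^d x {0}: image of that of [0, 1]^d *)
Definition lebesgue_torus0 (A : set borel_state) : \bar R :=
  lebesgue_cube d [set s : d.-tuple R | A (\row_i mod_Z (tnth s i), 0)].

Section dirac_sum.
Variables (I : finType) (a : pred I) (f : I -> borel_state).

Definition dirac_sum (A : set borel_state) : \bar R :=
  (\sum_(i | a i) \d_(f i) A)%E.

Let dirac_sum0 : dirac_sum set0 = 0%E.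
Proof. by rewrite /dirac_sum big1. Qed.

Let dirac_sum_ge0 A : (0 <= dirac_sum A)%E.
Proof. exact: sume_ge0. Qed.

Let dirac_sum_sigma_additive : semi_sigma_additive dirac_sum.
Proof.
move=> F mF tF mUF; rewrite [X in _ --> X](_ : _ =
    limn (fun n => \sum_(0 <= i < n) dirac_sum (F i))%E).
  by apply: is_cvg_ereal_nneg_natsum => k _; exact: sume_ge0.
rewrite nneseries_sum//; apply: eq_bigr => /= i _.
exact: measure_semi_bigcup.
Qed.

HB.instance Definition _ := isMeasure.Build _ _ _ dirac_sum
  dirac_sum0 dirac_sum_ge0 dirac_sum_sigma_additive.

Lemma dirac_sum_nat A : exists k : nat, dirac_sum A = k%:R%:E.
Proof.
exists (\sum_(i | a i) (f i \in A))%N.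
by rewrite /dirac_sum natr_sum -sumEFin.
Qed.

Lemma dirac_sum_integer A : measurable A ->
  dirac_sum A = +oo%E \/ exists k : nat, dirac_sum A = k%:R%:E.
Proof. by move=> _; right; exact: dirac_sum_nat. Qed.

Lemma dirac_sum_fin (K : set state) : compact K -> (dirac_sum K < +oo)%E.
Proof. by move=> _; have [k ->] := dirac_sum_nat K; exact: ltry. Qed.

Definition dirac_sum_pm : point_measure :=
  PointMeasure dirac_sum_integer dirac_sum_fin.

End dirac_sum.

(* x / N, read modulo Z^d in the first d coordinates *)
Definition rescale N (x : cylinder d N) : borel_state :=
  (\row_i mod_Z ((x.1 ord0 i : nat)%:R / N%:R), x.2%:~R / N%:R).

(* The point process N_N^z, one unit atom x/N for each x in T_N x {0} such that
   L_(H_x) > N^d u(z) *)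
Definition late_points N (z : R) (X : nat -> cylinder d N) : point_measure :=
  dirac_sum_pm
    [pred y : torus d N |
      ((N%:R ^+ d)%:E * level d N z <
       local_time X (hitting_time X (at_zero y)))%E]
    (fun y => rescale (at_zero y)).

End point_processes.

(* Main.v *)
(* Put n = N^d. The event that every point of B is late says that the trace of
   the walk on the zero level avoids B during about g(0) n (log n + z) steps.
   The Green function of the cylinder, minus its average over each slice, gives a
   kernel gamma on T_N with (I - Q) gamma = delta_0 - 1/n for the trace kernel Q,
   where gamma(0) = g(0) up to o(1 / log n) and gamma is small away from 0.
   Hence 1 - a sum_{w in B} gamma(. - w) is, for suitable a, a sub- or a
   supersolution for the trace killed on B.  When the points of B are far apart
   this gives P(B is late) = (1 + o(1)) (e^{-z} / n)^|B|; the other sets B are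
   rarer by a factor n, up to powers of log n, and two nearby points are both late
   with probability O(n^{-1-eps}).  Thus
   sum_{|B| = m} |P(B is late) - (e^{-z} / n)^m| -> 0 for every m, and by
   Bonferroni's inequalities the law of the late set is asymptotic in total
   variation to that of the set of boxes of side 1/N occupied by a Poisson
   process of intensity e^{-z}.  Moving each Poisson point to the corner of its
   box changes the process by a vaguely vanishing amount, so dominated convergence
   gives E F -> E F for every bounded continuous F, with no tightness argument. *)

Require Import Defs.
From HB Require Import structures.
From mathcomp Require Import all_boot all_order all_algebra.
From mathcomp Require Import all_classical all_reals all_analysis measurable_realfun.
From mathcomp Require Import ring lra zify.

Import Order.TTheory GRing.Theory Num.Theory.
Import numFieldNormedType.Exports.

Local Open Scope classical_set_scope.
Local Open Scope ring_scope.

Set Implicit Arguments.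
Unset Strict Implicit.
Unset Printing Implicit Defensive.

(** * Lazy walks on the line and on Z/N *)

(** All heat kernels are those of the walk held still with probability 1/2. A lazy step along an
    axis is a difference of two fair 0-1 steps, so its kernel is an autocorrelation and is maximal
    at 0. Hence [torus_pot] at 0 exceeds every other value by at least 1/2, the contribution of time
    0. This one gap G - 1/2 keeps the test functions positive off B, and it makes a pair of distinct
    points strictly harder to avoid than a single one: charges 1/(2G - 1/2) on both add up to more
    than 1/G. Three inverse square roots, from two horizontal axes and the vertical one, make the
    kernels summable in time; this is where d >= 2 enters. The trace is run for about g(0) n log n
    steps, which amplifies an error in its decay rate by log n, so the potential must be known up to
    o(1 / log n); powers of log N serve as cut-offs for this. A pointwise supersolution bound loses
    a constant factor. The constant 1 is recovered by pairing the test function with the killed walk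
    under the uniform start, where the symmetry of the trace kernel applies and [torus_pot] is small
    on average. *)

Section half_lazy_walk.
Context {R : realType}.

(** Pascal's rule in summed form, the induction step for every binomial average below. *)
Lemma binom_sumS (V : nmodType) (M : nat) (f : nat -> V) :
  \sum_(i < M.+2) f i *+ 'C(M.+1, i) = \sum_(i < M.+1) (f i + f i.+1) *+ 'C(M, i).
Proof.
rewrite big_ord_recl bin0 /=.
under eq_bigr do rewrite /bump /= add1n binS mulrnDr.
rewrite big_split /= addrA.
under [in RHS]eq_bigr do rewrite mulrnDl.
rewrite [RHS]big_split /=; congr +%R.
rewrite big_ord_recr /= bin_small // mulr0n addr0.
by rewrite [RHS]big_ord_recl bin0.
Qed.

Lemma sum_binomial (M : nat) : \sum_(i < M.+1) ('C(M, i)%:R : R) = 2 ^+ M.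
Proof.
elim: M => [|M IH]; first by rewrite big_ord1 bin0.
have := binom_sumS M (fun=> 1 : R); rewrite /= => ->.
by under eq_bigr do rewrite mulrnDl; rewrite big_split /= IH exprS; lra.
Qed.

(** The variance of a sum of M fair signs is M: in the step from M to M + 1 the cross terms
    cancel. *)
Lemma sum_binomial_sqr (M : nat) :
  \sum_(i < M.+1) ('C(M, i)%:R * (M%:R - 2 * i%:R) ^+ 2 : R) = M%:R * 2 ^+ M.
Proof.
elim: M => [|M IH]; first by rewrite big_ord1 /= mulr0 subrr expr0n mulr0 mul0r.
under eq_bigr do rewrite mulr_natl.
rewrite (binom_sumS M (fun i => (M.+1%:R - 2 * i%:R) ^+ 2 : R)).
transitivity (2 * \sum_(i < M.+1) ('C(M, i)%:R * (M%:R - 2 * i%:R) ^+ 2 : R)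
   + 2 * \sum_(i < M.+1) ('C(M, i)%:R : R)).
  rewrite !mulr_sumr -big_split /=; apply: eq_bigr => i _.
  by rewrite -mulr_natl -!natr1; ring.
by rewrite IH sum_binomial exprS -natr1; ring.
Qed.

Lemma sum_binomial_abs (M : nat) : (0 < M)%N ->
  \sum_(i < M.+1) ('C(M, i)%:R * `|M%:R - 2 * i%:R| : R) <=
  Num.sqrt M%:R * 2 ^+ M.
Proof.
move=> M0; set s := Num.sqrt _.
have s0 : 0 < s by rewrite sqrtr_gt0 ltr0n.
have s2 : s ^+ 2 = M%:R by rewrite sqr_sqrtr.
(* AM-GM: |k| <= (k^2 / s + s) / 2 *)
apply: (@le_trans _ _ (\sum_(i < M.+1) ('C(M, i)%:R * (M%:R - 2 * i%:R) ^+ 2 / s / 2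
   + 'C(M, i)%:R * (s / 2)))).
  apply: ler_sum => i _; set v := M%:R - 2 * i%:R; set c := 'C(M, i)%:R.
  have -> : c * v ^+ 2 / s / 2 + c * (s / 2) = c * (v ^+ 2 / s / 2 + s / 2) by ring.
  rewrite ler_wpM2l ?ler0n // -(real_normK (num_real v)).
  have : 0 <= (`|v| - s) ^+ 2 / s / 2 by rewrite !divr_ge0 // ?sqr_ge0 // ltW.
  suff -> : (`|v| - s) ^+ 2 / s / 2 = `|v| ^+ 2 / s / 2 + s / 2 - `|v| by rewrite subr_ge0.
  by field; rewrite gt_eqF.
rewrite big_split /= -!mulr_suml sum_binomial_sqr sum_binomial -s2.
have -> : s ^+ 2 * 2 ^+ M / s / 2 + 2 ^+ M * (s / 2) = s * 2 ^+ M.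
  by field; rewrite gt_eqF.
by [].
Qed.

Context {A : nzRingType}.
Implicit Types (m j : nat) (x y : A).

(** Law of the number of heads in m fair tosses, read in the ring [A]; taking [A] to be the integers
    or Z/N treats the line and the cycle at once. *)
Fixpoint bwalk m x : R :=
  if m is k.+1 then (bwalk k x + bwalk k (x - 1)) / 2 else (x == 0)%:R.

(** Centring 2j tosses gives j steps with law 1/4, 1/2, 1/4 on -1, 0, 1. The even number of
    half-steps is what exhibits the kernel as a convolution square. *)
Definition lazyq j x : R := bwalk j.*2 (x + j%:R).

Lemma bwalk_ge0 m x : 0 <= bwalk m x.
Proof. by elim: m x => //= m IH x; rewrite divr_ge0 // addr_ge0. Qed.

Lemma bwalk_le1 m x : bwalk m x <= 1.
Proof.
elim: m x => [|m IH] x /=; first by case: eqP.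
by have := IH x; have := IH (x - 1); lra.
Qed.

Lemma bwalkE m x :
  bwalk m x = 2^-1 ^+ m * \sum_(i < m.+1) ((i%:R == x)%:R : R) *+ 'C(m, i).
Proof.
elim: m x => [|m IH] x; first by rewrite /= big_ord1 bin0 mul1r eq_sym.
rewrite (binom_sumS m (fun i => (i%:R == x)%:R : R)) /= !IH.
under [in RHS]eq_bigr do rewrite mulrnDl.
rewrite big_split /= -mulrDr exprS mulrC -mulrA; congr (_ * (_ * (_ + _))).
by apply: eq_bigr => i _; rewrite -natr1 eq_sym subr_eq eq_sym.
Qed.

Lemma bwalk_support m x : bwalk m x != 0 -> exists2 i, (i <= m)%N & x = i%:R.
Proof.
elim: m x => [|m IH] x /=.
  by case: (eqVneq x 0) => [-> _|_]; [exists 0%N|rewrite eqxx].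
case: (eqVneq (bwalk m x) 0) => [->|/IH[i im ->] _]; last by exists i => //; apply: leqW.
case: (eqVneq (bwalk m (x - 1)) 0) => [->|/IH[i im xi] _].
  by rewrite addr0 mul0r eqxx.
by exists i.+1 => //; rewrite -natr1 -xi subrK.
Qed.

Lemma bwalk_sym m x : bwalk m (m%:R - x) = bwalk m x.
Proof.
elim: m x => [|m IH] x /=; first by rewrite sub0r oppr_eq0.
rewrite [in RHS]addrC -[in RHS]IH -[bwalk m x]IH.
have -> : m%:R - (x - 1) = m.+1%:R - x by rewrite opprB addrA natr1.
by have -> : m%:R - x = m.+1%:R - x - 1 by rewrite addrAC -natr1 addrK.
Qed.

Lemma lazyq_ge0 j x : 0 <= lazyq j x. Proof. exact: bwalk_ge0. Qed.

Lemma lazyq_le1 j x : lazyq j x <= 1. Proof. exact: bwalk_le1. Qed.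

Lemma lazyq0 x : lazyq 0 x = (x == 0)%:R.
Proof. by rewrite /lazyq /= addr0. Qed.

Lemma lazyqS j x :
  lazyq j.+1 x = lazyq j x / 2 + (lazyq j (x + 1) + lazyq j (x - 1)) / 4.
Proof.
rewrite /lazyq doubleS /=.
have -> : x + j.+1%:R = x + 1 + j%:R by rewrite -addrA nat1r.
have -> : x + 1 + j%:R - 1 = x + j%:R by rewrite addrAC addrK.
have -> : x - 1 + j%:R = x + j%:R - 1 by rewrite addrAC.
by field.
Qed.

Lemma lazyq_support j x : lazyq j x != 0 -> exists2 i, (i <= j.*2)%N & x = i%:R - j%:R.
Proof. by move=> /bwalk_support[i ij e]; exists i => //; rewrite -e addrK. Qed.

End half_lazy_walk.

Lemma sum_delta {R : pzSemiRingType} (T : finType) (c : T) (f : T -> R) :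
  \sum_x (x == c)%:R * f x = f c.
Proof.
rewrite (bigD1 c) //= eqxx mul1r big1 ?addr0 // => i /negbTE ->.
by rewrite mul0r.
Qed.

(** * Spectral gap and heat kernel bounds on the cycle *)

Section cyclic_walk.
Context {R : realType} (N : nat) (N1 : (1 < N)%N).
Local Notation A := ('Z_N).
Implicit Types (f h : A -> R).

Let cardA : #|A| = N. Proof. by rewrite card_ord Zp_cast. Qed.

Let sum_cst (c : R) : \sum_(z : A) c = N%:R * c.
Proof. by rewrite sumr_const; rewrite cardA mulr_natl. Qed.

Lemma reindex_Zp (V : nmodType) (f : A -> V) x :
  \sum_z f z = \sum_(i < N) f (x + i%:R).
Proof.
rewrite (reindex (fun i : 'I_N => x + (i%:R : A))) //=.
exists (fun z : A => Ordinal (leq_trans (ltn_ord (z - x)) (eq_leq (Zp_cast N1)))).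
  move=> i _; apply: val_inj; 
  change (nat_of_ord (x + (i%:R : A) - x) = i).
  by rewrite [x + _]addrC addrK val_Zp_nat // modn_small.
move=> z _; change (x + (nat_of_ord (z - x)%R)%:R = z).
by rewrite natr_Zp addrC subrK.
Qed.

Lemma sumZp_shift (V : nmodType) (f : A -> V) c : \sum_z f (z + c) = \sum_z f z.
Proof. by rewrite [RHS](reindex (fun z => z + c)) //; exists (fun z => z - c) => z _; rewrite ?addrK ?subrK. Qed.

(** Going upwards from y, the point x is reached within N unit steps, so the increments once around
    the cycle dominate the difference. *)
Lemma Zp_variation f x y : f x - f y <= \sum_z `|f (z + 1) - f z|.
Proof.
rewrite (reindex_Zp _ y); set k := val (x - y).
have -> : x = y + k%:R by rewrite /k natr_Zp addrC subrK.
have kN : (k <= N)%N by rewrite -[leqRHS](Zp_cast N1) ltnW // ltn_ord.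
apply: (@le_trans _ _ (\sum_(i < k) `|f (y + i%:R + 1) - f (y + i%:R)|)).
  elim: (k) => [|l IH]; first by rewrite big_ord0 addr0 subrr.
  rewrite big_ord_recr /=.
  have := ler_norm (f (y + l%:R + 1) - f (y + l%:R)).
  by rewrite -natr1 addrA; lra.
rewrite (big_ord_widen N (fun i => `|f (y + i%:R + 1) - f (y + i%:R)|)) //.
by rewrite [leRHS](bigID (fun i : 'I_N => (i < k)%N)) /= lerDl sumr_ge0.
Qed.

(** A function of mean zero is the average over y of h x - h y, hence is bounded by its total
    variation; Cauchy-Schwarz then passes to the Dirichlet form. The constant is crude but has the
    right order N^2. *)
Lemma Zp_poincare h : \sum_z h z = 0 ->
  \sum_z h z ^+ 2 <= N%:R ^+ 2 * \sum_z (h (z + 1) - h z) ^+ 2.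
Proof.
move=> h0; set V := \sum_z `|h (z + 1) - h z|.
have N0 : (0 : R) < N%:R by rewrite ltr0n; apply: ltnW.
have hV x : `|h x| <= V.
  have e : N%:R * h x = \sum_y (h x - h y).
    by rewrite sumrB h0 subr0 sum_cst.
  rewrite ler_norml; apply/andP; split; rewrite -(ler_pM2l N0) e ?mulrN.
    rewrite lerNl -sumrN -sum_cst ler_sum // => y _.
    by rewrite opprB Zp_variation.
  by rewrite -sum_cst ler_sum // => y _; rewrite Zp_variation.
have V2 : V ^+ 2 <= N%:R * \sum_z (h (z + 1) - h z) ^+ 2.
  set a := fun z : A => `|h (z + 1) - h z|.
  have a2 z : (h (z + 1) - h z) ^+ 2 = a z ^+ 2 by rewrite /a real_normK ?num_real.
  under eq_bigr do rewrite a2.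
  (* Cauchy-Schwarz: the variance of [a] is nonnegative *)
  have : 0 <= \sum_z (a z - V / N%:R) ^+ 2 by apply: sumr_ge0 => z _; apply: sqr_ge0.
  have -> : \sum_z (a z - V / N%:R) ^+ 2 = \sum_z a z ^+ 2 - V ^+ 2 / N%:R.
    transitivity (\sum_z (a z ^+ 2 - a z * (2 * V / N%:R) + (V / N%:R) ^+ 2)).
      by apply: eq_bigr => z _; ring.
    rewrite !big_split /= sum_cst sumrN -mulr_suml -/V.
    by field; rewrite gt_eqF.
  by rewrite subr_ge0 ler_pdivrMr // mulrC.
rewrite expr2 -mulrA; apply: (@le_trans _ _ (N%:R * V ^+ 2)).
  rewrite -sum_cst ler_sum // => z _.
  by rewrite -[leLHS]real_normK ?num_real // lerXn2r // nnegrE (le_trans _ (hV z)).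
by rewrite ler_wpM2l // ltW.
Qed.

Local Notation b := (@bwalk R A).
Local Notation q := (@lazyq R A).

Lemma sum_bwalk m : \sum_x b m x = 1.
Proof.
elim: m => [|m IH].
  by rewrite -[RHS](sum_delta (0 : A) (fun=> 1 : R)); apply: eq_bigr => x _; rewrite mulr1.
by rewrite -mulr_suml big_split /= (sumZp_shift (b m)) IH; lra.
Qed.

Lemma bwalk_conv m l x : b (m + l) x = \sum_y b m y * b l (x - y).
Proof.
elim: m x => [|m IH] x.
  by rewrite (sum_delta (0 : A) (fun y => b l (x - y))) subr0.
rewrite addSn; under eq_bigr do rewrite mulrAC mulrDl.
rewrite -mulr_suml big_split /= !IH; congr ((_ + _) / _).
rewrite -[RHS](sumZp_shift _ 1); apply: eq_bigr => y _.
by rewrite addrK opprD addrA addrAC.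
Qed.

(** The symmetry of [bwalk] turns one factor of the convolution into a translate of the other: an
    autocorrelation. *)
Lemma lazyqE j x : q j x = \sum_y b j y * b j (y - x).
Proof.
rewrite /lazyq -addnn bwalk_conv; apply: eq_bigr => y _; congr (_ * _).
by rewrite -[RHS]bwalk_sym opprB addrA [j%:R + x]addrC.
Qed.

(** An autocorrelation is largest at 0: expand the sum of the squares of b y - b (y - x). *)
Lemma lazyq_max j x : q j x <= q j 0.
Proof.
rewrite !lazyqE; under [leRHS]eq_bigr do rewrite subr0.
have : 0 <= \sum_y (b j y - b j (y - x)) ^+ 2 by apply: sumr_ge0 => *; apply: sqr_ge0.
have -> : \sum_y (b j y - b j (y - x)) ^+ 2 =
    \sum_y b j y * b j y + \sum_y b j (y - x) * b j (y - x) - 2 * \sum_y b j y * b j (y - x).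
  by rewrite mulr_sumr -sumrN -!big_split /=; apply: eq_bigr => y _; ring.
by rewrite (sumZp_shift (fun y => b j y * b j y)); lra.
Qed.

Let hN0 : (0 : R) < N%:R. Proof. by rewrite ltr0n; apply: ltnW. Qed.

(** A half-step averages with a translate, so by the parallelogram law the squared norm loses a
    quarter of the Dirichlet form, at least the fraction 1 / (4 N^2) by [Zp_poincare]. Being an
    autocorrelation, the deviation of q j is at most the squared norm after j half-steps. *)
Lemma lazyq_mixing j x :
  `|q j x - N%:R^-1| <= (1 - (4 * N%:R ^+ 2)^-1) ^+ j.
Proof.
pose h m y := b m y - N%:R^-1.
have sh m : \sum_y h m y = 0.
  by rewrite sumrB sum_bwalk sum_cst mulfV ?subrr // gt_eqF.
have sh' m c : \sum_y h m (y - c) = 0 by rewrite (sumZp_shift (h m)) sh.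
have hS m y : h m.+1 y = (h m y + h m (y - 1)) / 2 by rewrite /h /=; field; rewrite gt_eqF.
have decay m : \sum_y h m y ^+ 2 <= (1 - (4 * N%:R ^+ 2)^-1) ^+ m.
  have r0 : 0 <= 1 - (4 * N%:R ^+ 2)^-1 :> R.
    rewrite subr_ge0 invf_le1 ?mulr_gt0 ?exprn_gt0 //.
    have : (1 : R) <= N%:R by rewrite ler1n; apply: ltnW.
    by nra.
  elim: m => [|m IH].
    have -> : \sum_y h 0%N y ^+ 2 = \sum_y (b 0 y * h 0%N y) - N%:R^-1 * \sum_y h 0%N y.
      by rewrite mulr_sumr -sumrN -big_split /=; apply: eq_bigr => y _; rewrite /h; ring.
    rewrite sh mulr0 subr0 (sum_delta (0 : A) (h 0%N)).
    by rewrite expr0 /h /bwalk eqxx gerBl invr_ge0 ltW.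
  rewrite exprSr; apply: le_trans (ler_wpM2r r0 IH).
  have := Zp_poincare (sh m).
  rewrite -[X in _ <= _ * X](sumZp_shift _ (-1)).
  under [X in _ <= _ * X -> _]eq_bigr do rewrite subrK.
  set E := \sum_y (h m y - h m (y - 1)) ^+ 2; set Y := \sum_y h m y ^+ 2 => poinc.
  (* parallelogram law *)
  have -> : \sum_y h m.+1 y ^+ 2 = Y - E / 4.
    transitivity ((Y + \sum_y h m (y - 1) ^+ 2) / 2 - E / 4); last first.
      by rewrite (sumZp_shift (fun y => h m y ^+ 2)) -/Y; lra.
    rewrite -big_split /= !mulr_suml -sumrB.
    by apply: eq_bigr => y _; rewrite hS; field.
  rewrite mulrBr mulr1 lerD2l lerN2 ler_pdivrMr ?mulr_gt0 ?exprn_gt0 //.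
  by apply: le_trans poinc _; rewrite le_eqVlt; apply/orP; left; apply/eqP; field.
have -> : q j x - N%:R^-1 = \sum_y h j y * h j (y - x).
  transitivity (\sum_y (b j y * b j (y - x)) - N%:R^-1 * \sum_y b j y
     - N%:R^-1 * \sum_y h j (y - x)).
    by rewrite lazyqE sum_bwalk sh'; ring.
  rewrite !mulr_sumr -!sumrN -!big_split /=; apply: eq_bigr => y _.
  by rewrite /h; ring.
apply: le_trans (decay j).
have e2 : \sum_y h j y ^+ 2 = \sum_y (h j y ^+ 2 + h j (y - x) ^+ 2) / 2.
  rewrite -mulr_suml big_split /= (sumZp_shift (fun y => h j y ^+ 2)); lra.
rewrite e2; apply: le_trans (ler_norm_sum _ _ _) _; apply: ler_sum => y _.
rewrite normrM -[X in _ <= (X + _) / _]real_normK ?num_real //.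
rewrite -[X in _ <= (_ + X) / _]real_normK ?num_real //.
by have := sqr_ge0 (`|h j y| - `|h j (y - x)|); nra.
Qed.

(** The increments of a binomial row are C(m+1, i) (m + 1 - 2i) / (m + 1), so the total variation is
    governed by the first absolute moment of a centred binomial. Folding onto Z/N can only decrease
    it, whence a bound free of N. *)
Lemma bwalk_oscillation m x y : b m x - b m y <= 2 / Num.sqrt m.+1%:R.
Proof.
apply: le_trans (Zp_variation _ _ _) _.
pose a i : R := 'C(m.+1, i)%:R * (m.+1%:R - 2 * i%:R) / m.+1%:R.
have diff z : b m z - b m (z - 1) =
    2^-1 ^+ m * \sum_(i < m.+2) ((i%:R == z)%:R * a i).
  rewrite !bwalkE -mulrBr; congr (_ * _).
  have aE i : a i = 'C(m, i)%:R - (if i is k.+1 then 'C(m, k)%:R else 0).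
    rewrite /a; case: i => [|k]; first by rewrite !bin0 mulr0 !subr0 mul1r mulfV ?pnatr_eq0.
    have := mul_bin_diag m.+1 k; rewrite /= binS => /(congr1 (fun n => n%:R : R)).
    rewrite !natrM natrD => e; apply/(canLR (mulfK _)) => //.
    have k0 : (k.+1%:R : R) != 0 by [].
    have : ('C(m, k.+1)%:R + 'C(m, k)%:R) * k.+1%:R = m.+1%:R * 'C(m, k)%:R :> R by rewrite e mulrC.
    by move: ('C(m, k.+1)%:R) ('C(m, k)%:R) (k.+1%:R) (m.+1%:R) => u v w t h; rewrite mulrBr [_ * (2 * w)]mulrCA h; ring.
  under [RHS]eq_bigr do rewrite aE mulrBr.
  rewrite sumrB; congr (_ - _).
    by rewrite [RHS]big_ord_recr /= bin_small // mulr0 addr0; apply: eq_bigr => i _; rewrite mulr_natr.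
  rewrite [RHS]big_ord_recl /= mulr0 add0r; apply: eq_bigr => i _.
  by rewrite mulr_natr /bump add1n -natr1 eq_sym subr_eq eq_sym.
rewrite -(sumZp_shift _ (-1)); under eq_bigr do rewrite subrK diff normrM.
rewrite -mulr_sumr ger0_norm ?exprn_ge0 ?invr_ge0 //.
apply: (@le_trans _ _ (2^-1 ^+ m * \sum_(i < m.+2) `|a i|)).
  rewrite ler_wpM2l ?exprn_ge0 ?invr_ge0 //.
  apply: (@le_trans _ _ (\sum_z \sum_(i < m.+2) (i%:R == z)%:R * `|a i|)).
    apply: ler_sum => z _; apply: le_trans (ler_norm_sum _ _ _) _.
    by apply: ler_sum => i _; rewrite normrM ger0_norm.
  rewrite exchange_big /=; apply: ler_sum => i _.
  rewrite -mulr_suml (bigD1 i%:R) //= eqxx big1 ?addr0 ?mul1r // => z.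
  by rewrite eq_sym => /negbTE ->.
under eq_bigr do rewrite normrM normrM normfV !normr_nat.
rewrite -mulr_suml.
have := @sum_binomial_abs R m.+1 isT.
set S := \sum_(i < _) _; set s := Num.sqrt _ => hS.
have s0 : 0 < s by rewrite sqrtr_gt0 ltr0n.
have s2 : s ^+ 2 = m.+1%:R by rewrite sqr_sqrtr.
apply: (@le_trans _ _ (2^-1 ^+ m * (s * 2 ^+ m.+1 / m.+1%:R))).
  by rewrite ler_wpM2l ?exprn_ge0 ?invr_ge0 // ler_wpM2r.
rewrite -s2 exprS exprVn le_eqVlt; apply/orP; left; apply/eqP.
by field; rewrite expf_neq0 //= gt_eqF.
Qed.

(** The kernel has mean 1/N, so no value exceeds 1/N by more than the oscillation. *)
Lemma lazyq_bound j x : q j x <= N%:R^-1 + 2 / Num.sqrt j.+1%:R.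
Proof.
set y0 := x + j%:R.
have h : N%:R * (q j x) - 1 <= N%:R * (2 / Num.sqrt j.*2.+1%:R).
  rewrite -(sum_cst (q j x)) -[X in _ - X](sum_bwalk j.*2) -sumrB.
  rewrite -sum_cst ler_sum // => y _.
  exact: bwalk_oscillation.
have : 2 / Num.sqrt j.*2.+1%:R <= 2 / Num.sqrt j.+1%:R :> R.
  rewrite ler_wpM2l // lef_pV2 ?posrE ?sqrtr_gt0 ?ltr0n // ler_sqrt ?ler0n //.
  by rewrite ler_nat ltnS -addnn leq_addr.
move=> h2; rewrite -lerBlDl -(ler_pM2l hN0) mulrBr mulfV ?gt_eqF //.
by apply: le_trans h _; rewrite ler_pM2l.
Qed.

End cyclic_walk.

(** * Step counts along the axes *)

Section words.
Context {R : realType} {I : finType}.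
Implicit Types (c : I -> nat) (F G H : (I -> nat) -> R).

Definition inc c (i : I) : I -> nat := fun j => (c j + (j == i))%N.

(* Average of [F] over the letter counts of a uniform word of length t in the
   alphabet I: the joint law of the number of steps made along each axis. *)
Fixpoint word_avg (t : nat) F : R :=
  if t is s.+1 then #|I|%:R^-1 * \sum_i word_avg s (fun c => F (inc c i))
  else F (fun=> 0%N).

Lemma incC c i j : inc (inc c i) j = inc (inc c j) i.
Proof. by apply/funext => k; rewrite /inc addnAC. Qed.

Lemma word_avg_sum t (J : finType) (F : J -> (I -> nat) -> R) :
  word_avg t (fun c => \sum_j F j c) = \sum_j word_avg t (F j).
Proof.
elim: t F => //= t IH F.
under eq_bigr do rewrite IH.
by rewrite exchange_big /= mulr_sumr.
Qed.

Lemma word_avgD t F G :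
  word_avg t (fun c => F c + G c) = word_avg t F + word_avg t G.
Proof.
elim: t F G => //= t IH F G.
by under eq_bigr do rewrite IH; rewrite big_split mulrDr.
Qed.

Lemma word_avgZ t a F : word_avg t (fun c => a * F c) = a * word_avg t F.
Proof.
elim: t F => //= t IH F.
by under eq_bigr do rewrite IH; rewrite -mulr_sumr mulrCA.
Qed.

Lemma word_avgB t F G :
  word_avg t (fun c => F c - G c) = word_avg t F - word_avg t G.
Proof.
rewrite -mulN1r -word_avgZ -word_avgD; congr word_avg.
by apply/funext => c; rewrite mulN1r.
Qed.

Lemma ler_word_avg t F G :
  (forall c, (forall i, (c i <= t)%N) -> F c <= G c) -> word_avg t F <= word_avg t G.
Proof.
elim: t F G => [|t IH] F G FG /=; first exact: FG.
rewrite ler_wpM2l // ler_sum // => i _; apply: IH => c ct; apply: FG => j.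
by rewrite /inc (leq_trans (leq_add (ct j) (leq_b1 _))) // addn1.
Qed.

Lemma word_avg_ge0 t F : (forall c, 0 <= F c) -> 0 <= word_avg t F.
Proof.
elim: t F => [|t IH] F F0 /=; first exact: F0.
by rewrite mulr_ge0 // sumr_ge0 // => i _; apply: IH => c.
Qed.

Hypothesis I0 : (0 < #|I|)%N.
Let D0 : (0 : R) < #|I|%:R. Proof. by rewrite ltr0n. Qed.

Lemma word_avg_cst t a : word_avg t (fun=> a) = a.
Proof.
elim: t => //= t ->.
by rewrite sumr_const -[a *+ _]mulr_natl mulrA mulVf ?mul1r // gt_eqF.
Qed.

Lemma word_avg_norm t F : `|word_avg t F| <= word_avg t (fun c => `|F c|).
Proof.
rewrite ler_norml -mulN1r -word_avgZ; apply/andP; split.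
  by apply: ler_word_avg => c _; rewrite mulN1r lerNl -normrN ler_norm.
by apply: ler_word_avg => c _; apply: ler_norm.
Qed.

(** Generating function of a binomial count: each letter equals i with probability 1 / #|I|. It
    converts contraction per step along one axis into contraction per step of the walk. *)
Lemma word_avg_geometric t (r : R) i :
  word_avg t (fun c => r ^+ c i) = (1 - (1 - r) / #|I|%:R) ^+ t.
Proof.
elim: t => [|t IH] //=.
under eq_bigr => j _.
  rewrite (_ : (fun c => _) = (fun c => (if i == j then r else 1) * r ^+ c i)); last first.
    by apply/funext => c; rewrite /inc exprD mulrC; case: eqP; rewrite ?expr1 ?expr0.
  rewrite word_avgZ IH; over.
rewrite -mulr_suml exprS mulrA; congr (_ * _).
rewrite (bigD1 i) //= eqxx (eq_bigr (fun=> 1)); last first.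
  by move=> j; rewrite eq_sym => /negbTE ->.
have -> : \sum_(j | j != i) (1 : R) = #|I|%:R - 1.
  by rewrite sumr_const cardC1 -subn1 natrB.
by field; rewrite gt_eqF.
Qed.

(* Removing a marked letter [i] from a word *)
Lemma word_avg_mark t i H :
  word_avg t.+1 (fun c => (c i)%:R * H c) =
  t.+1%:R / #|I|%:R * word_avg t (fun c => H (inc c i)).
Proof.
have step s K : word_avg s.+1 (fun c => (c i)%:R * K c) =
    #|I|%:R^-1 * \sum_j word_avg s (fun c => (c i)%:R * K (inc c j)) +
    #|I|%:R^-1 * word_avg s (fun c => K (inc c i)).
  rewrite /= -mulrDr; congr (_ * _).
  rewrite (bigD1 i) //= [in RHS](bigD1 i) //= addrAC -word_avgD; congr (_ + _).
    by congr word_avg; apply/funext => c; rewrite {1}/inc eqxx natrD mulrDl mul1r.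
  apply: eq_bigr => j ji; congr word_avg; apply/funext => c.
  by rewrite {1}/inc eq_sym (negbTE ji) addn0.
elim: t H => [|t IH] H; rewrite step.
  by rewrite big1 ?mulr0 ?add0r ?mul1r // => j _; rewrite /= mul0r.
under eq_bigr do rewrite IH.
rewrite -mulr_sumr mulrCA -[t.+2%:R]natr1 mulrDl mulrDl mul1r; congr (_ * _ + _).
by rewrite /=; congr (_ * _); apply: eq_bigr => j _; congr word_avg; apply/funext => c; rewrite incC.
Qed.

(** Size biasing: the marking identity is applied to F c / c i, and words without the letter i only
    lose mass on the left-hand side. *)
Lemma word_avg_inv t i F : (forall c, 0 <= F c) -> (forall c, F (inc c i) = F c) ->
  word_avg t (fun c => (c i).+1%:R^-1 * F c) <= #|I|%:R / t.+1%:R * word_avg t.+1 F.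
Proof.
move=> F0 Fi.
have := word_avg_mark t i (fun c => (c i)%:R^-1 * F c).
rewrite (_ : (fun c => (inc c i i)%:R^-1 * F (inc c i)) = (fun c => (c i).+1%:R^-1 * F c)); last first.
  by apply/funext => c; rewrite Fi /inc eqxx addn1.
move=> e; set E := word_avg t _ in e *.
have -> : E = #|I|%:R / t.+1%:R * (t.+1%:R / #|I|%:R * E).
  by field; rewrite gt_eqF //= addrC natr1 pnatr_eq0.
rewrite -e ler_wpM2l //; apply: ler_word_avg => c _.
have [->|ci] := eqVneq (c i) 0%N; first by rewrite mul0r.
by rewrite mulrA mulfV ?mul1r // pnatr_eq0.
Qed.

(** With s = (t + 1)^(3/2), AM-GM gives xyz <= (s / 2) (xyz)^2 + 1 / (2s). Squaring removes the
    roots, and three uses of [word_avg_inv] bound the mean of the remaining product. The exponent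
    3/2 > 1 makes the heat kernel summable. *)
Lemma word_avg_sqrt3 t i j k : i != j -> i != k -> j != k ->
  word_avg t (fun c => (Num.sqrt (c i).+1%:R)^-1 * (Num.sqrt (c j).+1%:R)^-1 *
                       (Num.sqrt (c k).+1%:R)^-1) <=
  #|I|%:R ^+ 3 / (t.+1%:R * Num.sqrt t.+1%:R).
Proof.
move=> ij ik jk; set w := Num.sqrt _; set s := _ * w.
have sq n : (Num.sqrt n.+1%:R) ^+ 2 = n.+1%:R :> R by rewrite sqr_sqrtr.
have sq0 n : 0 < Num.sqrt n.+1%:R :> R by rewrite sqrtr_gt0 ltr0n.
have inv2 n : (n.+1%:R : R)^-1 = (Num.sqrt n.+1%:R)^-1 ^+ 2 by rewrite exprVn sq.
have t0 : (0 : R) < t.+1%:R by rewrite ltr0n.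
have s0 : 0 < s by apply: mulr_gt0 => //; apply: sq0.
have D1 : (1 : R) <= #|I|%:R by rewrite ler1n.
have inv n : (n.+1%:R : R)^-1 >= 0 by [].
have E : word_avg t (fun c => (c i).+1%:R^-1 * ((c j).+1%:R^-1 * (c k).+1%:R^-1)) <=
    #|I|%:R ^+ 3 / t.+1%:R ^+ 3.
  have e0 : word_avg t (fun c => (c i).+1%:R^-1 * ((c j).+1%:R^-1 * (c k).+1%:R^-1)) <=
      #|I|%:R / t.+1%:R * word_avg t.+1 (fun c => (c j).+1%:R^-1 * (c k).+1%:R^-1).
    apply: (@word_avg_inv t i (fun c => (c j).+1%:R^-1 * (c k).+1%:R^-1)) => c.
      by rewrite mulr_ge0.
    by rewrite /inc ![_ == i]eq_sym (negbTE ij) (negbTE ik) !addn0.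
  apply: le_trans e0 _.
  have e1 : word_avg t.+1 (fun c => (c j).+1%:R^-1 * (c k).+1%:R^-1) <= #|I|%:R / t.+2%:R * word_avg t.+2 (fun c => (c k).+1%:R^-1).
    apply: (@word_avg_inv t.+1 j (fun c => (c k).+1%:R^-1)) => c //.
    by rewrite /inc eq_sym (negbTE jk) addn0.
  have e2 : word_avg t.+2 (fun c => (c k).+1%:R^-1) <= #|I|%:R / t.+3%:R.
    rewrite (_ : (fun c => _) = (fun c => (c k).+1%:R^-1 * 1)); last by apply/funext => c; rewrite mulr1.
    have := @word_avg_inv t.+2 k (fun=> 1); rewrite word_avg_cst mulr1; exact.
  have dec n : (t <= n)%N -> #|I|%:R / n.+1%:R <= #|I|%:R / t.+1%:R :> R.
    by move=> tn; rewrite ler_wpM2l // lef_pV2 ?posrE ?ltr0n // ler_nat.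
  have nn n : 0 <= #|I|%:R / n.+1%:R :> R by rewrite divr_ge0.
  have e12 : word_avg t.+1 (fun c => (c j).+1%:R^-1 * (c k).+1%:R^-1) <= (#|I|%:R / t.+1%:R) ^+ 2.
    apply: le_trans e1 _; rewrite expr2 ler_pM ?dec //.
      by apply: word_avg_ge0 => c.
    by apply: le_trans e2 _; rewrite dec // leqW.
  by rewrite -expr_div_n [leRHS]exprS ler_wpM2l.
apply: (@le_trans _ _ (word_avg t (fun c => s / 2 * ((c i).+1%:R^-1 * ((c j).+1%:R^-1 * (c k).+1%:R^-1)) + (2 * s)^-1))).
  apply: ler_word_avg => c _; rewrite (inv2 (c i)) (inv2 (c j)) (inv2 (c k)).
  move: (_^-1) (_^-1) (_^-1) => x y z.
  have : 0 <= (s * (x * y * z) - 1) ^+ 2 / (2 * s) by rewrite divr_ge0 ?sqr_ge0 // mulr_ge0 // ltW.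
  move=> h; rewrite -subr_ge0; apply: le_trans h _.
  by rewrite le_eqVlt; apply/orP; left; apply/eqP; field; exact: lt0r_neq0.
rewrite word_avgD word_avg_cst word_avgZ.
apply: (@le_trans _ _ (s / 2 * (#|I|%:R ^+ 3 / t.+1%:R ^+ 3) + (2 * s)^-1)).
  by rewrite lerD2r ler_wpM2l // divr_ge0 // ltW.
have s2 : s ^+ 2 = t.+1%:R ^+ 3 by rewrite /s exprMn sq -exprSr.
rewrite -s2; have -> : s / 2 * (#|I|%:R ^+ 3 / s ^+ 2) + (2 * s)^-1 = (#|I|%:R ^+ 3 + 1) / 2 / s.
  by field; exact: lt0r_neq0.
rewrite ler_wpM2r ?invr_ge0 ?(ltW s0) //.
have : 1 <= #|I|%:R ^+ 3 :> R by rewrite exprn_ege1.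
by lra.
Qed.

End words.

(** * Heat kernel and potential of the cylinder *)

Lemma sum_option (V : nmodType) (I : finType) (F : option I -> V) :
  \sum_i F i = F None + \sum_i F (Some i).
Proof.
rewrite (bigD1 None) //=; congr (_ + _).
rewrite (reindex_omap Some id) /=; last by case.
by apply: eq_bigl => i; rewrite eqxx.
Qed.

Lemma ler_prod_diff {R : realFieldType} (I : finType) (a b : I -> R) :
  (forall i, 0 <= a i <= 1) -> (forall i, 0 <= b i <= 1) ->
  `|\prod_i a i - \prod_i b i| <= \sum_i `|a i - b i|.
Proof.
move=> ha hb.
suff : [/\ `|\prod_i a i - \prod_i b i| <= \sum_i `|a i - b i|,
   0 <= \prod_i a i <= 1 & 0 <= \prod_i b i <= 1] by case.
apply: (big_ind3 (fun x y z => [/\ `|x - y| <= z, 0 <= x <= 1 & 0 <= y <= 1])).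
- by split; rewrite ?subrr ?normr0 ?lexx ?ler01.
- move=> x1 y1 z1 x2 y2 z2 [h1 /andP[x10 x11] /andP[y10 y11]] [h2 /andP[x20 x21] /andP[y20 y21]].
  rewrite !mulr_ge0 // !mulr_ile1 //; split => //.
  have -> : x1 * x2 - y1 * y2 = (x1 - y1) * x2 + y1 * (x2 - y2) by ring.
  apply: le_trans (ler_normD _ _) _; rewrite !normrM (ger0_norm x20) (ger0_norm y10).
  by apply: lerD; [apply: le_trans h1; rewrite ler_piMr|apply: le_trans h2; rewrite ler_piMl].
- by move=> i _.
Qed.

Section product_heat_kernel.
Context {R : realType} {A : nzRingType} (d : nat).
Implicit Types (x : 'rV[A]_d) (h : int) (c : option 'I_d -> nat).

Definition axis_prod x c : R := \prod_i lazyq (c (Some i)) (x 0 i).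

(** Kernel of the lazy walk on A^d x Z: each step picks one of the d + 1 axes uniformly and makes a
    lazy step along it, so that given the axis counts the coordinates are independent. [None] is the
    vertical axis. *)
Definition cyl_heat t x h : R :=
  word_avg t (fun c => axis_prod x c * lazyq (c None) h).

Definition vert_heat t h : R := word_avg t (fun c : option 'I_d -> nat => lazyq (c None) h).

(* One step of simple random walk on A^d x Z *)
Definition cyl_avg (f : 'rV[A]_d -> int -> R) x h : R :=
  (\sum_i (f (x + delta_mx 0 i) h + f (x - delta_mx 0 i) h) +
   (f x (h + 1) + f x (h - 1))) / (2 * d.+1%:R).

Lemma axis_prod_ge0 x c : 0 <= axis_prod x c.
Proof. by apply: prodr_ge0 => i _; apply: lazyq_ge0. Qed.

Lemma axis_prod_inc x c i :
  axis_prod x (inc c (Some i)) = axis_prod x c / 2 +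
    (axis_prod (x + delta_mx 0 i) c + axis_prod (x - delta_mx 0 i) c) / 4.
Proof.
rewrite /axis_prod !(bigD1 i (P := predT)) //= /inc eqxx addn1 lazyqS !mxE !eqxx /=.
set r := \prod_(j < d | j != i) lazyq (c (Some j)) (x 0 j).
have -> : \prod_(j < d | j != i) lazyq (c (Some j) + (Some j == Some i))%N (x 0 j) = r.
  by apply: eq_bigr => j /negbTE ji; rewrite (_ : Some j == Some i = (j == i)) // ji addn0.
have -> : \prod_(j < d | j != i) lazyq (c (Some j)) ((x + delta_mx 0 i) 0 j) = r.
  by apply: eq_bigr => j /negbTE ji; rewrite !mxE eqxx ji /= addr0.
have -> : \prod_(j < d | j != i) lazyq (c (Some j)) ((x - delta_mx 0 i) 0 j) = r.
  by apply: eq_bigr => j /negbTE ji; rewrite !mxE eqxx ji /= subr0.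
by field.
Qed.

Lemma axis_prod_incN x c : axis_prod x (inc c None) = axis_prod x c.
Proof. by apply: eq_bigr => i _; rewrite /inc addn0. Qed.

Let cardI : #|{: option 'I_d}| = d.+1. Proof. by rewrite card_option card_ord. Qed.
Let I0 : (0 < #|{: option 'I_d}|)%N. Proof. by rewrite cardI. Qed.

Lemma cyl_heat_ge0 t x h : 0 <= cyl_heat t x h.
Proof. by apply: word_avg_ge0 => c; rewrite mulr_ge0 ?axis_prod_ge0 ?lazyq_ge0. Qed.

Lemma vert_heat_ge0 t h : 0 <= vert_heat t h.
Proof. by apply: word_avg_ge0 => c; rewrite lazyq_ge0. Qed.

Lemma vert_heat_le1 t h : vert_heat t h <= 1.
Proof.
rewrite -[leRHS](word_avg_cst I0 t); apply: ler_word_avg => c _.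
exact: lazyq_le1.
Qed.

Lemma cyl_heat0 x h : cyl_heat 0 x h = ((x == 0) && (h == 0))%:R.
Proof.
rewrite /cyl_heat /= lazyq0 -mulnb natrM; congr (_ * _).
rewrite /axis_prod; case: (eqVneq x 0) => [->|].
  by rewrite big1 // => i _; rewrite lazyq0 mxE eqxx.
move=> /rV0Pn[i xi]; rewrite (bigD1 i) //= lazyq0.
by rewrite (negbTE xi) mul0r.
Qed.

Lemma cyl_heatS t x h :
  cyl_heat t.+1 x h = (cyl_heat t x h + cyl_avg (cyl_heat t) x h) / 2.
Proof.
rewrite {1}/cyl_heat /= sum_option cardI.
have -> : word_avg t (fun c => axis_prod x (inc c None) * lazyq (inc c None None) h) =
    cyl_heat t x h / 2 + (cyl_heat t x (h + 1) + cyl_heat t x (h - 1)) / 4.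
  rewrite /cyl_heat -word_avgD !(mulrC _ 2^-1) !(mulrC _ 4^-1) -!word_avgZ -word_avgD.
  congr word_avg; apply/funext => c; rewrite axis_prod_incN /inc eqxx addn1 lazyqS.
  by field.
have E i : word_avg t (fun c => axis_prod x (inc c (Some i)) * lazyq (inc c (Some i) None) h) =
    cyl_heat t x h / 2 + (cyl_heat t (x + delta_mx 0 i) h + cyl_heat t (x - delta_mx 0 i) h) / 4.
  rewrite /cyl_heat -word_avgD !(mulrC _ 2^-1) !(mulrC _ 4^-1) -!word_avgZ -word_avgD.
  congr word_avg; apply/funext => c; rewrite axis_prod_inc {1}/inc addn0.
  by field.
under eq_bigr do rewrite E.
rewrite big_split /= sumr_const card_ord -mulr_suml -mulr_natl /cyl_avg.
by rewrite -natr1; field; rewrite natr1 pnatr_eq0.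
Qed.

Lemma vert_heatS t h :
  vert_heat t.+1 h = (vert_heat t h + cyl_avg (fun=> vert_heat t) 0 h) / 2.
Proof.
rewrite {1}/vert_heat /= sum_option cardI.
have -> : word_avg t (fun c : option 'I_d -> nat => lazyq (inc c None None) h) =
    vert_heat t h / 2 + (vert_heat t (h + 1) + vert_heat t (h - 1)) / 4.
  rewrite /vert_heat -word_avgD !(mulrC _ 2^-1) !(mulrC _ 4^-1) -!word_avgZ -word_avgD.
  congr word_avg; apply/funext => c; rewrite /inc eqxx addn1 lazyqS.
  by field.
have E i : word_avg t (fun c : option 'I_d -> nat => lazyq (inc c (Some i) None) h) = vert_heat t h.
  by congr word_avg; apply/funext => c; rewrite /inc addn0.
under eq_bigr do rewrite E.
rewrite /cyl_avg !sumr_const card_ord -2!mulr_natl.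
by rewrite -natr1; field; rewrite natr1 pnatr_eq0.
Qed.

(** Sup-norm ball around 0, written through natural numbers so that it keeps a meaning in Z/N. *)
Definition in_box (r : nat) x : Prop :=
  forall i, exists2 k, (k <= r.*2)%N & x 0 i = k%:R - r%:R.

Lemma cyl_heat_support r t x h : (t <= r)%N -> ~ in_box r x -> cyl_heat t x h = 0.
Proof.
move=> tr nx; apply/eqP; rewrite eq_le cyl_heat_ge0 andbT.
rewrite -[leRHS](word_avg_cst I0 t); apply: ler_word_avg => c ct.
suff -> : axis_prod x c = 0 by rewrite mul0r.
apply/eqP/negPn/negP => /prodf_neq0 h0; apply: nx => i.
have /lazyq_support[k kc ->] := h0 i isT.
exists (k + (r - c (Some i)))%N; last first.
  rewrite natrD natrB ?(leq_trans (ct _)) //.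
  by rewrite addrA addrAC addrK.
move: (ct (Some i)) kc tr; move: (c (Some i)) => m; lia.
Qed.

End product_heat_kernel.
Arguments vert_heat {R} d t h.
Arguments axis_prod {R A d} x c.
Arguments cyl_heat {R A d} t x h.

(** * Decay of the heat kernel and tails of series *)

Section kernel_decay.
Context {R : realType}.

Lemma Zp_natr_eq N i j : (1 < N)%N -> (i <= j.*2)%N -> (j < N)%N ->
  ((i%:R : 'Z_N) == j%:R) = (i == j).
Proof.
move=> N1 ij jN; apply/eqP/eqP => [|->//].
move=> /(congr1 (@nat_of_ord _)); rewrite !val_Zp_nat // (modn_small jN) => e.
have := divn_eq i N; rewrite e; case: (i %/ N)%N => [|k]; first by rewrite mul0n.
by rewrite mulSn; nia.
Qed.

(** The number i of heads satisfies |i - j| <= j < N, so i and j agree modulo N only if they are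
    equal. *)
Lemma lazyq_wrap N j : (1 < N)%N -> (j < N)%N ->
  lazyq j (0 : 'Z_N) = lazyq j (0 : int) :> R.
Proof.
move=> N1 jN; rewrite /lazyq !bwalkE !add0r; congr (_ * _).
apply: eq_bigr => i _; rewrite eqr_nat Zp_natr_eq // -ltnS; exact: ltn_ord.
Qed.

(** A cycle of length j + 2 is not noticed by j lazy steps, so the bound on the cycle applies; its
    term 1 / (j + 2) is absorbed by raising the constant from 2 to 3. *)
Lemma lazyq_int_bound j : lazyq j (0 : int) <= 3 / Num.sqrt j.+1%:R :> R.
Proof.
rewrite -(@lazyq_wrap j.+2) //; apply: le_trans (lazyq_bound _ _ _) _ => //.
set s : R := Num.sqrt _.
have s1 : 1 <= s by rewrite -sqrtr1 ler_sqrt ?ltr0n // ler1n.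
have s2 : s ^+ 2 = j.+1%:R by rewrite sqr_sqrtr.
suff h : (j.+2%:R : R)^-1 <= s^-1.
  have -> : 3 / s = s^-1 + 2 / s by rewrite -[X in _ = X + _]mul1r -mulrDl.
  by rewrite lerD2r.
rewrite lef_pV2 ?posrE ?ltr0n //; last by rewrite (lt_le_trans ltr01).
rewrite (@le_trans _ _ (j.+1%:R)) ?ler_nat //.
by rewrite -s2 expr2 ler_peMl // (le_trans ler01).
Qed.

(** Two horizontal axes and the vertical one supply the three inverse roots; the other coordinates
    are bounded by 1. [K] is left free: it is 3 on the lattice, while on the torus it must grow to
    absorb the floor 1/N of the kernel. *)
Lemma cyl_heat_decay {A : nzRingType} d t (x : 'rV[A]_d) (K : R) : (2 <= d)%N -> 0 <= K ->
  (forall i c, (c <= t)%N -> lazyq c (x 0 i) <= K / Num.sqrt c.+1%:R) ->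
  cyl_heat t x 0 <= 3 * K ^+ 2 * d.+1%:R ^+ 3 / (t.+1%:R * Num.sqrt t.+1%:R).
Proof.
move=> d2 K0 hK.
have d0 : (0 < d)%N by apply: leq_trans d2.
pose i0 : 'I_d := Ordinal d0; pose i1 : 'I_d := Ordinal d2.
have i01 : i1 != i0 by [].
have s0 n : 0 <= (Num.sqrt n%:R)^-1 :> R by rewrite invr_ge0.
apply: (@le_trans _ _ (word_avg t (fun c : option 'I_d -> nat => 3 * K ^+ 2 *
   ((Num.sqrt (c (Some i0)).+1%:R)^-1 * (Num.sqrt (c (Some i1)).+1%:R)^-1 *
    (Num.sqrt (c None).+1%:R)^-1)))).
  apply: ler_word_avg => c ct.
  have h0 := hK i0 _ (ct (Some i0)); have h1 := hK i1 _ (ct (Some i1)).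
  have hN := lazyq_int_bound (c None).
  have : axis_prod x c <= lazyq (c (Some i0)) (x 0 i0) * lazyq (c (Some i1)) (x 0 i1) :> R.
    rewrite /axis_prod (bigD1 i0) //= (bigD1 i1) //= mulrA.
    rewrite ler_piMr ?mulr_ge0 ?lazyq_ge0 //.
    by apply: prodr_ile1 => i _; rewrite lazyq_ge0 lazyq_le1.
  move=> hx; apply: (@le_trans _ _ (K / Num.sqrt (c (Some i0)).+1%:R *
    (K / Num.sqrt (c (Some i1)).+1%:R) * (3 / Num.sqrt (c None).+1%:R))).
    apply: ler_pM => //; [exact: axis_prod_ge0|exact: lazyq_ge0|].
    by apply: le_trans hx _; apply: ler_pM => //; exact: lazyq_ge0.
  by rewrite le_eqVlt; apply/orP; left; apply/eqP; ring.
rewrite word_avgZ -[leRHS]mulrA ler_wpM2l ?mulr_ge0 ?exprn_ge0 //.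
rewrite -(_ : #|{: option 'I_d}| = d.+1); last by rewrite card_option card_ord.
apply: word_avg_sqrt3 => //; first by rewrite card_option.
Qed.

(** With a and b the roots of M and M + 1, (b - a) (b + a) = 1 shows that each term is at most 2/a -
    2/b, and the sum telescopes. *)
Lemma sum_decay (M0 M : nat) : (0 < M0)%N -> (M0 <= M)%N ->
  \sum_(M0 <= t < M) ((t.+1%:R * Num.sqrt t.+1%:R)^-1 : R) <= 2 / Num.sqrt M0%:R.
Proof.
move=> M00; elim: M => [|M IH]; first by rewrite leqn0 => /eqP e; rewrite e in M00.
suff : forall M, (M0 <= M)%N -> \sum_(M0 <= t < M) ((t.+1%:R * Num.sqrt t.+1%:R)^-1 : R)
    <= 2 / Num.sqrt M0%:R - 2 / Num.sqrt M%:R.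
  by move=> h /h; move/le_trans; apply; rewrite gerBl divr_ge0.
move=> {IH} {}M; elim: M => [|M IH]; first by rewrite leqn0 => /eqP e; rewrite e in M00.
rewrite leq_eqVlt => /predU1P[<-|]; first by rewrite big_geq // subrr.
rewrite ltnS => M0M; rewrite big_nat_recr //=.
apply: le_trans (lerD (IH M0M) (lexx _)) _.
have Mp : (0 < M)%N by apply: leq_trans M0M.
set a := Num.sqrt M%:R; set b := Num.sqrt M.+1%:R.
have a0 : 0 < a by rewrite sqrtr_gt0 ltr0n.
have ab : a <= b by rewrite ler_sqrt ?ltr0n // ler_nat.
have b0 : 0 < b by apply: lt_le_trans ab.
have b2 : b ^+ 2 = M.+1%:R by rewrite sqr_sqrtr.
have a2 : a ^+ 2 = M%:R by rewrite sqr_sqrtr.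
rewrite -b2.
suff h : (b ^+ 2 * b)^-1 <= 2 / a - 2 / b.
  by rewrite -addrA lerD2l -lerBrDl opprK addrC.
have -> : 2 / a - 2 / b = 2 / (a * b * (a + b)).
  have e : (b - a) * (b + a) = 1 by rewrite -subr_sqr a2 b2 -natr1 addrAC subrr add0r.
  have -> : 2 / (a * b * (a + b)) = 2 * ((b - a) * (b + a)) / (a * b * (a + b)) by rewrite e mulr1.
  by field; rewrite !gt_eqF ?addr_gt0.
rewrite -[leLHS]mul1r ler_pdivrMr ?mulr_gt0 // mulrAC ler_pdivlMr ?mulr_gt0 ?addr_gt0 //.
by nra.
Qed.

Lemma geometric_series_cvg (u : R^nat) (C r : R) : 0 <= r < 1 ->
  (forall t, `|u t| <= C * r ^+ t) -> cvgn (series u).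
Proof.
move=> /andP[r0 r1] h; apply: normed_cvg.
apply: (series_le_cvg _ _ h) => [t|t|]; first exact: normr_ge0.
  by apply: le_trans (h t).
by apply: is_cvg_geometric_series; rewrite ger0_norm.
Qed.

Lemma sum_geometric_tail (M0 M : nat) (r : R) : 0 <= r < 1 -> (M0 <= M)%N ->
  \sum_(M0 <= t < M) r ^+ t <= r ^+ M0 / (1 - r).
Proof.
move=> /andP[r0 r1] MM; have r10 : 0 < 1 - r by rewrite subr_gt0.
rewrite ler_pdivlMr //.
suff -> : (\sum_(M0 <= t < M) r ^+ t) * (1 - r) = r ^+ M0 - r ^+ M.
  by rewrite gerBl exprn_ge0.
move: MM; elim: M => [|M IH]; first by rewrite leqn0 => /eqP ->; rewrite big_geq // mul0r subrr.
rewrite leq_eqVlt => /predU1P[<-|]; first by rewrite big_geq // mul0r subrr.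
by rewrite ltnS => h; rewrite big_nat_recr //= mulrDl IH // exprS; ring.
Qed.

Lemma lim_series_bound (u : R^nat) (M0 : nat) (B : R) : cvgn (series u) ->
  (forall M, (M0 <= M)%N -> \sum_(M0 <= t < M) `|u t| <= B) ->
  `|limn (series u) - series u M0| <= B.
Proof.
move=> cu h.
have cn : `|series u M - series u M0| @[M --> \oo] --> `|limn (series u) - series u M0|.
  by apply: cvg_norm; apply: cvgB => //; exact: cvg_cst.
apply: (cvgr_to_le cn); near=> M.
have MM : (M0 <= M)%N by near: M; exact: nbhs_infty_ge.
rewrite /series /= sub_series_geq //; apply: le_trans (h M MM).
exact: ler_norm_sum.
Unshelve. all: by end_near. Qed.

End kernel_decay.

(** * The potential kernel and its size at, near and far from the origin *)

Section torus_potential.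
Context {R : realType} (d N : nat) (N1 : (1 < N)%N).
Local Notation T := (torus d N).
Implicit Types (x : T) (h : int).

Definition osc t x h : R := cyl_heat t x h - vert_heat d t h / N%:R ^+ d.

(** A step follows a given axis with probability 1 / (d + 1) and then contracts by 1 - 1 / (4 N^2);
    this is the mean factor per step. *)
Definition mix_rate : R := 1 - (1 - (1 - (4 * N%:R ^+ 2)^-1)) / d.+1%:R.

Let N0 : (0 : R) < N%:R. Proof. by rewrite ltr0n ltnW. Qed.
Let N1' : (1 : R) <= N%:R. Proof. by rewrite ler1n ltnW. Qed.

Let Nn0 : (N%:R : R) != 0. Proof. by rewrite gt_eqF. Qed.
Let D0 : (d.+1%:R : R) != 0. Proof. by rewrite pnatr_eq0. Qed.

Lemma card_torus : #|{: T}| = (N ^ d)%N.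
Proof. by rewrite card_mx mul1n card_ord Zp_cast. Qed.

Lemma mix_rateE : 1 - mix_rate = (4 * N%:R ^+ 2 * d.+1%:R)^-1.
Proof. by rewrite /mix_rate; move: (d.+1%:R) D0 => D ?; field; apply/andP; split. Qed.

Lemma mix_rate_itv : 0 <= mix_rate < 1.
Proof.
have : 0 < (4 * N%:R ^+ 2 * d.+1%:R : R)^-1 by rewrite invr_gt0 !mulr_gt0 ?exprn_gt0.
have : (4 * N%:R ^+ 2 * d.+1%:R : R)^-1 <= 1.
  have : (1 : R) <= N%:R ^+ 2 by rewrite exprn_ege1.
  have : (1 : R) <= d.+1%:R by rewrite ler1n.
  rewrite invf_le1; first by nra.
  by rewrite !mulr_gt0 ?exprn_gt0.
by rewrite -mix_rateE; lra.
Qed.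

(** Given the axis counts, two products of numbers in [0, 1] differ by at most the sum of the d
    coordinatewise deviations, and each of these averages to [mix_rate ^+ t]. *)
Lemma osc_norm t x h : `|osc t x h| <= d%:R * mix_rate ^+ t.
Proof.
have I0 : (0 < #|{: option 'I_d}|)%N by rewrite card_option.
rewrite /osc /cyl_heat /vert_heat mulrC -word_avgZ -word_avgB.
apply: le_trans (word_avg_norm _ _) _.
have -> : d%:R * mix_rate ^+ t = word_avg t (fun c : option 'I_d -> nat =>
    \sum_i (1 - (4 * N%:R ^+ 2)^-1) ^+ c (Some i)).
  rewrite word_avg_sum; under eq_bigr do rewrite word_avg_geometric //.
  by rewrite sumr_const card_ord card_option card_ord mulr_natl.
apply: ler_word_avg => c _; rewrite -mulrBl normrM.
rewrite (ger0_norm (lazyq_ge0 _ _)).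
apply: le_trans (ler_piMr _ (lazyq_le1 _ _)) _ => //.
have -> : (N%:R ^+ d)^-1 = \prod_(i < d) N%:R^-1 :> R by rewrite prodr_const card_ord exprVn.
apply: le_trans (ler_prod_diff _ _) _.
- by move=> i; rewrite lazyq_ge0 lazyq_le1.
- by move=> i; rewrite invr_ge0 ltW //= invf_le1.
by apply: ler_sum => i _; apply: lazyq_mixing.
Qed.

Lemma oscS t x h : osc t.+1 x h = (osc t x h + cyl_avg (osc t) x h) / 2.
Proof.
rewrite /osc cyl_heatS (@vert_heatS R 'Z_N) /cyl_avg sumr_const card_ord -[(_ + _) *+ d]mulr_natl.
have -> : \sum_(i < d) (cyl_heat t (x + delta_mx 0 i) h - vert_heat d t h / N%:R ^+ d
     + (cyl_heat t (x - delta_mx 0 i) h - vert_heat d t h / N%:R ^+ d)) =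
   \sum_(i < d) (cyl_heat t (x + delta_mx 0 i) h + cyl_heat t (x - delta_mx 0 i) h) -
   (d%:R * (vert_heat d t h + vert_heat d t h)) / N%:R ^+ d :> R.
  set v := vert_heat d t h.
  have -> : d%:R * (v + v) = \sum_(i < d) (v + v) by rewrite sumr_const card_ord mulr_natl.
  rewrite mulr_suml -sumrB.
  by apply: eq_bigr => i _; ring.
have Nd : N%:R ^+ d != 0 :> R by rewrite expf_neq0.
have -> : d%:R = d.+1%:R - 1 :> R by rewrite -natr1 addrK.
by move: (d.+1%:R) D0 (N%:R ^+ d) Nd => D ? n ?; field; do ?[apply/andP; split].
Qed.

(* Green function of the cylinder, minus its average over each horizontal slice *)
Definition cyl_pot x h : R := limn (series (fun t => osc t x h / 2)).

Lemma cvg_cyl_pot x h : cvgn (series (fun t => osc t x h / 2)).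
Proof.
apply: (@geometric_series_cvg _ _ d%:R mix_rate mix_rate_itv) => t.
rewrite normrM normfV [X in _ / X]ger0_norm //.
by rewrite ler_pdivrMr // (le_trans (osc_norm _ _ _)) // ler_peMr ?mulr_ge0 ?exprn_ge0 ?ler1n //; case/andP: mix_rate_itv.
Qed.

Lemma cyl_pot_bounded : exists B : R, forall x h, `|cyl_pot x h| <= B.
Proof.
exists (d%:R * ((1 - mix_rate)^-1)) => x h.
have := @lim_series_bound _ _ 0 (d%:R * ((1 - mix_rate)^-1)) (@cvg_cyl_pot x h).
rewrite {2}/series /= big_geq // subr0; apply => M _.
apply: (@le_trans _ _ (\sum_(0 <= t < M) d%:R * mix_rate ^+ t)).
  apply: ler_sum => t _; rewrite normrM normfV [X in _ / X]ger0_norm //.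
  by rewrite ler_pdivrMr // (le_trans (osc_norm _ _ _)) // ler_peMr ?mulr_ge0 ?exprn_ge0 ?ler1n //; case/andP: mix_rate_itv.
rewrite -mulr_sumr ler_wpM2l // (le_trans (sum_geometric_tail mix_rate_itv (leq0n M))) //.
by rewrite expr0 mul1r.
Qed.

(** By [oscS] the partial sums telescope to [osc 0] minus [osc M], and the latter vanishes in the
    limit. The 1/2 in the series compensates the laziness, so the equation involves the step of the
    original walk. *)
Lemma cyl_pot_poisson x h :
  cyl_pot x h - cyl_avg cyl_pot x h = (h == 0)%:R * ((x == 0)%:R - (N%:R ^+ d)^-1).
Proof.
pose S M x h := series (fun t => osc t x h / 2) M.
have cS y k : S M y k @[M --> \oo] --> cyl_pot y k by exact: cvg_cyl_pot.
have lhs : (S M x h - cyl_avg (S M) x h) @[M --> \oo] --> cyl_pot x h - cyl_avg cyl_pot x h.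
  apply: cvgB; first exact: cS.
  rewrite /cyl_avg; apply: cvgMl.
  apply: cvgD; last by apply: cvgD; exact: cS.
  apply: (@cvg_big _ _ +%R 0 xpredT add_continuous) => i _.
  by apply: cvgD; exact: cS.
have rhs : (S M x h - cyl_avg (S M) x h) @[M --> \oo] --> osc 0 x h.
  have -> : (fun M => S M x h - cyl_avg (S M) x h) = (fun M => osc 0 x h - osc M x h).
    apply/funext => M; elim: M => [|M IH].
      rewrite /S /series /= /cyl_avg subrr !big_geq // big1 ?addr0 ?mul0r ?subrr //.
      by move=> i _; rewrite !big_geq // addr0.
    have -> : S M.+1 x h - cyl_avg (S M.+1) x h = S M x h - cyl_avg (S M) x h +
        (osc M x h - cyl_avg (osc M) x h) / 2.
      have SS y k : S M.+1 y k = S M y k + osc M y k / 2.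
        by rewrite /S /series /= big_nat_recr.
      have -> : cyl_avg (S M.+1) x h = cyl_avg (S M) x h + cyl_avg (osc M) x h / 2.
        rewrite /cyl_avg !SS.
        under eq_bigr do rewrite !SS addrACA -mulrDl.
        by rewrite big_split /= -mulr_suml; field; rewrite addrC natr1.
      by rewrite SS; field.
    by rewrite IH oscS; field.
  have /cvg_series_cvg_0 o0 := @cvg_cyl_pot x h.
  have -> : (fun M => osc 0 x h - osc M x h) = (fun M => osc 0 x h - 2 * (osc M x h / 2)).
    by apply/funext => M; rewrite mulrCA mulfV ?mulr1.
  rewrite (_ : nbhs (osc 0 x h) = nbhs (osc 0 x h - 2 * 0)); last by rewrite mulr0 subr0.
  by apply: cvgB; [exact: cvg_cst|apply: cvgMr; exact: o0].
rewrite (cvg_unique _ lhs rhs) // /osc cyl_heat0.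
have -> : vert_heat d 0 h = (h == 0)%:R :> R by rewrite /vert_heat /= lazyq0.
by case: (h == 0); case: (x == 0); rewrite /= ?mul0r ?mul1r ?subrr ?sub0r ?oppr0.
Qed.

Definition torus_pot x : R := cyl_pot x 0.

Lemma cyl_heat_max t x : cyl_heat t x 0 <= cyl_heat t (0 : T) 0 :> R.
Proof.
apply: ler_word_avg => c _; rewrite ler_wpM2r ?lazyq_ge0 //.
by apply: ler_prod => i _; rewrite lazyq_ge0 mxE lazyq_max.
Qed.

(** The term of time 0 contributes 1/2. Every later term of the difference is nonnegative, since the
    heat kernels are maximal at 0 and the slice averages cancel. *)
Lemma torus_pot_gap x : x != 0 -> torus_pot x <= torus_pot 0 - 1 / 2.
Proof.
move=> x0; rewrite lerBrDr -lerBrDl.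
have c : (series (fun t => osc t 0 0 / 2) M - series (fun t => osc t x 0 / 2) M)
    @[M --> \oo] --> torus_pot 0 - torus_pot x.
  by apply: cvgB; exact: cvg_cyl_pot.
suff step M : 1 / 2 <= series (fun t => osc t 0 0 / 2) M.+1 - series (fun t => osc t x 0 / 2) M.+1.
  apply: (cvgr_to_ge c); near=> M.
  have M0 : (0 < M)%N by near: M; exact: nbhs_infty_gt.
  by rewrite -(prednK M0); exact: step.
rewrite /series /= -sumrB big_nat_recl //.
rewrite /osc !cyl_heat0 !eqxx (negbTE x0) /=.
set v := vert_heat d 0 0 / _; have -> : (1 - v) / 2 - (0 - v) / 2 = 1 / 2 by field.
rewrite lerDl; apply: sumr_ge0 => t _.
by rewrite subr_ge0 ler_wpM2r // lerD2r cyl_heat_max.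
Unshelve. all: by end_near. Qed.

(** Bound for the terms after time M0, cut at time (N l)^2: before the cut the decay t^(-3/2) is
    used, after it the exponential mixing. The 12 is 6 from [osc_decay] times 2 from [sum_decay]. *)
Definition slice_tail (M0 l : nat) : R :=
  12 * (l%:R + 2) ^+ 2 * d.+1%:R ^+ 3 / Num.sqrt M0%:R +
  d%:R * (mix_rate ^+ (N ^ 2 * l ^ 2) / (1 - mix_rate)).

Lemma osc_decay (l t : nat) x : (2 <= d)%N -> (0 < l)%N -> (t < N ^ 2 * l ^ 2)%N ->
  `|osc t x 0| <= 6 * (l%:R + 2) ^+ 2 * d.+1%:R ^+ 3 / (t.+1%:R * Num.sqrt t.+1%:R).
Proof.
move=> d2 l0 tl.
have sq0 n : 0 < Num.sqrt n.+1%:R :> R by rewrite sqrtr_gt0 ltr0n.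
(* The reason for the cut at (N l)^2: before it the floor 1/N costs only a factor l against the
   inverse root. *)
have invN c : (c <= t)%N -> N%:R^-1 <= l%:R / Num.sqrt c.+1%:R :> R.
  move=> ct; rewrite ler_pdivlMr // mulrC ler_pdivrMr //.
  rewrite -[leRHS]ger0_norm ?mulr_ge0 // -sqrtr_sqr ler_sqrt ?sqr_ge0 //.
  rewrite -natrM -natrX ler_nat expnMn mulnC.
  by apply: leq_ltn_trans tl.
have hc : cyl_heat t x 0 <= 3 * (l%:R + 2) ^+ 2 * d.+1%:R ^+ 3 / (t.+1%:R * Num.sqrt t.+1%:R) :> R.
  apply: cyl_heat_decay => //.
  move=> i c ct; apply: le_trans (lazyq_bound _ _ _) _ => //.
  by rewrite [leRHS]mulrDl lerD2r invN.
have hv : vert_heat d t 0 / N%:R ^+ d <= 3 * (l%:R + 2) ^+ 2 * d.+1%:R ^+ 3 / (t.+1%:R * Num.sqrt t.+1%:R) :> R.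
  rewrite mulrC /vert_heat -word_avgZ.
  have d0 : (0 < d)%N by apply: leq_trans d2.
  pose i0 : 'I_d := Ordinal d0; pose i1 : 'I_d := Ordinal d2.
  have s0 n : 0 <= (Num.sqrt n%:R)^-1 :> R by rewrite invr_ge0.
  apply: (@le_trans _ _ (word_avg t (fun c : option 'I_d -> nat => 3 * (l%:R + 2) ^+ 2 *
     ((Num.sqrt (c (Some i0)).+1%:R)^-1 * (Num.sqrt (c (Some i1)).+1%:R)^-1 *
      (Num.sqrt (c None).+1%:R)^-1)))).
    apply: ler_word_avg => c ct.
    have h0 := invN _ (ct (Some i0)); have h1 := invN _ (ct (Some i1)).
    have hN := @lazyq_int_bound R (c None).
    have l2 : 0 <= l%:R + 2 :> R by rewrite addr_ge0.
    apply: (@le_trans _ _ ((l%:R + 2) / Num.sqrt (c (Some i0)).+1%:R *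
      ((l%:R + 2) / Num.sqrt (c (Some i1)).+1%:R) * (3 / Num.sqrt (c None).+1%:R))).
      apply: ler_pM; [by rewrite invr_ge0 exprn_ge0|exact: lazyq_ge0| |exact: hN].
      apply: (@le_trans _ _ (N%:R^-1 * N%:R^-1)).
        rewrite -expr2 -exprVn.
        by apply: ler_wiXn2l => //; rewrite ?invr_ge0 ?invf_le1 // ltW.
      have iN : (0 : R) <= N%:R^-1 by rewrite invr_ge0 ltW.
      apply: ler_pM => //; [apply: le_trans h0 _|apply: le_trans h1 _];
        by rewrite ler_wpM2r // lerDl.
    by rewrite le_eqVlt; apply/orP; left; apply/eqP; ring.
  rewrite word_avgZ -[leRHS]mulrA ler_wpM2l ?mulr_ge0 ?exprn_ge0 ?addr_ge0 //.
  rewrite -(_ : #|{: option 'I_d}| = d.+1); last by rewrite card_option card_ord.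
  by apply: word_avg_sqrt3 => //; first by rewrite card_option.
have c0 : 0 <= cyl_heat t x 0 :> R by apply: cyl_heat_ge0.
have v0 : 0 <= vert_heat d t 0 / N%:R ^+ d :> R by rewrite divr_ge0 ?exprn_ge0 ?vert_heat_ge0.
rewrite /osc; move: hc hv c0 v0; set K := _ / (t.+1%:R * _) => hc hv c0 v0.
have -> : 6 * (l%:R + 2) ^+ 2 * d.+1%:R ^+ 3 / (t.+1%:R * Num.sqrt t.+1%:R) = K + K by rewrite /K; ring.
by rewrite ler_norml; apply/andP; split; lra.
Qed.

Lemma osc_tail (M0 l M : nat) x : (2 <= d)%N -> (0 < l)%N -> (0 < M0)%N -> (M0 <= M)%N ->
  \sum_(M0 <= t < M) `|osc t x 0| <= slice_tail M0 l.
Proof.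
move=> d2 l0 M00 MM; set T1 := (N ^ 2 * l ^ 2)%N.
pose a t : R := 6 * (l%:R + 2) ^+ 2 * d.+1%:R ^+ 3 / (t.+1%:R * Num.sqrt t.+1%:R).
pose b t : R := if (T1 <= t)%N then d%:R * mix_rate ^+ t else 0.
have a0 t : 0 <= a t.
  by rewrite divr_ge0 // ?mulr_ge0 ?exprn_ge0 ?addr_ge0.
have [r0 r1] := andP mix_rate_itv.
apply: (@le_trans _ _ (\sum_(M0 <= t < M) (a t + b t))).
  apply: ler_sum => t _; rewrite /b; case: leqP => tT.
    by apply: le_trans (osc_norm _ _ _) _; rewrite lerDr.
  by rewrite addr0; apply: osc_decay.
rewrite big_split /=; apply: lerD.
  rewrite -mulr_sumr; apply: le_trans (ler_wpM2l _ (sum_decay M00 MM)) _.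
    by rewrite !mulr_ge0 ?exprn_ge0 ?addr_ge0.
  by rewrite le_eqVlt; apply/orP; left; apply/eqP; ring.
rewrite /b -big_mkcond /= -mulr_sumr ler_wpM2l //.
have r10 : 0 <= mix_rate ^+ T1 / (1 - mix_rate) by rewrite divr_ge0 ?exprn_ge0 // subr_ge0 ltW.
have [TM|MT] := leqP T1 M; last first.
  rewrite big_nat_cond big1 // => t /andP[/andP[_ tM]] Tt.
  by rewrite ltnNge (leq_trans (ltnW MT) Tt) in tM.
apply: le_trans (sum_geometric_tail mix_rate_itv TM).
rewrite [leRHS](big_nat_widenl _ 0) // [leLHS](big_nat_widenl _ 0) //.
rewrite [leLHS]big_mkcond [leRHS]big_mkcond /=; apply: ler_sum => t _.
by case: (T1 <= t)%N; case: (M0 <= t)%N; rewrite //= ?exprn_ge0.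
Qed.

Lemma torus_pot_approx (M0 l : nat) x : (2 <= d)%N -> (0 < l)%N -> (0 < M0)%N ->
  `|torus_pot x - series (fun t => osc t x 0 / 2) M0| <= slice_tail M0 l / 2.
Proof.
move=> d2 l0 M00; apply: lim_series_bound; first exact: cvg_cyl_pot.
move=> M MM; under eq_bigr do rewrite normrM normfV [X in _ / X]ger0_norm //.
by rewrite -mulr_suml ler_wpM2r // osc_tail.
Qed.

Let series_vert_le M0 : \sum_(0 <= t < M0) (vert_heat d t 0 / N%:R ^+ d / 2) <= M0%:R / N%:R ^+ d / 2 :> R.
Proof.
rewrite -!mulr_suml ler_wpM2r // ler_wpM2r ?invr_ge0 ?exprn_ge0 //.
rewrite -[in leRHS](subn0 M0) -[leRHS]sumr_const_nat; apply: ler_sum => t _; exact: vert_heat_le1.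
Qed.

(** The slice averages subtracted up to time M0, each at most 1/n, plus the tail; both are halved
    like the terms of the potential. *)
Definition pot_err (M0 l : nat) : R := M0%:R / N%:R ^+ d / 2 + slice_tail M0 l / 2.

Lemma torus_pot_ge (M0 l : nat) x : (2 <= d)%N -> (0 < l)%N -> (0 < M0)%N ->
  - pot_err M0 l <= torus_pot x.
Proof.
move=> d2 l0 M00; have := torus_pot_approx x d2 l0 M00.
rewrite ler_norml => /andP[h _]; rewrite lerBrDl in h; apply: le_trans h.
rewrite /pot_err opprD lerD2r /series /= lerNl -sumrN.
apply: le_trans (series_vert_le M0); apply: ler_sum => t _.
by rewrite -mulNr ler_wpM2r // /osc opprB gerBl cyl_heat_ge0.
Qed.

(** Before time M0 the walk cannot leave the box, so outside it the early terms are minus a slice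
    average and only the tail can be positive. *)
Lemma torus_pot_far (M0 l : nat) x : (2 <= d)%N -> (0 < l)%N -> (0 < M0)%N ->
  ~ in_box M0 x -> torus_pot x <= pot_err M0 l.
Proof.
move=> d2 l0 M00 xb; have := torus_pot_approx x d2 l0 M00.
rewrite ler_norml => /andP[_ h]; rewrite lerBlDl in h; apply: le_trans h _.
rewrite /pot_err lerD2r /series /=.
apply: (@le_trans _ _ 0); last by rewrite !divr_ge0 ?exprn_ge0.
rewrite big_nat_cond; apply: sumr_le0 => t /andP[/andP[_ tM] _].
rewrite pmulr_lle0 ?invr_gt0 // /osc (cyl_heat_support 0 (ltnW tM) xb) sub0r oppr_le0.
by rewrite divr_ge0 ?exprn_ge0 ?vert_heat_ge0.
Qed.

Lemma cyl_heat_wrap t : (t < N)%N -> cyl_heat t (0 : T) 0 = cyl_heat t (0 : 'rV[int]_d) 0 :> R.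
Proof.
move=> tN; apply/eqP; rewrite eq_le; apply/andP; split; apply: ler_word_avg => c ct;
  rewrite le_eqVlt; apply/orP; left; apply/eqP; congr (_ * _); apply: eq_bigr => i _;
  by rewrite !mxE lazyq_wrap // (leq_ltn_trans (ct _)).
Qed.

End torus_potential.

(** * Green function of Z^(d+1) *)

Section lattice_neighbours.
Context {A : nzRingType} (n : nat).
Hypothesis A2 : (1 : A) != -1.

(** Since 1 differs from -1 the listed neighbours are distinct and [undup] removes nothing; in Z/N
    this is secured by N > 2. *)
Lemma lattice_nbrsE (x : 'rV[A]_n) :
  lattice_nbrs x = [seq (if b then x + delta_mx 0 i else x - delta_mx 0 i) |
                     i <- enum 'I_n, b <- [:: true; false]].
Proof.
rewrite /lattice_nbrs undup_id //.
change (uniq [seq (if b then x + delta_mx 0 i else x - delta_mx 0 i) |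
                     i <- enum 'I_n, b <- [:: true; false]]).
apply: allpairs_uniq => //; first exact: enum_uniq.
move=> [i b] [j c] _ _ /=.
have eqd (a a' : A) : a != 0 -> a *: delta_mx 0 i = a' *: (delta_mx 0 j : 'rV[A]_n) ->
    i = j /\ a = a'.
  move=> a0 /matrixP/(_ 0 i); rewrite !mxE !eqxx /= mulr1.
  by case: (eqVneq i j) => [->|_ e]; [rewrite mulr1|rewrite e mulr0 eqxx in a0].
have m1 : (-1 : A) != 0 by rewrite oppr_eq0 oner_eq0.
have E (b' : bool) k : (if b' then x + delta_mx 0 k else x - delta_mx 0 k) =
    x + (if b' then 1 else -1) *: delta_mx 0 k by case: b'; rewrite ?scale1r ?scaleN1r.
rewrite !E => /addrI /eqd [|-> e]; first by case: b; rewrite ?oner_eq0.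
by move/eqP: A2 => A2'; case: b c e => [] [] //= e; case: A2'.
Qed.

Lemma big_lattice_nbrs (V : nmodType) (f : 'rV[A]_n -> V) x :
  \sum_(v <- lattice_nbrs x) f v = \sum_i (f (x + delta_mx 0 i) + f (x - delta_mx 0 i)).
Proof.
rewrite lattice_nbrsE big_allpairs_dep big_enum /=; apply: eq_bigr => i _.
by rewrite !big_cons big_nil addr0.
Qed.

Lemma size_lattice_nbrs (x : 'rV[A]_n) : size (lattice_nbrs x) = (2 * n)%N.
Proof. by rewrite lattice_nbrsE size_allpairs size_enum_ord mulnC. Qed.

End lattice_neighbours.

Section green_function.
Context {R : realType}.

Let two_neq : (1 : int) != -1. Proof. by []. Qed.

Lemma sum_srw_step {V : eqType} (nbrs : V -> seq V) (f : V -> R) x :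
  \sum_(v <- nbrs x) srw_step nbrs x v * f v = (\sum_(v <- nbrs x) f v) / (size (nbrs x))%:R.
Proof.
rewrite mulr_suml big_seq [RHS]big_seq; apply: eq_bigr => v vx.
by rewrite /srw_step vx mul1r mulrC.
Qed.

Lemma srw_prob_ge0 {V : eqType} (nbrs : V -> seq V) n x y : 0 <= srw_prob nbrs n x y :> R.
Proof.
elim: n x => [|n IH] x //=; rewrite sum_srw_step divr_ge0 //.
exact: sumr_ge0.
Qed.

Definition split_row {A : nzRingType} d (x : 'rV[A]_d.+1) : 'rV[A]_d := \row_i x 0 (lift ord0 i).

(** After t lazy steps the number of genuine steps is binomial, so the lazy kernel is a binomial
    mixture of the original ones. *)
Lemma lattice_heatE d t (x : 'rV[int]_d.+1) :
  cyl_heat t (split_row x) (x 0 0) =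
  2^-1 ^+ t * \sum_(j < t.+1) srw_prob (@lattice_nbrs int d.+1) j x 0 *+ 'C(t, j) :> R.
Proof.
elim: t x => [|t IH] x.
  rewrite cyl_heat0 mul1r big_ord1 bin0 /=; congr ((_ : bool)%:R).
  apply/andP/eqP => [[/eqP/rowP e /eqP e0]|->].
    apply/rowP => i; rewrite mxE; case: (unliftP ord0 i) => [j ->|->] //.
    by have := e j; rewrite !mxE.
  by split; apply/eqP; [apply/rowP => i|]; rewrite !mxE.
rewrite cyl_heatS (binom_sumS t (fun j => srw_prob (@lattice_nbrs int d.+1) j x 0 : R)).
under [in RHS]eq_bigr do rewrite mulrnDl.
have avgE (f : 'rV[int]_d.+1 -> R) g : (forall y, g (split_row y) (y 0 0) = f y) ->
    cyl_avg g (split_row x) (x 0 0) = (\sum_(v <- lattice_nbrs x) f v) / (2 * d.+1%:R).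
  move=> gf; rewrite big_lattice_nbrs // big_ord_recl addrC /cyl_avg -!gf; congr ((_ + _) / _).
    apply: eq_bigr => i _; rewrite -!gf; congr (g _ _ + g _ _); rewrite ?mxE /= ?addr0 ?subr0 //;
    by apply/rowP => j; rewrite !mxE (inj_eq lift_inj) eqxx.
  by congr (g _ _ + g _ _); rewrite ?mxE ?eqxx //; apply/rowP => j; rewrite !mxE /= ?addr0 ?subr0.
have -> : cyl_avg (cyl_heat t) (split_row x) (x 0 0) =
    2^-1 ^+ t * \sum_(j < t.+1) srw_prob (@lattice_nbrs int d.+1) j.+1 x 0 *+ 'C(t, j) :> R.
  rewrite (avgE _ _ IH) -mulr_sumr -mulrA; congr (_ * _).
  rewrite exchange_big /= mulr_suml; apply: eq_bigr => j _.
  rewrite sumrMnl (sum_srw_step _ (fun v => srw_prob _ j v 0)) size_lattice_nbrs //.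
  by rewrite natrM -[RHS]mulrnAl.
by rewrite big_split /= IH exprS; field.
Qed.

(** Both sides are the probability that the head number j + 1 appears within M fair tosses. *)
Lemma sum_neg_binomial (j M : nat) :
  \sum_(0 <= t < M) ('C(t, j)%:R * 2^-1 ^+ t.+1 : R) =
  1 - 2^-1 ^+ M * \sum_(i < j.+1) 'C(M, i)%:R.
Proof.
elim: M => [|M IH].
  rewrite big_geq // big_ord_recl bin0 big1 ?addr0 ?mulr1 ?subrr //.
have e : \sum_(i < j.+1) ('C(M.+1, i)%:R : R) = 2 * \sum_(i < j.+1) 'C(M, i)%:R - 'C(M, j)%:R.
  rewrite big_ord_recl bin0 /=.
  under eq_bigr do rewrite /bump /= add1n binS natrD.
  rewrite big_split /= mulr_natl mulr2n [in X in _ = X + _ - _]big_ord_recl bin0 /=.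
  by rewrite [in X in _ = _ + X - _]big_ord_recr /= addrA addrA addrK.
by rewrite big_nat_recr //= IH e exprS; field.
Qed.

Lemma neg_binomial_series j :
  (\sum_(0 <= t <oo) ('C(t, j)%:R * 2^-1 ^+ t.+1 : R)%:E = 1)%E.
Proof.
have pos k t : 0 <= 'C(t, k)%:R * 2^-1 ^+ t.+1 :> R by rewrite mulr_ge0 ?exprn_ge0 ?invr_ge0.
have to0 k : ('C(t, k)%:R * 2^-1 ^+ t.+1 : R) @[t --> \oo] --> (0 : R).
  apply: cvg_series_cvg_0; apply: nondecreasing_is_cvgn.
    by apply: nondecreasing_series => t _ _; exact: pos.
  exists 1 => _ [M _ <-]; rewrite /series /= sum_neg_binomial gerBl.
  by rewrite mulr_ge0 ?exprn_ge0 ?invr_ge0 // sumr_ge0.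
apply/cvg_lim => //.
rewrite (_ : (fun n => _) = EFin \o (fun M => 1 - \sum_(i < j.+1) (2 * ('C(M, i)%:R * 2^-1 ^+ M.+1) : R))); last first.
  apply/funext => M; rewrite /= sumEFin sum_neg_binomial; congr (_ - _)%:E.
  by rewrite mulr_sumr; apply: eq_bigr => i _; rewrite exprS; field.
apply: cvg_EFin; first by near=> M.
rewrite (_ : nbhs (1 : R) = nbhs (1 - \sum_(i < j.+1) (2 * 0) : R)); last first.
  by rewrite big1 ?subr0 // => i _; rewrite mulr0.
apply: cvgB; first exact: cvg_cst.
apply: (@cvg_big _ _ +%R 0 xpredT add_continuous) => i _.
by apply: cvgMr; exact: to0.
Unshelve. all: by end_near. Qed.

Variables (d : nat) (d2 : (2 <= d)%N).

Definition latt_green : R := limn (series (fun t => cyl_heat t (0 : 'rV[int]_d) 0 / 2)).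

Let heat_decay t :
  cyl_heat t (0 : 'rV[int]_d) 0 <= 27 * d.+1%:R ^+ 3 / (t.+1%:R * Num.sqrt t.+1%:R) :> R.
Proof.
have -> : (27 : R) = 3 * 3 ^+ 2 by rewrite -natrX -natrM.
by apply: cyl_heat_decay => // i c _; rewrite mxE lazyq_int_bound.
Qed.

Let heat_tail M0 M : (0 < M0)%N -> (M0 <= M)%N ->
  \sum_(M0 <= t < M) `|cyl_heat t (0 : 'rV[int]_d) 0 / 2 : R| <= 27 * d.+1%:R ^+ 3 / Num.sqrt M0%:R.
Proof.
move=> M00 MM.
apply: (@le_trans _ _ (\sum_(M0 <= t < M) (27 * d.+1%:R ^+ 3 / 2) / (t.+1%:R * Num.sqrt t.+1%:R))).
  apply: ler_sum => t _; rewrite ger0_norm ?divr_ge0 ?cyl_heat_ge0 //.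
  by rewrite mulrAC ler_wpM2r.
rewrite -mulr_sumr; apply: le_trans (ler_wpM2l _ (sum_decay M00 MM)) _.
  by rewrite divr_ge0 // mulr_ge0 // exprn_ge0.
by rewrite le_eqVlt; apply/orP; left; apply/eqP; field; rewrite gt_eqF // sqrtr_gt0 ltr0n.
Qed.

Lemma cvg_latt_green : cvgn (series (fun t => cyl_heat t (0 : 'rV[int]_d) 0 / 2 : R)).
Proof.
apply: nondecreasing_is_cvgn.
  by apply: nondecreasing_series => t _ _; rewrite divr_ge0 ?cyl_heat_ge0.
exists (1 / 2 + 27 * d.+1%:R ^+ 3 / Num.sqrt 1%:R) => _ [M _ <-].
have tail0 : 0 <= 27 * d.+1%:R ^+ 3 / Num.sqrt 1%:R :> R.
  by rewrite divr_ge0 // mulr_ge0 // exprn_ge0.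
case: M => [|M]; first by rewrite /series /= big_geq // addr_ge0.
rewrite /series /= big_nat_recl // cyl_heat0 !eqxx lerD2l.
have := @heat_tail 1 M.+1 isT isT; apply: le_trans.
rewrite big_add1 /=; apply: ler_sum => t _; exact: ler_norm.
Qed.

Lemma latt_green_approx M0 : (0 < M0)%N ->
  `|latt_green - series (fun t => cyl_heat t (0 : 'rV[int]_d) 0 / 2) M0| <=
  27 * d.+1%:R ^+ 3 / Num.sqrt M0%:R.
Proof.
move=> M00; apply: lim_series_bound; first exact: cvg_latt_green.
by move=> M MM; apply: heat_tail.
Qed.

(** Times 0 and 1 contribute 1/2 and at least 1/4. Being strictly above 1/2 leaves room for
    [torus_pot] at 0 to stay above 1/2 for large N. *)
Lemma latt_green_ge : 3 / 4 <= latt_green.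
Proof.
apply: (cvgr_to_ge cvg_latt_green); near=> M.
have M1 : (1 < M)%N by near: M; exact: nbhs_infty_gt.
have e : M = M.-2.+2 by move: (M) M1 => [|[]].
rewrite /series /= e big_nat_recl // big_nat_recl // addrA -[leLHS]addr0.
apply: lerD; last by apply: sumr_ge0 => t _; rewrite divr_ge0 ?cyl_heat_ge0.
rewrite cyl_heatS !cyl_heat0 !eqxx /=.
have : 0 <= cyl_avg (@cyl_heat R int d 0) 0 0.
  by rewrite /cyl_avg divr_ge0 // addr_ge0 ?addr_ge0 ?sumr_ge0 // => *; rewrite ?addr_ge0 // cyl_heat_ge0.
by lra.
Unshelve. all: by end_near. Qed.

(** Tonelli: in the halved lazy series each genuine time j receives the total weight 1, by
    [neg_binomial_series]. *)
Lemma greenE : green (@lattice_nbrs int d.+1) 0 0 = latt_green%:E.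
Proof.
rewrite /green /latt_green.
pose a j : R := srw_prob (@lattice_nbrs int d.+1) j 0 0.
have a0 j : 0 <= a j by apply: srw_prob_ge0.
have w0 t j : 0 <= 'C(t, j)%:R * 2^-1 ^+ t.+1 :> R by rewrite mulr_ge0 ?exprn_ge0 ?invr_ge0.
transitivity (\sum_(0 <= j <oo) \sum_(0 <= t <oo) (a j * ('C(t, j)%:R * 2^-1 ^+ t.+1))%:E)%E.
  apply: eq_eseriesr => j _; rewrite -[LHS]mule1 -(neg_binomial_series j).
  by rewrite -nneseriesZl.
rewrite (nneseries_interchange xpredT xpredT); last by move=> i j; rewrite lee_fin mulr_ge0.
transitivity (\sum_(0 <= t <oo) (cyl_heat t (0 : 'rV[int]_d) 0 / 2 : R)%:E)%E; last first.
  rewrite -EFin_lim; last exact: cvg_latt_green.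
  by congr (limn _); apply/funext => M; rewrite /= -sumEFin.
apply: eq_eseriesr => t _.
have -> : (0 : 'rV[int]_d) = split_row (0 : 'rV[int]_d.+1) by apply/rowP => i; rewrite !mxE.
have -> : (0 : int) = (0 : 'rV[int]_d.+1) 0 0 by rewrite mxE.
rewrite lattice_heatE.
rewrite (nneseries_split 0 t.+1); last by move=> j _; rewrite lee_fin mulr_ge0.
rewrite [X in (_ + X)%E]eseries0 ?adde0; last first.
  by move=> j tj _; rewrite bin_small // mul0r mulr0.
rewrite add0n big_mkord sumEFin; congr EFin.
rewrite mulr_sumr mulr_suml; apply: eq_bigr => j _.
by rewrite -[srw_prob _ _ _ _ *+ _]mulr_natr exprS -/(a j); field.
Qed.

End green_function.

(** * Trace of the walk on the zero level *)

Section trace_kernel.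
Context {R : realType} (d N : nat) (N1 : (1 < N)%N).
Local Notation T := (torus d N).
Implicit Types (x y : T) (h : int) (f : T -> R) (F : T -> int -> R) (M : nat).

Let D0 : (d.+1%:R : R) != 0. Proof. by rewrite pnatr_eq0. Qed.

Lemma cyl_avg_cst (c : R) x h : cyl_avg (fun (_ : T) (_ : int) => c) x h = c.
Proof.
rewrite /cyl_avg sumr_const card_ord -[(c + c) *+ d]mulr_natl.
by rewrite (_ : d%:R = d.+1%:R - 1 :> R) -?natr1 ?addrK //; field; rewrite natr1.
Qed.

Lemma ler_cyl_avg F G x h :
  (forall y k, F y k <= G y k) -> cyl_avg F x h <= cyl_avg G x h.
Proof.
move=> FG; rewrite ler_wpM2r ?invr_ge0 // lerD //; last exact: lerD.
by apply: ler_sum => i _; apply: lerD.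
Qed.

Lemma cyl_avg_sum (I : finType) (a : I -> R) (G : I -> T -> int -> R) x h :
  cyl_avg (fun y k => \sum_i a i * G i y k) x h = \sum_i a i * cyl_avg (G i) x h.
Proof.
rewrite /cyl_avg -!big_split /=.
under eq_bigr do rewrite -big_split /=.
rewrite exchange_big /= -big_split /= mulr_suml; apply: eq_bigr => i _.
by rewrite mulrA; congr (_ / _); rewrite !mulrDr mulr_sumr; congr (_ + _); apply: eq_bigr => j _; rewrite mulrDr.
Qed.

Lemma cyl_avgB F G x h :
  cyl_avg (fun y k => F y k - G y k) x h = cyl_avg F x h - cyl_avg G x h.
Proof.
rewrite /cyl_avg -mulrBl; congr (_ / _).
have -> : \sum_i (F (x + delta_mx 0 i) h - G (x + delta_mx 0 i) h + (F (x - delta_mx 0 i) h - G (x - delta_mx 0 i) h)) =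
    \sum_i (F (x + delta_mx 0 i) h + F (x - delta_mx 0 i) h) - \sum_i (G (x + delta_mx 0 i) h + G (x - delta_mx 0 i) h).
  by rewrite -sumrB; apply: eq_bigr => i _; ring.
by ring.
Qed.

Lemma cyl_avg_shift F x y h : cyl_avg (fun x' => F (x' - y)) x h = cyl_avg F (x - y) h.
Proof.
rewrite /cyl_avg; congr ((_ + _) / _); apply: eq_bigr => i _.
by rewrite ![x - y + _]addrAC.
Qed.

Lemma cyl_avg_opp F x h : (forall y k, F (- y) k = F y k) -> cyl_avg F (- x) h = cyl_avg F x h.
Proof.
move=> Fe; rewrite /cyl_avg !Fe; congr ((_ + _) / _); apply: eq_bigr => i _.
rewrite -[F (- x + _) h]Fe -[F (- x - _) h]Fe !opprD !opprK addrC.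
by [].
Qed.

(* Expectation of f at the first visit to the level 0, killed after M steps *)
Fixpoint hit_avg f M x h : R :=
  if h == 0 then f x else if M is k.+1 then cyl_avg (hit_avg f k) x h else 0.

(* Probability of not visiting the level 0 within M steps *)
Fixpoint escape M h : R :=
  if h == 0 then 0 else if M is k.+1 then cyl_avg (fun _ : T => escape k) 0 h else 1.

Definition delta0 x : R := (x == 0)%:R.

Lemma escape0 M : escape M 0 = 0. Proof. by case: M. Qed.

Lemma escape_ge0 M h : 0 <= escape M h.
Proof.
elim: M h => [|M IH] h /=; case: eqP => // _.
by rewrite -(cyl_avg_cst 0 (0 : T) h); apply: ler_cyl_avg.
Qed.

Lemma escape_le1 M h : escape M h <= 1.
Proof.
elim: M h => [|M IH] h /=; case: eqP => // _.
by rewrite -[leRHS](cyl_avg_cst 1 (0 : T) h); apply: ler_cyl_avg.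
Qed.

Lemma escape_decr M h : escape M.+1 h <= escape M h.
Proof.
elim: M h => [|M IH] h.
  rewrite /=; case: eqP => // _; rewrite -[leRHS](cyl_avg_cst 1 (0 : T) h); apply: ler_cyl_avg => y k.
  by case: eqP.
rewrite {1}/escape -/escape [leRHS]/=; case: eqP => // _.
by apply: ler_cyl_avg => y k; exact: IH.
Qed.

Lemma escapeN M h : escape M (- h) = escape M h.
Proof.
elim: M h => [|M IH] h /=; rewrite oppr_eq0 //; case: eqP => // _.
rewrite /cyl_avg IH; congr ((_ + _) / _).
by rewrite -[escape M (- h + 1)]IH -[escape M (- h - 1)]IH !opprD !opprK addrC.
Qed.

(** Recurrence of the vertical coordinate without estimates: the limit is harmonic off 0 and
    vanishes at 0, hence is linear on the naturals, and being bounded it is 0; symmetry covers the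
    negative heights. *)
Lemma cvg_escape h : escape M h @[M --> \oo] --> 0.
Proof.
have cv k : cvgn (escape ^~ k).
  apply: nonincreasing_is_cvgn.
    by apply/nonincreasing_seqP => M; exact: escape_decr.
  by exists 0 => _ [M _ <-]; exact: escape_ge0.
pose s k := limn (escape ^~ k).
have s_cvg k : escape M k @[M --> \oo] --> s k by exact: cv.
have s0 : s 0 = 0.
  apply/cvg_lim => //; rewrite (_ : escape ^~ 0 = fun=> 0); first exact: cvg_cst.
  by apply/funext => M; rewrite escape0.
have sN k : s (- k) = s k by rewrite /s; congr (limn _); apply/funext => M; rewrite escapeN.
have s_le1 k : s k <= 1.
  by apply: (cvgr_to_le (s_cvg k)); near=> M; exact: escape_le1.
have s_ge0 k : 0 <= s k.
  by apply: (cvgr_to_ge (s_cvg k)); near=> M; exact: escape_ge0.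
have s_lin k : k != 0 -> s (k + 1) = 2 * s k - s (k - 1).
  move=> k0.
  have c1 : escape M.+1 k @[M --> \oo] --> s k by rewrite (cvg_shiftS (escape ^~ k)); exact: s_cvg.
  have c2 : escape M.+1 k @[M --> \oo] -->
      (d%:R * (s k + s k) + (s (k + 1) + s (k - 1))) / (2 * d.+1%:R).
    rewrite (_ : (fun M => _) = (fun M => (d%:R * (escape M k + escape M k) +
       (escape M (k + 1) + escape M (k - 1))) / (2 * d.+1%:R))); last first.
      apply/funext => M; rewrite /= (negbTE k0) /cyl_avg sumr_const card_ord.
      by rewrite -[(_ + _) *+ d]mulr_natl.
    apply: cvgMl; apply: cvgD; last by apply: cvgD; exact: s_cvg.
    by apply: cvgMr; apply: cvgD; exact: s_cvg.
  have e := cvg_unique _ c1 c2.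
  have : 2 * d.+1%:R * s k = d%:R * (s k + s k) + (s (k + 1) + s (k - 1)).
    by rewrite {1}e //; field; rewrite addrC natr1.
  by rewrite -natr1 => e'; lra.
have s_mul (n : nat) : s n = n%:R * s 1 /\ s n.+1 = n.+1%:R * s 1.
  elim: n => [|n [IH1 IH2]]; first by rewrite s0 mul0r mul1r.
  split=> //; have := @s_lin n.+1%:Z isT.
  have -> : n.+1%:Z + 1 = n.+2%:Z by rewrite -PoszD addn1.
  have -> : n.+1%:Z - 1 = n%:Z by rewrite -addn1 PoszD addrK.
  by rewrite IH1 IH2 => ->; rewrite -!natr1; ring.
have s1 : s 1 = 0.
  apply/eqP; rewrite eq_le s_ge0 andbT leNgt; apply/negP => s10.
  have [n hn] : exists n : nat, (s 1)^-1 < n%:R.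
    by exists (Num.truncn (s 1)^-1).+1; exact: truncnS_gt.
  have := s_le1 n; rewrite (s_mul n).1 leNgt => /negP; apply.
  by rewrite -ltr_pdivrMr // div1r.
suff <- : s h = 0 by exact: s_cvg.
case: h => n; first by rewrite (s_mul n).1 s1 mulr0.
by rewrite NegzE sN (s_mul n).2 s1 mulr0.
Unshelve. all: by end_near. Qed.

(** Both functions agree on the level 0 and average in the same way off it, so the error comes only
    from paths that have not reached the level within M steps. *)
Lemma hit_avg_approx F (B : R) M x h :
  (forall y k, `|F y k| <= B) -> (forall y k, k != 0 -> F y k = cyl_avg F y k) ->
  `|F x h - hit_avg (F ^~ 0) M x h| <= B * escape M h.
Proof.
move=> FB Fh; elim: M x h => [|M IH] x h /=.
  by case: eqP => [->|_]; rewrite ?subrr ?normr0 ?mulr0 // subr0 mulr1.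
case: (eqVneq h 0) => [->|h0]; first by rewrite subrr normr0 mulr0.
rewrite Fh // -cyl_avgB.
have -> : B * cyl_avg (fun _ : T => escape M) 0 h = cyl_avg (fun _ : T => fun k => B * escape M k) x h.
  rewrite /cyl_avg mulrA mulrDr mulr_sumr; congr ((_ + _) / _); last by rewrite mulrDr.
  by apply: eq_bigr => i _; rewrite mulrDr.
rewrite ler_norml; apply/andP; split.
  have -> : - cyl_avg (fun _ : T => fun k => B * escape M k) x h =
     cyl_avg (fun (_ : T) k => 0 - B * escape M k) x h.
    by rewrite cyl_avgB cyl_avg_cst sub0r.
  apply: ler_cyl_avg => y k; rewrite sub0r.
  by have := IH y k; rewrite ler_norml => /andP[].
by apply: ler_cyl_avg => y k; have := IH y k; rewrite ler_norml => /andP[].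
Qed.

Lemma hit_avg_conv f M x h : hit_avg f M x h = \sum_y f y * hit_avg delta0 M (x - y) h.
Proof.
elim: M x h => [|M IH] x h /=.
  case: eqP => _; last by rewrite big1 // => y _; rewrite mulr0.
  under eq_bigr do rewrite /delta0 subr_eq0 eq_sym mulrC.
  by rewrite sum_delta.
case: eqP => _.
  under eq_bigr do rewrite /delta0 subr_eq0 eq_sym mulrC.
  by rewrite sum_delta.
under eq_bigr do rewrite -cyl_avg_shift.
rewrite -cyl_avg_sum; congr cyl_avg.
by apply/funext => y; apply/funext => k; exact: IH.
Qed.

Lemma hit_avg_opp M x h : hit_avg delta0 M (- x) h = hit_avg delta0 M x h.
Proof.
elim: M x h => [|M IH] x h /=; rewrite /delta0 oppr_eq0 //.
by case: eqP => // _; apply: cyl_avg_opp.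
Qed.

Lemma hit_avg_ge0 M x h : 0 <= hit_avg delta0 M x h.
Proof.
elim: M x h => [|M IH] x h /=; case: eqP => // _.
by rewrite -(cyl_avg_cst 0 x h); apply: ler_cyl_avg.
Qed.

Lemma hit_avg_le1 M x h : hit_avg delta0 M x h <= 1.
Proof.
have d1 y : delta0 y <= 1 by rewrite /delta0 lern1 leq_b1.
elim: M x h => [|M IH] x h /=; case: eqP => // _.
by rewrite -(cyl_avg_cst 1 x h); apply: ler_cyl_avg.
Qed.

Lemma hit_avg_incr M x h : hit_avg delta0 M x h <= hit_avg delta0 M.+1 x h.
Proof.
elim: M x h => [|M IH] x h.
  rewrite /=; case: eqP => // _; rewrite -[leLHS](cyl_avg_cst 0 x h); apply: ler_cyl_avg => y k.
  by case: eqP.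
rewrite {1}/hit_avg -/hit_avg [leRHS]/=; case: eqP => // _.
by apply: ler_cyl_avg => y k; exact: IH.
Qed.

(** Law of the displacement between consecutive visits to the level 0. A horizontal step counts as
    an immediate return; the limit is monotone in the horizon. *)
Definition trace_ker x : R := limn (fun M => cyl_avg (hit_avg delta0 M) x 0).

Lemma cvg_trace_ker x : cyl_avg (hit_avg delta0 M) x 0 @[M --> \oo] --> trace_ker x.
Proof.
suff : cvgn (fun M => cyl_avg (hit_avg delta0 M) x 0) by [].
apply: nondecreasing_is_cvgn.
  by apply/nondecreasing_seqP => M; apply: ler_cyl_avg => y k; exact: hit_avg_incr.
exists 1 => _ [M _ <-]; rewrite -(cyl_avg_cst 1 x 0).
by apply: ler_cyl_avg => y k; exact: hit_avg_le1.
Qed.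

Lemma trace_ker_ge0 x : 0 <= trace_ker x.
Proof.
apply: (cvgr_to_ge (cvg_trace_ker (x:=x))); near=> M.
rewrite -(cyl_avg_cst 0 x 0); apply: ler_cyl_avg => y k; exact: hit_avg_ge0.
Unshelve. all: by end_near. Qed.

Lemma trace_kerN x : trace_ker (- x) = trace_ker x.
Proof.
congr (limn _); apply/funext => M; apply: cyl_avg_opp => y k; exact: hit_avg_opp.
Qed.

(* The value at a zero-level neighbour of a bounded function harmonic off the
   level 0 is recovered from its values on that level (recurrence). *)
Lemma trace_ker_harmonic F (B : R) x :
  (forall y k, `|F y k| <= B) -> (forall y k, k != 0 -> F y k = cyl_avg F y k) ->
  \sum_y trace_ker (x - y) * F y 0 = cyl_avg F x 0.
Proof.
move=> FB Fh.
have c1 : cyl_avg (hit_avg (F ^~ 0) M) x 0 @[M --> \oo] --> \sum_y trace_ker (x - y) * F y 0.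
  rewrite (_ : (fun M => _) = (fun M => \sum_y cyl_avg (hit_avg delta0 M) (x - y) 0 * F y 0)); last first.
    apply/funext => M; under eq_bigr do rewrite mulrC -cyl_avg_shift.
    rewrite -cyl_avg_sum; congr cyl_avg.
    by apply/funext => y; apply/funext => k; exact: hit_avg_conv.
  apply: (@cvg_big _ _ +%R 0 xpredT add_continuous) => y _.
  by apply: cvgMl; exact: cvg_trace_ker.
suff c2 : cyl_avg (hit_avg (F ^~ 0) M) x 0 @[M --> \oo] --> cyl_avg F x 0.
  exact: cvg_unique _ c1 c2.
have c3 y k : hit_avg (F ^~ 0) M y k @[M --> \oo] --> F y k.
  apply/cvgrPdist_le => e e0.
  have B0 : 0 < B + 1.
    by rewrite ltr_wpDl // (le_trans _ (FB 0 0)).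
  have /cvgrPdist_le/(_ (e / (B + 1)))/(_ (divr_gt0 e0 B0)) := cvg_escape k.
  apply: filterS => M; rewrite sub0r normrN ger0_norm ?escape_ge0 // ler_pdivlMr // => h.
  apply: le_trans (hit_avg_approx M y k FB Fh) _; apply: le_trans h.
  by rewrite mulrC ler_wpM2l ?escape_ge0 // lerDl.
apply: cvgMl; apply: cvgD; last by apply: cvgD; exact: c3.
apply: (@cvg_big _ _ +%R 0 xpredT add_continuous) => i _.
by apply: cvgD; exact: c3.
Qed.

Definition trace_op f x : R := \sum_y trace_ker (x - y) * f y.

Lemma trace_ker_sum x : \sum_y trace_ker (x - y) = 1.
Proof.
have := @trace_ker_harmonic (fun _ _ => 1) 1 x.
rewrite cyl_avg_cst => <-.
- by apply: eq_bigr => y _; rewrite mulr1.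
- by move=> y k; rewrite normr1.
- by move=> y k _; rewrite cyl_avg_cst.
Qed.

(** [cyl_pot] is bounded and harmonic off the level 0, so its trace average equals its cylinder
    average, which [cyl_pot_poisson] computes on the level. *)
Lemma trace_op_pot w x :
  trace_op (fun y => torus_pot (y - w)) x =
  torus_pot (x - w) - (x == w)%:R + (N%:R ^+ d)^-1.
Proof.
have [B hB] := @cyl_pot_bounded R d N N1.
rewrite /trace_op (@trace_ker_harmonic (fun y k => cyl_pot (y - w) k) B) //.
  rewrite cyl_avg_shift; have := @cyl_pot_poisson R d N N1 (x - w) 0.
  rewrite eqxx mul1r subr_eq0 => e; rewrite /torus_pot.
  set u := cyl_pot _ 0 in e *; set v := cyl_avg _ _ _ in e *.
  by rewrite -(subKr u v) e opprB addrCA addrC.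
move=> y k k0; rewrite cyl_avg_shift.
have := @cyl_pot_poisson R d N N1 (y - w) k.
by rewrite (negbTE k0) mul0r => /eqP; rewrite subr_eq0 => /eqP.
Qed.

Lemma ler_trace_op f g x : (forall y, f y <= g y) -> trace_op f x <= trace_op g x.
Proof. by move=> fg; apply: ler_sum => y _; rewrite ler_wpM2l ?trace_ker_ge0. Qed.

Lemma trace_op_cst c x : trace_op (fun=> c) x = c.
Proof. by rewrite /trace_op -mulr_suml trace_ker_sum mul1r. Qed.

Lemma trace_opZ a f x : trace_op (fun y => a * f y) x = a * trace_op f x.
Proof. by rewrite /trace_op mulr_sumr; apply: eq_bigr => y _; rewrite mulrCA. Qed.

Lemma trace_op_sum (I : Type) (r : seq I) (P : pred I) (f : I -> T -> R) x :
  trace_op (fun y => \sum_(i <- r | P i) f i y) x = \sum_(i <- r | P i) trace_op (f i) x.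
Proof. by rewrite /trace_op exchange_big /=; apply: eq_bigr => y _; rewrite mulr_sumr. Qed.

Lemma trace_opB f g x : trace_op (fun y => f y - g y) x = trace_op f x - trace_op g x.
Proof. by rewrite /trace_op -sumrB; apply: eq_bigr => y _; rewrite mulrBr. Qed.

(** Reversibility of the trace: its kernel is an even function of the displacement. *)
Lemma trace_op_adjoint f g : \sum_x f x * trace_op g x = \sum_x trace_op f x * g x.
Proof.
rewrite /trace_op; under eq_bigr do rewrite mulr_sumr.
under [RHS]eq_bigr do rewrite mulr_suml.
rewrite exchange_big /=; apply: eq_bigr => y _; apply: eq_bigr => x _.
by rewrite -trace_kerN opprB; ring.
Qed.

End trace_kernel.

(** * Avoidance probabilities of the trace *)

Section boxes.
Variables (d N : nat).
Implicit Types (r : nat) (v x y w : torus d N) (W J : {set torus d N}).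

(** With the radius doubled, a site lies in the box of radius r around at most one point of W. *)
Definition far_apart r W := forall x y, x \in W -> y \in W -> x != y -> ~ in_box r.*2 (x - y).

Lemma in_boxB r v x y : in_box r (v - x) -> in_box r (v - y) -> in_box r.*2 (x - y).
Proof.
move=> hx hy i; have [k kr ek] := hx i; have [l lr el] := hy i.
exists (l + (r.*2 - k))%N; first by move: kr lr; lia.
have -> : (x - y) 0 i = (v - y) 0 i - (v - x) 0 i by rewrite !mxE; ring.
rewrite ek el natrD natrB // -addnn !natrD.
by rewrite opprB [in RHS]addrC -!addrA; ring.
Qed.

Lemma sub_in_box r x : in_box r x -> in_box r.*2 x.
Proof.
move=> h i; have [k kr ->] := h i; exists (k + r)%N; first by move: kr; lia.
by rewrite natrD -addnn natrD opprD addrA addrK.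
Qed.

Lemma in_box0 r : in_box r (0 : torus d N).
Proof. by move=> i; exists r; rewrite ?subrr ?mxE // -addnn leq_addr. Qed.

Lemma in_boxN r x : in_box r x -> in_box r (- x).
Proof.
move=> h i; have [k kr e] := h i; exists (r.*2 - k)%N; first exact: leq_subr.
by rewrite mxE e natrB // -addnn natrD; ring.
Qed.

Lemma separatedU1 r w J : far_apart r J -> (forall v, v \in J -> ~ in_box r.*2 (w - v)) ->
  far_apart r (w |: J)%SET.
Proof.
move=> sJ h x y /setU1P[->|xJ] /setU1P[->|yJ] xy; first by rewrite eqxx in xy.
- exact: h.
- by move=> /in_boxN; rewrite opprB; exact: h.
- exact: sJ.
Qed.

End boxes.

(** * Test functions for the trace killed on a set *)

Section avoidance.
Context {R : realType} (d N : nat) (N1 : (1 < N)%N).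
Local Notation T := (torus d N).
Local Notation pot := (@torus_pot R d N).
Local Notation Q := (@trace_op R d N).
Local Notation n := (N%:R ^+ d : R).
Implicit Types (W J : {set T}) (x y w v : T) (k : nat).

Let n0 : 0 < n. Proof. by rewrite exprn_gt0 // ltr0n ltnW. Qed.

(* Probability that the trace of the walk on the level 0, started at x,
   avoids W at times 0, ..., k. *)
Fixpoint avoid W k x : R :=
  (x \notin W)%:R * (if k is j.+1 then Q (avoid W j) x else 1).

Definition avoid_prob W k : R := (\sum_x avoid W k x) / n.

Lemma avoid_in W k x : x \in W -> avoid W k x = 0.
Proof. by case: k => [|k] xW /=; rewrite xW mul0r. Qed.

Lemma avoid_ge0 W k x : 0 <= avoid W k x.
Proof.
elim: k x => [|k IH] x /=; first by rewrite mulr1.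
rewrite mulr_ge0 // -(trace_op_cst (N := N) 0 x); exact: ler_trace_op.
Qed.

Lemma avoid_prob_le W k (S : R) : (forall x, avoid W k x <= S) -> avoid_prob W k <= S.
Proof.
move=> h; rewrite ler_pdivrMr // mulrC.
apply: le_trans (ler_sum _ (fun x _ => h x)) _.
by rewrite sumr_const -[S *+ _]mulr_natl card_torus // natrX.
Qed.

Section potential.
Variables (W : {set T}) (a : T -> R).
Hypothesis a0 : forall w, 0 <= a w.

(** One minus the potential of charges [a] on W. Off W a trace step lowers it by exactly
    [cap_mass / n], so [cap_mass] acts as the capacity of W once the charges make this function
    nearly 0 on W. *)
Definition cap_pot x : R := 1 - \sum_(w in W) a w * pot (x - w).
Definition cap_mass : R := \sum_(w in W) a w.

Lemma cap_mass_ge0 : 0 <= cap_mass. Proof. exact: sumr_ge0. Qed.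

Lemma trace_op_cap_pot x : x \notin W -> Q cap_pot x = cap_pot x - cap_mass / n.
Proof.
move=> xW; rewrite /cap_pot trace_opB trace_op_cst // trace_op_sum.
under eq_bigr do rewrite trace_opZ trace_op_pot //.
rewrite -addrA -opprD; congr (_ - _); rewrite /cap_mass mulr_suml -big_split /=.
apply: eq_bigr => w wW; case: eqP xW => [->|_ _]; first by rewrite wW.
by rewrite subr0 mulrDr.
Qed.

(** Under the uniform start, symmetry moves the trace operator from [avoid], which is unknown, onto
    [cap_pot], where it is explicit. This gives a recursion linking the energy and [avoid_prob]. *)
Definition cap_energy k : R := (\sum_x cap_pot x * avoid W k x) / n.

Let energy_step k :
  \sum_x cap_pot x * Q (avoid W k) x = n * (cap_energy k - cap_mass / n * avoid_prob W k).
Proof.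
rewrite trace_op_adjoint /cap_energy /avoid_prob.
transitivity (\sum_x (cap_pot x * avoid W k x - cap_mass / n * avoid W k x)).
  apply: eq_bigr => x _; have [xW|xW] := boolP (x \in W).
    by rewrite avoid_in // !mulr0 subrr.
  by rewrite trace_op_cap_pot // mulrBl.
by rewrite sumrB -mulr_sumr; field; rewrite gt_eqF.
Qed.

Let Q_ge0 k x : 0 <= Q (avoid W k) x.
Proof.
rewrite -(trace_op_cst (N := N) 0 x); apply: ler_trace_op => // y; exact: avoid_ge0.
Qed.

(** Killing drops from the sum the values on W, which are [cap_pot] times something nonnegative; the
    sign of [cap_pot] on W fixes the direction of the inequality. *)
Lemma cap_energy_le k : (forall w, w \in W -> 0 <= cap_pot w) ->
  cap_energy k.+1 <= cap_energy k - cap_mass / n * avoid_prob W k.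
Proof.
move=> h; rewrite ler_pdivrMr // mulrC -energy_step; apply: ler_sum => x _ /=.
have [xW|xW] := boolP (x \in W); last by rewrite mul1r.
by rewrite mul0r mulr0 mulr_ge0 ?h ?Q_ge0.
Qed.

Lemma cap_energy_ge k : (forall w, w \in W -> cap_pot w <= 0) ->
  cap_energy k - cap_mass / n * avoid_prob W k <= cap_energy k.+1.
Proof.
move=> h; rewrite ler_pdivlMr // mulrC -energy_step; apply: ler_sum => x _ /=.
have [xW|xW] := boolP (x \in W); last by rewrite mul1r.
by rewrite mul0r mulr0 mulr_le0_ge0 ?h ?Q_ge0.
Qed.

(* cap_pot is a supersolution for the walk killed on W *)
Lemma avoid_le k x (c M : R) : 0 < c -> 0 < M -> cap_mass <= n * M ->
  (forall w, w \in W -> 0 <= cap_pot w) -> (forall y, y \notin W -> c <= cap_pot y) ->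
  (forall y, cap_pot y <= M) ->
  avoid W k x <= M / c * (1 - cap_mass / (n * M)) ^+ k.
Proof.
move=> c0 M0 hM hW hc hle; set lam := 1 - _.
have nM0 : 0 < n * M by rewrite mulr_gt0.
have lam0 : 0 <= lam by rewrite subr_ge0 ler_pdivrMr // mul1r.
have phi0 y : 0 <= cap_pot y.
  by have [/hW//|/hc] := boolP (y \in W); apply: le_trans; exact: ltW.
suff h j y : avoid W j y <= c^-1 * lam ^+ j * cap_pot y.
  apply: le_trans (h k x) _; rewrite (_ : M / c * lam ^+ k = c^-1 * lam ^+ k * M); last by ring.
  by rewrite ler_wpM2l // mulr_ge0 ?exprn_ge0 // invr_ge0 ltW.
elim: j y => [|j IH] y.
  rewrite /= mulr1 expr0 mulr1; have [yW|yW] := boolP (y \in W).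
    by rewrite mulr_ge0 // invr_ge0 ltW.
  by rewrite mulrC ler_pdivlMr // mul1r hc.
have [yW|yW] := boolP (y \in W).
  by rewrite avoid_in // !mulr_ge0 ?exprn_ge0 // invr_ge0 ltW.
rewrite /= yW mul1r; apply: le_trans (ler_trace_op y IH) _.
rewrite trace_opZ trace_op_cap_pot // exprS -!mulrA ler_wpM2l ?invr_ge0 ?(ltW c0) //.
(* The additive loss [cap_mass / n] is also a multiplicative one, because [cap_pot] is at most M. *)
rewrite mulrCA ler_wpM2l ?exprn_ge0 // /lam mulrBl mul1r lerB //.
rewrite mulrAC ler_pdivrMr // mulrA mulfVK ?gt_eqF // ler_wpM2l ?cap_mass_ge0 //.
Qed.

End potential.

Section estimates.
Variables (eta beta : R) (r : nat).
Local Notation G := (pot 0).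
Hypothesis eta0 : 0 <= eta.
Hypothesis beta0 : 0 <= beta.
Hypothesis pot_lb : forall x, - eta <= pot x.
Hypothesis pot_far : forall x, ~ in_box r x -> pot x <= eta.
Hypothesis G_half : 1 / 2 <= G.
Hypothesis pot_sum : \sum_x Num.max (pot x) 0 <= n * beta.

Let G0 : 0 < G. Proof. by apply: lt_le_trans G_half; rewrite divr_gt0. Qed.

Lemma pot_le x : pot x <= G.
Proof.
have [->//|x0] := eqVneq x 0; apply: le_trans (torus_pot_gap N1 x0) _.
by rewrite gerBl.
Qed.

Lemma sum_pot_ge J v : - (#|J|%:R * eta) <= \sum_(w in J) pot (v - w).
Proof.
rewrite -mulrN mulr_natl -sumr_const; exact: ler_sum.
Qed.

(** Separation leaves at most one point of J near v, bounded by B; all others contribute at most eta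
    each. *)
Lemma sum_pot_le J v (B : R) : far_apart r J -> 0 <= B ->
  (forall w, w \in J -> pot (v - w) <= B) ->
  \sum_(w in J) pot (v - w) <= B + #|J|%:R * eta.
Proof.
move=> sJ B0 hB.
have far J' : (forall w, w \in J' -> ~ in_box r (v - w)) ->
    \sum_(w in J') pot (v - w) <= #|J'|%:R * eta.
  by move=> h; rewrite mulr_natl -sumr_const; apply: ler_sum => w wJ; apply: pot_far; apply: h.
have [[w wJ wv]|h] := pselect (exists2 w, w \in J & in_box r (v - w)); last first.
  apply: le_trans (far J _) _; last by rewrite lerDr.
  by move=> w wJ wv; apply: h; exists w.
rewrite (big_setD1 w) //= lerD ?hB //.
apply: (@le_trans _ _ (#|J :\ w|%:R * eta)).
  apply: far => y; rewrite !inE => /andP[yw yJ] yv.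
  by apply: (sJ _ _ wJ yJ); [rewrite eq_sym|exact: in_boxB wv yv].
by rewrite ler_wpM2r // ler_nat subset_leq_card // subD1set.
Qed.

Lemma avg_pot_avoid W k (S : R) : (forall x, avoid W k x <= S) ->
  (\sum_x (\sum_(w in W) pot (x - w)) * avoid W k x) / n <= #|W|%:R * beta * S.
Proof.
move=> hS; have S0 : 0 <= S by apply: le_trans (hS 0); exact: avoid_ge0.
under eq_bigr do rewrite mulr_suml.
rewrite exchange_big /= ler_pdivrMr //.
have -> : #|W|%:R * beta * S * n = \sum_(w in W) (n * beta * S).
  by rewrite sumr_const -[RHS]mulr_natl; ring.
apply: ler_sum => w _.
apply: (@le_trans _ _ ((\sum_x Num.max (pot (x - w)) 0) * S)).
  rewrite mulr_suml; apply: ler_sum => x _.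
  apply: (@le_trans _ _ (Num.max (pot (x - w)) 0 * avoid W k x)).
    by rewrite ler_wpM2r ?avoid_ge0 // le_max lexx.
  by rewrite ler_wpM2l // le_max lexx orbT.
rewrite ler_wpM2r //; apply: le_trans pot_sum.
by rewrite [leRHS](reindex (fun x => x - w)) //=; exists (fun x => x + w) => x _; rewrite ?subrK ?addrK.
Qed.

(** * Sharp bounds for well-separated sets *)

Section separated_set.
Variables (W : {set T}) (m : nat).
Hypothesis Wm : #|W| = m.
Hypothesis sW : far_apart r W.
Hypothesis m_eta : m%:R * eta < G / 4.
Hypothesis n_large : 8 * m%:R <= n.

Let me0 : 0 <= m%:R * eta. Proof. by rewrite mulr_ge0. Qed.
(** On W the potentials of unit charges add up to a number between G - m eta and G + m eta, so
    charges [ap] make [cap_pot] nonnegative there and charges [am] make it nonpositive. *)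
Let ap : R := (G + m%:R * eta)^-1.
Let am : R := (G - m%:R * eta)^-1.
Let M : R := 1 + ap * (m%:R * eta).

Let ap0 : 0 < ap. Proof. by rewrite invr_gt0 ltr_wpDr. Qed.
Let Gm0 : 0 < G - m%:R * eta. Proof. by move: m_eta G0; lra. Qed.
Let am0 : 0 < am. Proof. by rewrite invr_gt0. Qed.
Let M1 : 1 <= M. Proof. by rewrite lerDl mulr_ge0 // ltW. Qed.

Let cap_potE al x : cap_pot W (fun=> al) x = 1 - al * \sum_(w in W) pot (x - w).
Proof. by rewrite /cap_pot mulr_sumr. Qed.

Let cap_massE al : cap_mass W (fun=> al) = m%:R * al.
Proof. by rewrite /cap_mass sumr_const Wm mulr_natl. Qed.

Let sum_in v : v \in W -> G - m%:R * eta <= \sum_(w in W) pot (v - w) <= G + m%:R * eta.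
Proof.
move=> vW; apply/andP; split.
  rewrite (big_setD1 v) //= subrr lerD2l; apply: le_trans (sum_pot_ge _ _).
  by rewrite lerN2 ler_wpM2r // ler_nat -Wm subset_leq_card // subD1set.
by rewrite -Wm; apply: sum_pot_le => // [|w _]; [exact: ltW|exact: pot_le].
Qed.

Let sum_out v : v \notin W -> \sum_(w in W) pot (v - w) <= G - 1 / 2 + m%:R * eta.
Proof.
move=> vW; rewrite -Wm; apply: sum_pot_le => // [|w wW]; first by rewrite subr_ge0.
apply: torus_pot_gap => //; rewrite subr_eq0; apply: contra vW => /eqP ->//.
Qed.

(** This is 1 minus the mass m [ap] over n M, as (G + m eta) M = G + 2 m eta. *)
Definition rate_up : R := 1 - m%:R / (n * (G + 2 * (m%:R * eta))).
Definition rate_low : R := 1 - m%:R / (n * (G - m%:R * eta)).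

Let rate_upE : rate_up = 1 - cap_mass W (fun=> ap) / (n * M).
Proof.
rewrite cap_massE /rate_up /M /ap; congr (1 - _).
have p1 : G + m%:R * eta != 0 by rewrite gt_eqF // ltr_wpDr.
have p2 : G + m%:R * eta + m%:R * eta != 0 by rewrite gt_eqF // !ltr_wpDr.
have p3 : n != 0 by rewrite gt_eqF.
have -> : G + 2 * (m%:R * eta) = G + m%:R * eta + m%:R * eta by ring.
have -> : 1 + (G + m%:R * eta)^-1 * (m%:R * eta) = (G + m%:R * eta + m%:R * eta) / (G + m%:R * eta).
  by rewrite [RHS]mulrDl mulfV // [_^-1 * _]mulrC.
move: p1 p2; set u := G + _; set v := u + _ => p1 p2.
by field; rewrite p1 p2 p3.
Qed.

Let avoid_up k x : avoid W k x <= 2 * M / ap * rate_up ^+ k.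
Proof.
have M0 : 0 < M by apply: lt_le_trans M1.
rewrite rate_upE (_ : 2 * M / ap = M / (ap / 2)); last by field; rewrite gt_eqF.
apply: avoid_le => //.
- by move=> _; exact: ltW.
- by rewrite divr_gt0.
- rewrite cap_massE; apply: (@le_trans _ _ n); last by rewrite ler_peMr // ltW.
  apply: le_trans n_large; rewrite mulrC ler_wpM2r //.
  rewrite invf_ple ?posrE // ?ltr_wpDr //.
  by apply: (@le_trans _ _ (1 / 2)); [lra|apply: le_trans G_half _; rewrite lerDl].
- move=> w /sum_in/andP[_ h]; rewrite cap_potE subr_ge0 mulrC -ler_pdivlMr // invrK mul1r //.
- move=> y /sum_out h; rewrite cap_potE.
  rewrite lerBrDr -lerBrDl; apply: le_trans (ler_wpM2l (ltW ap0) h) _.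
  have e : ap * (G + m%:R * eta) = 1 by rewrite mulVf // gt_eqF // ltr_wpDr.
  by move: e; nra.
- move=> y; rewrite cap_potE /M lerD2l lerNl -mulrN ler_wpM2l ?(ltW ap0) // lerNl -Wm.
  by rewrite lerNl; exact: sum_pot_ge.
Qed.

Let rate_up0 : 0 <= rate_up.
Proof.
have D0 : 1 / 2 <= G + 2 * (m%:R * eta) by move: G_half me0; lra.
rewrite subr_ge0 ler_pdivrMr ?mul1r; last by rewrite mulr_gt0 //; move: D0; lra.
apply: (@le_trans _ _ (n * (1 / 2))); last by rewrite ler_wpM2l ?(ltW n0).
by move: n_large (ler0n R m); lra.
Qed.

Let energyE al k : avoid_prob W k = cap_energy W (fun=> al) k +
  al * ((\sum_x (\sum_(w in W) pot (x - w)) * avoid W k x) / n).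
Proof.
rewrite /avoid_prob /cap_energy mulrA -mulrDl; congr (_ / _).
by rewrite mulr_sumr -big_split /=; apply: eq_bigr => x _; rewrite cap_potE; ring.
Qed.

(** [avoid_up] alone would leave the prefactor 2 M / ap. The energy decays at the same rate from at
    most M, and [avoid_prob] exceeds it by an average of potentials, which costs 2 m beta; the
    prefactor thus tends to 1 with eta and beta. *)
Lemma separated_upper k :
  avoid_prob W k <= rate_up ^+ k * (M * (1 + 2 * m%:R * beta)).
Proof.
have M0 : 0 < M by apply: lt_le_trans M1.
have le_M y : cap_pot W (fun=> ap) y <= M.
  rewrite cap_potE /M lerD2l lerNl -mulrN ler_wpM2l ?(ltW ap0) // -Wm; exact: sum_pot_ge.
have en_le j : cap_energy W (fun=> ap) j <= M * avoid_prob W j.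
  rewrite /cap_energy /avoid_prob mulrA ler_wpM2r ?invr_ge0 ?(ltW n0) // mulr_sumr.
  by apply: ler_sum => x _; rewrite ler_wpM2r ?avoid_ge0.
have en k' : cap_energy W (fun=> ap) k' <= rate_up ^+ k' * M.
  elim: k' => [|j IH].
    rewrite expr0 mul1r; apply: le_trans (en_le 0%N) _; rewrite ler_piMr ?(ltW M0) //.
    by apply: avoid_prob_le => x /=; rewrite mulr1; case: (_ \in _).
  apply: (@le_trans _ _ (cap_energy W (fun=> ap) j - cap_mass W (fun=> ap) / n * avoid_prob W j)).
    apply: cap_energy_le => // w /sum_in/andP[_ h].
    by rewrite cap_potE subr_ge0 mulrC -ler_pdivlMr // invrK mul1r.
  have h2 : rate_up * cap_energy W (fun=> ap) j <= rate_up ^+ j.+1 * M.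
    by rewrite exprS -mulrA ler_wpM2l.
  apply: le_trans h2.
  rewrite rate_upE mulrBl mul1r lerD2l lerN2.
  have -> : cap_mass W (fun=> ap) / (n * M) * cap_energy W (fun=> ap) j =
      cap_mass W (fun=> ap) / n * (cap_energy W (fun=> ap) j / M) by rewrite invfM; ring.
  rewrite ler_wpM2l //; last by rewrite ler_pdivrMr // mulrC.
  by rewrite divr_ge0 ?(ltW n0) // cap_mass_ge0 // => _; exact: ltW.
rewrite (energyE ap); apply: le_trans (lerD (en k) (ler_wpM2l (ltW ap0) (avg_pot_avoid (avoid_up k)))) _.
rewrite Wm le_eqVlt; apply/orP; left; apply/eqP; field.
by rewrite gt_eqF.
Qed.

(** Charges [am] reverse the energy inequality. Replacing [avoid_prob] by the energy costs a term of
    order beta / n at each of the k steps; as k is of order n log n, this is harmless once beta log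
    n tends to 0. *)
Lemma separated_lower k :
  rate_low ^+ k * (1 - am * m%:R * beta) -
  k%:R * (m%:R * am / n * (am * (m%:R * beta * (2 * M / ap)))) * rate_up ^+ k.-1 <=
  avoid_prob W k * (1 + am * (m%:R * eta)).
Proof.
have M0 : 0 < M by apply: lt_le_trans M1.
set sig := _ / n * _.
have sig0 : 0 <= sig.
  rewrite /sig; apply: mulr_ge0; first by rewrite !mulr_ge0 // ?invr_ge0 ltW.
  apply: mulr_ge0; first exact: ltW.
  apply: mulr_ge0; first exact: mulr_ge0.
  by apply: mulr_ge0; [apply: mulr_ge0 => //; exact: ltW|rewrite invr_ge0; exact: ltW].
have rate_le : rate_low <= rate_up.
  have Gp : 0 < G + 2 * (m%:R * eta) by move: G0 me0; lra.
  rewrite lerD2l lerN2 ler_wpM2l // lef_pV2 ?posrE ?(mulr_gt0 n0) //.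
  by rewrite ler_pM2l //; move: me0; lra.
have rate_low0 : 0 <= rate_low.
  rewrite subr_ge0 ler_pdivrMr ?mul1r ?mulr_gt0 //.
  apply: (@le_trans _ _ (n * (1 / 4))); first by move: n_large (ler0n R m); lra.
  by rewrite ler_wpM2l ?(ltW n0) //; move: m_eta G_half; lra.
have en j : rate_low ^+ j * (1 - am * m%:R * beta) - j%:R * sig * rate_up ^+ j.-1 <=
    cap_energy W (fun=> am) j.
  elim: j => [|j IH].
    rewrite !mul0r subr0 mul1r /cap_energy ler_pdivlMr //.
    apply: (@le_trans _ _ (\sum_x cap_pot W (fun=> am) x)).
      under eq_bigr do rewrite cap_potE.
      rewrite sumrB sumr_const card_torus // natrX mulrBl mul1r lerB //.
      rewrite -mulr_sumr exchange_big /= -mulrA -mulrA ler_wpM2l ?(ltW am0) //.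
      have -> : m%:R * beta * n = \sum_(w in W) (n * beta).
        by rewrite sumr_const Wm -[RHS]mulr_natl; ring.
      apply: ler_sum => w _; apply: le_trans pot_sum.
      rewrite [leLHS](reindex (fun x => x + w)) /=; last first.
        by exists (fun x => x - w) => x _; rewrite ?subrK ?addrK.
      by apply: ler_sum => x _; rewrite addrK le_max lexx.
    apply: ler_sum => x _ /=; rewrite mulr1.
    have [/sum_in/andP[h _]|_] := boolP (x \in W); last by rewrite mulr1.
    by rewrite mulr0 cap_potE subr_le0 mulrC -ler_pdivrMr // div1r invrK.
  apply: (@le_trans _ _ (cap_energy W (fun=> am) j - cap_mass W (fun=> am) / n * avoid_prob W j)); last first.
    apply: cap_energy_ge => // w /sum_in/andP[h _].
    by rewrite cap_potE subr_le0 mulrC -ler_pdivrMr // div1r invrK.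
  have -> : cap_energy W (fun=> am) j - cap_mass W (fun=> am) / n * avoid_prob W j =
      rate_low * cap_energy W (fun=> am) j - cap_mass W (fun=> am) / n *
      (am * ((\sum_x (\sum_(w in W) pot (x - w)) * avoid W j x) / n)).
    rewrite (energyE am); set rr := am * _; set e := cap_energy _ _ _.
    by rewrite cap_massE /rate_low /am; field; rewrite !gt_eqF.
  have h1 : cap_mass W (fun=> am) / n * (am * ((\sum_x (\sum_(w in W) pot (x - w)) * avoid W j x) / n)) <= sig * rate_up ^+ j.
    rewrite cap_massE /sig -[leRHS]mulrA; apply: ler_wpM2l.
      apply: mulr_ge0; first by apply: mulr_ge0 => //; exact: ltW.
      by rewrite invr_ge0 ltW.
    rewrite -[leRHS]mulrA; apply: ler_wpM2l; first exact: ltW.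
    by apply: le_trans (avg_pot_avoid (avoid_up j)) _; rewrite Wm le_eqVlt; apply/orP; left; apply/eqP; ring.
  apply: le_trans (lerB (ler_wpM2l rate_low0 IH) h1).
  have h2 : rate_low * (j%:R * sig * rate_up ^+ j.-1) <= j%:R * sig * rate_up ^+ j.
    case: (j) => [|j']; first by rewrite !mul0r mulr0.
    rewrite mulrCA; apply: ler_wpM2l; first exact: mulr_ge0.
    by rewrite exprS; apply: ler_wpM2r => //; exact: exprn_ge0.
  rewrite exprS -natr1 /=; move: h2.
  move: (rate_low ^+ j) (rate_up ^+ j) (rate_up ^+ j.-1) => p q s.
  by lra.
apply: le_trans (en k) _; rewrite mulrDr mulr1.
rewrite {1}(energyE am) -[leLHS]addr0 -addrA lerD2l.
have h3 : - (m%:R * eta * avoid_prob W k) <= (\sum_x (\sum_(w in W) pot (x - w)) * avoid W k x) / n.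
  rewrite /avoid_prob mulrA -mulNr ler_wpM2r ?invr_ge0 ?(ltW n0) //.
  rewrite mulr_sumr -sumrN; apply: ler_sum => x _.
  by rewrite -mulNr ler_wpM2r ?avoid_ge0 // -Wm sum_pot_ge.
have := ler_wpM2l (ltW am0) h3; rewrite mulrN => h4.
by rewrite -lerBlDr sub0r; apply: le_trans h4; rewrite lerN2 le_eqVlt; apply/orP; left; apply/eqP; ring.
Qed.

End separated_set.

(** * Sets containing two points with no lower bound on their distance *)

Section clustered_set.
Variables (J : {set T}) (x y : T) (m : nat).
Hypothesis Jm : #|J| = m.
Hypothesis xy : x != y.
Hypotheses (xJ : x \notin J) (yJ : y \notin J).
Hypothesis sx : far_apart r (x |: J).
Hypothesis sy : far_apart r (y |: J).
Hypothesis n_large : 8 * (m%:R + 2) <= n.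

Let W := [set x; y] :|: J.
Let c : R := (2 * m%:R + 2) * eta.
(** At x and at y the pair contributes at most G + (G - 1/2), which dictates [be]; [al] is the
    charge of an isolated point. The cross terms between J and the pair are absorbed in [c]. The
    gain is 2 [be], close to 2 / (2G - 1/2), against 1/G for one point. *)
Let al : R := (G + c)^-1.
Let be : R := (2 * G - 1 / 2 + c)^-1.
Let a w : R := if w \in J then al else be.
Let M : R := 1 + al * ((m%:R + 2) * eta).

Definition cluster_rate : R :=
  1 - (m%:R / (G + c) + 2 / (2 * G - 1 / 2 + c)) / (n * (1 + (m%:R + 2) * eta / (G + c))).

Let c0 : 0 <= c. Proof. by rewrite mulr_ge0 // addr_ge0 // mulr_ge0. Qed.
Let al0 : 0 < al. Proof. by rewrite invr_gt0 ltr_wpDr. Qed.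
Let be0 : 0 < be. Proof. by rewrite invr_gt0; move: G_half c0; lra. Qed.
Let beal : be <= al.
Proof. by rewrite lef_pV2 ?posrE; move: G_half c0; lra. Qed.
Let albe : al <= 2 * be.
Proof.
rewrite -[2]invrK -invfM lef_pV2 ?posrE; move: G_half c0; try lra.
Qed.
Let al_e : al * (G + c) = 1. Proof. by rewrite mulVf // gt_eqF // ltr_wpDr. Qed.
Let be_e : be * (2 * G - 1 / 2 + c) = 1.
Proof. by rewrite mulVf // gt_eqF //; move: G_half c0; lra. Qed.

Let sumW (f : T -> R) : \sum_(w in W) a w * f w = al * (\sum_(w in J) f w) + be * (f x + f y).
Proof.
rewrite (big_setID J) /=.
have -> : W :&: J = J by apply/setP => w; rewrite !inE; case: (w \in J); rewrite ?orbT ?andbF.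
have -> : W :\: J = finset.setU (finset.set1 x) (finset.set1 y).
  apply/setP => w; rewrite !inE; case: (eqVneq w x) => [->|_]; first by rewrite xJ.
  case: (eqVneq w y) => [->|_]; first by rewrite yJ.
  by case: (w \in J).
rewrite mulr_sumr; congr (_ + _).
  by apply: eq_bigr => w wJ; rewrite /a wJ.
by rewrite big_setU1 ?inE // big_set1 /a (negbTE xJ) (negbTE yJ) mulrDr.
Qed.

Let sJ : far_apart r J.
Proof. by move=> u v uJ vJ; apply: sx; rewrite inE ?uJ ?vJ orbT. Qed.

Let far_x w v : w \in J -> in_box r (v - w) -> ~ in_box r (v - x).
Proof.
move=> wJ vw vx; apply: (sx (x := x) (y := w)); rewrite ?inE ?eqxx ?wJ ?orbT //.
  by apply: contraNneq xJ => ->.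
exact: in_boxB vx vw.
Qed.

Let far_y w v : w \in J -> in_box r (v - w) -> ~ in_box r (v - y).
Proof.
move=> wJ vw vx; apply: (sy (x := y) (y := w)); rewrite ?inE ?eqxx ?wJ ?orbT //.
  by apply: contraNneq yJ => ->.
exact: in_boxB vx vw.
Qed.

Let in_box0 : in_box r (0 : T).
Proof. by move=> i; exists r; [rewrite -addnn leq_addr|rewrite mxE subrr]. Qed.

Let near_J v : (exists2 w, w \in J & in_box r (v - w)) -> v \notin J ->
  al * (\sum_(w in J) pot (v - w)) + be * (pot (v - x) + pot (v - y)) <= 1 - al / 2.
Proof.
move=> [w wJ vw] vJ.
have h1 : \sum_(w in J) pot (v - w) <= G - 1 / 2 + m%:R * eta.
  rewrite -Jm; apply: sum_pot_le => // [|u uJ]; first by rewrite subr_ge0.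
  by apply: torus_pot_gap => //; rewrite subr_eq0; apply: contraNneq vJ => ->.
have h2 := pot_far (far_x wJ vw); have h3 := pot_far (far_y wJ vw).
have h4 : be * (pot (v - x) + pot (v - y)) <= al * (2 * eta).
  apply: (@le_trans _ _ (be * (2 * eta))); first by rewrite ler_wpM2l ?(ltW be0) //; lra.
  by rewrite ler_wpM2r // mulr_ge0.
apply: le_trans (lerD (ler_wpM2l (ltW al0) h1) h4) _.
have me : 0 <= al * (m%:R * eta) by rewrite !mulr_ge0 // ltW.
by move: al_e; rewrite /c; move: me; lra.
Qed.

Let far_J v : ~ (exists2 w, w \in J & in_box r (v - w)) ->
  al * (\sum_(w in J) pot (v - w)) <= be * (2 * m%:R * eta).
Proof.
move=> h; apply: (@le_trans _ _ (al * (m%:R * eta))).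
  rewrite ler_wpM2l ?(ltW al0) // -Jm mulr_natl -sumr_const; apply: ler_sum => w wJ.
  by apply: pot_far => vw; apply: h; exists w.
have me : 0 <= m%:R * eta by rewrite mulr_ge0.
apply: le_trans (ler_wpM2r me albe) _.
by rewrite le_eqVlt; apply/orP; left; apply/eqP; ring.
Qed.

(** Only the rate matters here, so the pointwise bound is enough. Off W the margin of [cap_pot] is
    at least al / 2 near J and be / 2 >= al / 4 elsewhere, whence the factor 4 (G + c). *)
Lemma cluster_upper k : avoid_prob W k <= (4 * (G + c) * (1 + (m%:R + 2) * eta / (G + c))) * cluster_rate ^+ k.
Proof.
apply: avoid_prob_le => v.
have M1 : 1 <= M by rewrite lerDl mulr_ge0 ?(ltW al0) // mulr_ge0 // addr_ge0.
have M0 : 0 < M by apply: lt_le_trans M1.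
have massE : cap_mass W a = m%:R * al + 2 * be.
  transitivity (\sum_(w in W) a w * 1); first by apply: eq_bigr => w _; rewrite mulr1.
  by rewrite sumW sumr_const Jm; ring.
have -> : cluster_rate = 1 - cap_mass W a / (n * M).
  by rewrite massE /cluster_rate /M [al * _]mulrC.
have -> : 4 * (G + c) * (1 + (m%:R + 2) * eta / (G + c)) = M / (al / 4).
  rewrite /M [al * _]mulrC /al; field.
  by rewrite gt_eqF // ltr_wpDr.
apply: avoid_le => //.
- by move=> w; rewrite /a; case: ifP => _; exact: ltW.
- by rewrite divr_gt0.
- rewrite massE; apply: (@le_trans _ _ n); last by rewrite ler_peMr // ltW.
  apply: le_trans n_large.
  have al2 : al <= 2.
    rewrite -[2]invrK lef_pV2 ?posrE ?invr_gt0 // ?ltr_wpDr //.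
    by move: G_half c0; lra.
  have : m%:R * al <= m%:R * 2 by rewrite ler_wpM2l.
  have m0 : (0 : R) <= m%:R by [].
  by move: beal al2 m0; lra.
- move=> w; rewrite /cap_pot sumW subr_ge0 !inE => wW.
  have [wJ|wJ] := boolP (w \in J).
    have h1 : \sum_(u in J) pot (w - u) <= G + m%:R * eta.
      rewrite -Jm; apply: sum_pot_le => // [|u _]; [exact: ltW|exact: pot_le].
    have ww : in_box r (w - w) by rewrite subrr.
    have h2 := pot_far (far_x wJ ww); have h3 := pot_far (far_y wJ ww).
    have h4 : be * (pot (w - x) + pot (w - y)) <= al * (2 * eta).
      apply: (@le_trans _ _ (be * (2 * eta))); first by rewrite ler_wpM2l ?(ltW be0) //; lra.
      by rewrite ler_wpM2r // mulr_ge0.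
    apply: le_trans (lerD (ler_wpM2l (ltW al0) h1) h4) _.
    have me : 0 <= al * (m%:R * eta) by rewrite !mulr_ge0 // ltW.
    by move: al_e; rewrite /c; move: me; lra.
  have hJ : ~ (exists2 u, u \in J & in_box r (w - u)).
    move: wW; rewrite (negbTE wJ) orbF => wW [u uJ wu].
    case/orP: wW => /eqP e; subst w.
      by apply: (far_x uJ wu); rewrite subrr.
    by apply: (far_y uJ wu); rewrite subrr.
  have h2 : pot (w - x) + pot (w - y) <= 2 * G - 1 / 2.
    move: wW; rewrite (negbTE wJ) orbF => /orP[] /eqP ->; rewrite subrr.
      have : pot (x - y) <= G - 1 / 2 by apply: torus_pot_gap => //; rewrite subr_eq0.
      by lra.
    have : pot (y - x) <= G - 1 / 2 by apply: torus_pot_gap => //; rewrite subr_eq0 eq_sym.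
    by lra.
  apply: le_trans (lerD (far_J hJ) (ler_wpM2l (ltW be0) h2)) _.
  have be_eta : 0 <= be * eta by rewrite mulr_ge0 // ltW.
  by move: be_e; rewrite /c; lra.
- move=> w; rewrite !inE !negb_or => /andP[/andP[wx wy] wJ].
  rewrite /cap_pot sumW lerBrDr -lerBrDl.
  have [hJ|hJ] := pselect (exists2 u, u \in J & in_box r (w - u)).
    by apply: le_trans (near_J hJ wJ) _; move: al0; lra.
  have h2 : pot (w - x) + pot (w - y) <= 2 * G - 1.
    have : pot (w - x) <= G - 1 / 2 by apply: torus_pot_gap => //; rewrite subr_eq0.
    have : pot (w - y) <= G - 1 / 2 by apply: torus_pot_gap => //; rewrite subr_eq0.
    by lra.
  apply: le_trans (lerD (far_J hJ) (ler_wpM2l (ltW be0) h2)) _.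
  have be_eta : 0 <= be * eta by rewrite mulr_ge0 // ltW.
  by move: be_e albe; rewrite /c; lra.
- move=> w; rewrite /cap_pot sumW /M lerD2l lerNl.
  have h1 := sum_pot_ge J w; rewrite Jm in h1.
  have h2 : be * (- (2 * eta)) <= be * (pot (w - x) + pot (w - y)).
    by rewrite ler_wpM2l ?(ltW be0) //; have := pot_lb (w - x); have := pot_lb (w - y); lra.
  apply: le_trans (lerD (ler_wpM2l (ltW al0) h1) h2).
  have : be * (2 * eta) <= al * (2 * eta) by rewrite ler_wpM2r // mulr_ge0.
  by lra.
Qed.

End clustered_set.
End estimates.
End avoidance.

(** * Asymptotics of the error terms *)

Section growth.
Context {R : realType}.

(** From u <= exp u at u = e l / A, raised to the power A. *)
Lemma pow_le_exp (A : nat) (e : R) : 0 < e ->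
  exists2 C : R, 0 < C & forall l : nat, l%:R ^+ A <= C * expR (e * l%:R).
Proof.
move=> e0; case: A => [|A].
  exists 1 => // l; rewrite mul1r expr0 (le_trans _ (expR_ge1Dx _)) // lerDl.
  by rewrite mulr_ge0 // ltW.
have A0 : (0 : R) < A.+1%:R by [].
exists ((A.+1%:R / e) ^+ A.+1) => [|l]; first by rewrite exprn_gt0 // divr_gt0.
have -> : e * l%:R = A.+1%:R * (e * l%:R / A.+1%:R) by rewrite [RHS]mulrCA mulfV ?mulr1 // gt_eqF.
have h : l%:R <= A.+1%:R / e * expR (e * l%:R / A.+1%:R).
  apply: (@le_trans _ _ (A.+1%:R / e * (e * l%:R / A.+1%:R))).
    rewrite le_eqVlt; apply/orP; left; apply/eqP.
    by move: (A.+1%:R) A0 => a a0; field; rewrite !gt_eqF.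
  rewrite ler_wpM2l ?divr_ge0 ?(ltW e0) //.
  by apply: le_trans (expR_ge1Dx _); rewrite lerDr.
rewrite expRM_natl -exprMn lerXn2r ?nnegrE //.
by apply: le_trans h.
Qed.

Definition log2 (N : nat) : nat := trunc_log 2 N.

Lemma log2_cvg : log2 N @[N --> \oo] --> \oo.
Proof.
apply/cvgnyPge => A; near=> N.
have : (2 ^ A <= N)%N by near: N; exact: nbhs_infty_ge.
by move=> h; rewrite /log2; apply: trunc_log_max.
Unshelve. all: by end_near. Qed.

Lemma log2_bounds N : (0 < N)%N -> 2 ^+ log2 N <= N%:R :> R /\ N%:R <= 2 ^+ (log2 N).+1 :> R.
Proof.
move=> N0; split; first by rewrite -natrX ler_nat trunc_logP.
by rewrite -natrX ler_nat ltnW // trunc_log_ltn.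
Qed.

Lemma ln_le_log2 N : (1 < N)%N -> ln (N%:R : R) <= 2 * (log2 N)%:R.
Proof.
move=> N1; have N0 : (0 < N)%N by apply: ltnW.
have l0 : (0 < log2 N)%N by rewrite /log2 trunc_log_gt0.
have [_ h] := log2_bounds N0.
rewrite -ler_expR lnK ?posrE ?ltr0n //; apply: le_trans h _.
have e2 : (2 : R) <= expR 1 by apply: le_trans (expR_ge1Dx 1); rewrite -natr1.
apply: (@le_trans _ _ (expR 1 ^+ (log2 N).+1)); first by rewrite lerXn2r ?nnegrE ?expR_ge0.
rewrite -expRM_natl ler_expR mulr_natl -mulr_natr ?mul1r; move: l0; case: (log2 N) => // l _.
by rewrite -[_.+2%:R]natr1 -natr1; have : (0 : R) <= l%:R by []; lra.
Qed.

Lemma cvg_div_log2 (C : R) : C / (log2 N)%:R @[N --> \oo] --> 0.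
Proof.
rewrite (_ : nbhs 0 = nbhs (C * 0)); last by rewrite mulr0.
apply: cvgMr.
suff h : (l%:R : R)^-1 @[l --> \oo] --> 0 by exact: (cvg_comp _ _ log2_cvg h).
apply/cvgrPdist_le => e e0; near=> l.
have l0 : (0 < l)%N by near: l; exact: nbhs_infty_gt.
rewrite sub0r normrN ger0_norm ?invr_ge0 // invf_ple ?posrE ?ltr0n //.
by near: l; exact: nbhs_infty_ger.
Unshelve. all: by end_near. Qed.

End growth.

(* The scale at which torus_pot is compared with the Green function of Z^(d+1) *)
Definition radius (N : nat) : nat := (log2 N ^ 8)%N.

Section error_terms.
Context {R : realType}.
Variables (d : nat) (d2 : (2 <= d)%N).
Local Notation g := (@latt_green R d).
Local Notation n N := (N%:R ^+ d : R).
Local Notation pot N := (@torus_pot R d N).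

(** With l = log2 N and cut-off l^8, whose root is l^4, the main tail is of order l^2 / l^4, small
    enough to survive a factor ln n. The last summand is the tail of the lattice Green series. *)
Definition pot_eta (N : nat) : R :=
  @pot_err R d N (radius N) (log2 N) + 27 * d.+1%:R ^+ 3 / Num.sqrt (radius N)%:R.

(** The potential is at most eta outside the box and at most its value at 0 inside; the last factor
    bounds the share of the torus taken by the box. *)
Definition pot_beta (N : nat) : R :=
  pot_eta N + (g + pot_eta N) * ((radius N).*2.+1%:R ^+ d / n N).

Let log2_gt0 N : (1 < N)%N -> (0 < log2 N)%N.
Proof. by move=> N1; rewrite /log2 trunc_log_gt0. Qed.

Let radius_gt0 N : (1 < N)%N -> (0 < radius N)%N.
Proof. by move=> N1; rewrite /radius expn_gt0 log2_gt0. Qed.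

Lemma sqrt_radius N : Num.sqrt (radius N)%:R = (log2 N)%:R ^+ 4 :> R.
Proof. by rewrite /radius (expnM _ 4 2) natrX sqrtr_sqr ger0_norm natrX // exprn_ge0. Qed.

Let slice_tail_ge0 N M0 l : (1 < N)%N -> 0 <= @slice_tail R d N M0 l.
Proof.
move=> N1; have /andP[r0 r1] := @mix_rate_itv R d N N1.
apply: addr_ge0; first by rewrite divr_ge0 // !mulr_ge0 ?exprn_ge0 ?addr_ge0.
by rewrite mulr_ge0 // divr_ge0 ?exprn_ge0 // subr_ge0 ltW.
Qed.

Lemma pot_eta_ge0 N : (1 < N)%N -> 0 <= pot_eta N.
Proof.
move=> N1; rewrite /pot_eta /pot_err !addr_ge0 // ?divr_ge0 ?mulr_ge0 ?exprn_ge0 ?slice_tail_ge0 //.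
Qed.

Let err_le_eta N : @pot_err R d N (radius N) (log2 N) <= pot_eta N.
Proof. by rewrite lerDl divr_ge0 // mulr_ge0 // exprn_ge0. Qed.

Lemma pot_ge_eta N (x : torus d N) : (1 < N)%N -> - pot_eta N <= pot N x.
Proof.
move=> N1; apply: le_trans (torus_pot_ge N1 x d2 (log2_gt0 N1) (radius_gt0 N1)).
by rewrite lerN2.
Qed.

Lemma pot_far_eta N (x : torus d N) : (1 < N)%N -> ~ in_box (radius N) x -> pot N x <= pot_eta N.
Proof.
move=> N1 xb; apply: le_trans (torus_pot_far N1 d2 (log2_gt0 N1) (radius_gt0 N1) xb) _.
exact: err_le_eta.
Qed.

(** Up to time [radius N <= N] the return probabilities on the torus and on the lattice coincide;
    what remains is the slice averages and the two tails. *)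
Lemma pot0_green N : (1 < N)%N -> (radius N <= N)%N -> `|pot N 0 - g| <= pot_eta N.
Proof.
move=> N1 rN; have l0 := log2_gt0 N1; have r0 := radius_gt0 N1.
set M0 := radius N in rN r0 *.
have h1 := @torus_pot_approx R d N N1 M0 (log2 N) (0 : torus d N) d2 l0 r0.
have h2 := @latt_green_approx R d d2 _ r0.
have h3 : `|series (fun t => osc t (0 : torus d N) 0 / 2) M0 -
    series (fun t => cyl_heat t (0 : 'rV[int]_d) 0 / 2 : R) M0| <= M0%:R / n N / 2.
  rewrite /series /= -sumrB; apply: le_trans (ler_norm_sum _ _ _) _.
  apply: (@le_trans _ _ (\sum_(0 <= t < M0) ((n N)^-1 / 2))); last first.
    by rewrite sumr_const_nat subn0 -[_ *+ M0]mulr_natl mulrA.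
  rewrite big_nat_cond [leRHS]big_nat_cond; apply: ler_sum => t /andP[/andP[_ tM] _].
  rewrite /osc (@cyl_heat_wrap R d N N1 _ (leq_trans tM rN)) -mulrBl addrAC subrr sub0r.
  rewrite normrM [X in _ * X]ger0_norm // ler_wpM2r // normrN ger0_norm.
    by rewrite ler_piMl ?invr_ge0 ?exprn_ge0 // vert_heat_le1.
  by rewrite divr_ge0 ?exprn_ge0 ?vert_heat_ge0.
rewrite /pot_eta -/M0 /pot_err.
set a := pot N 0 in h1 *; set b := series _ M0 in h1 h3; set c := series _ M0 in h2 h3.
have -> : a - g = (a - b) + (b - c) + (c - g) by ring.
apply: le_trans (ler_normD _ _) _; apply: lerD; last by rewrite distrC.
by apply: le_trans (ler_normD _ _) _; rewrite addrC; apply: lerD.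
Qed.

Lemma card_in_box N r (A : {set torus d N}) : (forall x, x \in A -> in_box r x) ->
  (#|A| <= r.*2.+1 ^ d)%N.
Proof.
move=> hA; pose f (k : {ffun 'I_d -> 'I_r.*2.+1}) : torus d N := \row_i ((k i)%:R - r%:R).
have AB : A \subset codom f.
  apply/fintype.subsetP => x xA.
  have hx i : exists k : 'I_r.*2.+1, x 0 i = k%:R - r%:R.
    by have [k kr e] := hA _ xA i; exists (Ordinal (kr : (k < r.*2.+1)%N)).
  have [k hk] := choice hx.
  suff -> : x = f [ffun i => k i] by exact: codom_f.
  by apply/rowP => i; rewrite !mxE ffunE hk.
apply: leq_trans (subset_leq_card AB) _.
by apply: leq_trans (leq_image_card _ _) _; rewrite card_ffun !card_ord.
Qed.

Lemma pot_sum_beta N : (1 < N)%N -> (radius N <= N)%N ->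
  \sum_x Num.max (pot N x) 0 <= n N * pot_beta N.
Proof.
move=> N1 rN; set r := radius N.
have eta0 := pot_eta_ge0 N1.
have n0 : 0 < n N by rewrite exprn_gt0 // ltr0n ltnW.
have Gle : pot N 0 <= g + pot_eta N.
  by have := pot0_green N1 rN; rewrite ler_norml => /andP[_]; rewrite lerBlDl.
pose A : {set torus d N} := [set x | `[< in_box r x >]]%SET.
apply: (@le_trans _ _ (\sum_x (pot_eta N + (x \in A)%:R * (g + pot_eta N)))).
  apply: ler_sum => x _; rewrite inE; case: asboolP => xb.
    rewrite mul1r ge_max; apply/andP; split; last first.
      by have := @latt_green_ge R d d2; move: eta0; lra.
    by apply: le_trans (pot_le N1 _) _; apply: le_trans Gle _; rewrite lerDr.
  by rewrite mul0r addr0 ge_max eta0 andbT pot_far_eta.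
rewrite big_split /= sumr_const -[pot_eta N *+ _]mulr_natl card_torus // natrX -mulr_suml.
rewrite /pot_beta [leRHS]mulrDr lerD2l [leRHS]mulrCA [n N * (_ / _)]mulrC mulfVK ?gt_eqF //.
have -> : \sum_(x : torus d N) (x \in A)%:R = #|A|%:R :> R.
  rewrite -natr_sum -sum1_card [in RHS]big_mkcond /=; congr (_%:R).
rewrite mulrC ler_wpM2l //; first by have := @latt_green_ge R d d2; move: eta0; lra.
rewrite -natrX ler_nat; apply: card_in_box => x.
by rewrite inE => /asboolP.
Qed.

Let lnn_le N : (1 < N)%N -> ln (n N) <= 2 * d%:R * (log2 N)%:R.
Proof.
move=> N1; rewrite lnXn ?ltr0n ?(ltnW N1) // -[ln _ *+ d]mulr_natl.
by rewrite (_ : 2 * d%:R * (log2 N)%:R = d%:R * (2 * (log2 N)%:R)) ?ler_wpM2l ?ln_le_log2 //; ring.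
Qed.

Let lnn_ge0 N : (1 < N)%N -> 0 <= ln (n N).
Proof. by move=> N1; rewrite ln_ge0 // exprn_ege1 // ler1n ltnW. Qed.

Let n_ge_exp N : (1 < N)%N -> expR (ln 2 * (log2 N)%:R) <= n N.
Proof.
move=> N1; have [h _] := @log2_bounds R N (ltnW N1).
rewrite mulrC expRM_natl lnK ?posrE //; apply: le_trans h _.
rewrite -[leLHS]expr1 ler_weXn2l // ?ler1n ?(ltnW N1) //.
by apply: leq_trans d2.
Qed.

Let div_n_le (A : nat) : exists C : R, forall N, (1 < N)%N ->
  (log2 N)%:R ^+ A / n N <= C / (log2 N)%:R.
Proof.
have ln2 : (0 : R) < ln 2 by rewrite ln_gt0 // ltr1n.
have [C C0 hC] := pow_le_exp A.+1 ln2.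
exists C => N N1; have l0 : (0 : R) < (log2 N)%:R by rewrite ltr0n log2_gt0.
have n0 : 0 < n N by rewrite exprn_gt0 // ltr0n ltnW.
rewrite ler_pdivrMr // mulrAC ler_pdivlMr // -exprSr.
apply: le_trans (hC _) _; rewrite ler_wpM2l ?(ltW C0) //; exact: n_ge_exp.
Qed.

Let mix_le : exists C : R, \forall N \near \oo,
  (log2 N)%:R * (@mix_rate R d N ^+ (N ^ 2 * log2 N ^ 2) / (1 - @mix_rate R d N)) <= C / (log2 N)%:R.
Proof.
have [C C0 hC] := @pow_le_exp R 2 1 ltr01.
exists (16 * d.+1%:R * C); near=> N.
have N1 : (1 < N)%N by near: N; exact: nbhs_infty_gt.
(* This makes the exponent l^2 / (4 (d + 1)) at least 3 l. Two of these three l pay for N^2 <= 4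
   exp(2 l) in the relaxation time, the third gives the decay. *)
have lD : (12 * d.+1 <= log2 N)%N.
  near: N; have := @log2_cvg => /cvgnyPge; exact.
set l := log2 N in lD *.
have l0 : (0 : R) < l%:R by rewrite ltr0n log2_gt0.
have N0 : (0 : R) < N%:R by rewrite ltr0n ltnW.
have D0 : (0 : R) < d.+1%:R by [].
have rE := @mix_rateE R d N N1.
have /andP[r0 r1] := @mix_rate_itv R d N N1.
have h1 : @mix_rate R d N ^+ (N ^ 2 * l ^ 2) <= expR (- (3 * l%:R)).
  apply: (@le_trans _ _ (expR (- (1 - @mix_rate R d N)) ^+ (N ^ 2 * l ^ 2))).
    rewrite lerXn2r ?nnegrE ?expR_ge0 //; apply: le_trans (expR_ge1Dx _).
    by rewrite opprB addrC subrK.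
  rewrite -expRM_natl ler_expR mulrN lerN2 rE natrM !natrX.
  have -> : N%:R ^+ 2 * l%:R ^+ 2 * (4 * N%:R ^+ 2 * d.+1%:R)^-1 = l%:R * (l%:R / (4 * d.+1%:R)) :> R.
    by move: D0; move: (d.+1%:R) => D D0; field; rewrite !gt_eqF.
  rewrite mulrC ler_wpM2l ?(ltW l0) // ler_pdivlMr ?mulr_gt0 //.
  by rewrite mulrA -!natrM ler_nat.
have h2 : N%:R ^+ 2 <= 4 * expR (2 * l%:R) :> R.
  have [_ h] := @log2_bounds R N (ltnW N1).
  have e2 : (2 : R) <= expR 1 by apply: le_trans (expR_ge1Dx 1); rewrite -natr1.
  apply: (@le_trans _ _ ((2 ^+ l.+1) ^+ 2)); first by rewrite lerXn2r ?nnegrE ?exprn_ge0.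
  have -> : (2 ^+ l.+1) ^+ 2 = 4 * (2 ^+ l) ^+ 2 :> R by rewrite [2 ^+ l.+1]exprS; ring.
  rewrite ler_wpM2l // expRM_natl lerXn2r ?nnegrE ?exprn_ge0 ?expR_ge0 //.
  by rewrite -[l%:R]mulr1 expRM_natl lerXn2r ?nnegrE ?expR_ge0.
rewrite rE invrK.
apply: (@le_trans _ _ (l%:R * (expR (- (3 * l%:R)) * (4 * (4 * expR (2 * l%:R)) * d.+1%:R)))).
  rewrite ler_wpM2l ?(ltW l0) //; apply: ler_pM => //; first by rewrite exprn_ge0.
  by rewrite ler_wpM2r ?(ltW D0) // ler_wpM2l.
have -> : l%:R * (expR (- (3 * l%:R)) * (4 * (4 * expR (2 * l%:R)) * d.+1%:R)) =
   16 * d.+1%:R * (l%:R * expR (- (1 * l%:R))) :> R.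
  have -> : - (1 * l%:R) = - (3 * l%:R) + 2 * l%:R :> R by ring.
  by rewrite expRD; ring.
rewrite -[leRHS]mulrA ler_wpM2l ?mulr_ge0 // expRN ler_pdivlMr // mulrAC ler_pdivrMr ?expR_gt0 //.
by rewrite -expr2.
Unshelve. all: by end_near. Qed.

Let ln_eta_le : exists C : R, \forall N \near \oo, ln (n N) * pot_eta N <= C / (log2 N)%:R.
Proof.
have [C1 h1'] := div_n_le 9; have [C2 h2] := mix_le.
exists (2 * d%:R * (C1 / 2 + 12 * 9 * d.+1%:R ^+ 3 / 2 + d%:R * C2 / 2 + 27 * d.+1%:R ^+ 3)).
near=> N.
have N1 : (1 < N)%N by near: N; exact: nbhs_infty_gt.
have h3 : (log2 N)%:R * (@mix_rate R d N ^+ (N ^ 2 * log2 N ^ 2) / (1 - @mix_rate R d N)) <= C2 / (log2 N)%:R.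
  by near: N; exact: h2.
have h1 := h1' N N1.
have l1 : (1 : R) <= (log2 N)%:R by rewrite ler1n log2_gt0.
have l0 : (0 : R) < (log2 N)%:R by rewrite ltr0n log2_gt0.
apply: le_trans (ler_wpM2r (pot_eta_ge0 N1) (lnn_le N1)) _.
rewrite -[leLHS]mulrA -[leRHS]mulrA ler_wpM2l ?mulr_ge0 //.
rewrite /pot_eta /pot_err /slice_tail sqrt_radius /radius natrX.
move: h1 h3; set q := mix_rate _ _ ^+ _ / _; move: (n N) l0 l1 q => nn; set l := (log2 N)%:R => l0 l1 q h1 h3.
have e1 : l * (l ^+ 8 / nn / 2) <= C1 / l / 2.
  by rewrite mulrA ler_wpM2r // mulrA -exprS.
have e2 : l * (12 * (l + 2) ^+ 2 * d.+1%:R ^+ 3 / l ^+ 4 / 2) <= 12 * 9 * d.+1%:R ^+ 3 / 2 / l.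
  have -> : l * (12 * (l + 2) ^+ 2 * d.+1%:R ^+ 3 / l ^+ 4 / 2) =
     (12 * d.+1%:R ^+ 3 / 2 / l) * ((l + 2) / l) ^+ 2 by field; rewrite gt_eqF.
  have -> : 12 * 9 * d.+1%:R ^+ 3 / 2 / l = (12 * d.+1%:R ^+ 3 / 2 / l) * 3 ^+ 2 by ring.
  rewrite ler_wpM2l // ?divr_ge0 ?mulr_ge0 ?exprn_ge0 ?(ltW l0) //.
  rewrite lerXn2r ?nnegrE ?divr_ge0 ?addr_ge0 ?(ltW l0) // ler_pdivrMr //.
  by move: l1; lra.
have e3 : l * (d%:R * q / 2) <= d%:R * C2 / 2 / l.
  have -> : l * (d%:R * q / 2) = d%:R / 2 * (l * q) by ring.
  have -> : d%:R * C2 / 2 / l = d%:R / 2 * (C2 / l) by ring.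
  by rewrite ler_wpM2l // divr_ge0.
have e4 : l * (27 * d.+1%:R ^+ 3 / l ^+ 4) <= 27 * d.+1%:R ^+ 3 / l.
  have -> : l * (27 * d.+1%:R ^+ 3 / l ^+ 4) = 27 * d.+1%:R ^+ 3 / l * (l ^- 2) by field; rewrite gt_eqF.
  rewrite ler_piMr ?divr_ge0 ?mulr_ge0 ?exprn_ge0 ?(ltW l0) //.
  by rewrite invf_le1 ?exprn_gt0 // exprn_ege1.
apply: le_trans (_ : _ <= C1 / l / 2 + 12 * 9 * d.+1%:R ^+ 3 / 2 / l + d%:R * C2 / 2 / l + 27 * d.+1%:R ^+ 3 / l) _.
  by move: e1 e2 e3 e4; lra.
by rewrite le_eqVlt; apply/orP; left; apply/eqP; ring.
Unshelve. all: by end_near. Qed.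

Lemma cvg_ln_eta : ln (n N) * pot_eta N @[N --> \oo] --> 0.
Proof.
have [C hC] := ln_eta_le.
apply: (@squeeze_cvgr _ _ _ _ (fun=> 0) (fun N => C / (log2 N)%:R)); last 2 first.
- exact: cvg_cst.
- exact: cvg_div_log2.
near=> N.
have N1 : (1 < N)%N by near: N; exact: nbhs_infty_gt.
apply/andP; split; first by rewrite mulr_ge0 ?lnn_ge0 ?pot_eta_ge0.
by near: N; exact: hC.
Unshelve. all: by end_near. Qed.

Lemma cvg_ln_n : ln (n N) @[N --> \oo] --> +oo.
Proof.
apply/cvgryPge => A; near=> N.
have N1 : (1 < N)%N by near: N; exact: nbhs_infty_gt.
have n0 : 0 < n N by rewrite exprn_gt0 // ltr0n ltnW.
rewrite -ler_expR lnK ?posrE //.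
apply: (@le_trans _ _ N%:R); first by near: N; exact: nbhs_infty_ger.
rewrite -[leLHS]expr1 ler_weXn2l // ?ler1n ?(ltnW N1) //.
by apply: leq_trans d2.
Unshelve. all: by end_near. Qed.

Lemma cvg_pot_eta : pot_eta N @[N --> \oo] --> 0.
Proof.
apply: (@squeeze_cvgr _ _ _ _ (fun=> 0) (fun N => ln (n N) * pot_eta N)); last 2 first.
- exact: cvg_cst.
- exact: cvg_ln_eta.
near=> N.
have N1 : (1 < N)%N by near: N; exact: nbhs_infty_gt.
rewrite pot_eta_ge0 //= ler_peMl ?pot_eta_ge0 //.
by near: N; have := cvg_ln_n => /cvgryPge; exact.
Unshelve. all: by end_near. Qed.

Lemma cvg_ln_beta : ln (n N) * pot_beta N @[N --> \oo] --> 0.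
Proof.
rewrite (_ : nbhs 0 = nbhs (0 + (g + 0) * 0 : R)); last by rewrite mulr0 addr0.
rewrite (_ : (fun N => _) = (fun N => ln (n N) * pot_eta N + (g + pot_eta N) *
   (ln (n N) * ((radius N).*2.+1%:R ^+ d / n N)))); last by apply/funext => N; rewrite /pot_beta; ring.
apply: cvgD; first exact: cvg_ln_eta.
apply: cvgM; first by apply: cvgD; [exact: cvg_cst|exact: cvg_pot_eta].
have [C hC] := div_n_le (8 * d + 1).
apply: (@squeeze_cvgr _ _ _ _ (fun=> 0) (fun N => 2 * d%:R * 3 ^+ d * C / (log2 N)%:R)); last 2 first.
- exact: cvg_cst.
- exact: cvg_div_log2.
near=> N.
have N1 : (1 < N)%N by near: N; exact: nbhs_infty_gt.
have n0 : 0 < n N by rewrite exprn_gt0 // ltr0n ltnW.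
have l1 := log2_gt0 N1.
apply/andP; split; first by rewrite mulr_ge0 ?lnn_ge0 // divr_ge0 ?exprn_ge0 // ltW.
apply: (@le_trans _ _ (2 * d%:R * (log2 N)%:R * ((3 * (log2 N)%:R ^+ 8) ^+ d / n N))).
  apply: ler_pM; [exact: lnn_ge0|by rewrite divr_ge0 ?exprn_ge0 // ltW|exact: lnn_le|].
  rewrite ler_wpM2r ?invr_ge0 ?(ltW n0) // lerXn2r ?nnegrE ?mulr_ge0 ?exprn_ge0 //.
  rewrite -natrX -natrM ler_nat /radius.
  have : (0 < log2 N ^ 8)%N by rewrite expn_gt0 l1.
  by lia.
have -> : 2 * d%:R * (log2 N)%:R * ((3 * (log2 N)%:R ^+ 8) ^+ d / n N) =
    2 * d%:R * 3 ^+ d * ((log2 N)%:R ^+ (8 * d + 1) / n N) :> R.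
  by rewrite exprMn -exprM exprD expr1; ring.
rewrite -[leRHS]mulrA ler_wpM2l ?mulr_ge0 ?exprn_ge0 //; exact: hC.
Unshelve. all: by end_near. Qed.

Lemma near_radius_lt : \forall N \near \oo, (radius N <= N)%N.
Proof.
have ln2 : (0 : R) < ln 2 by rewrite ln_gt0 // ltr1n.
have [C C0 hC] := pow_le_exp 9 ln2.
near=> N.
have N1 : (1 < N)%N by near: N; exact: nbhs_infty_gt.
have [h _] := @log2_bounds R N (ltnW N1).
rewrite -(ler_nat R); apply: le_trans h.
rewrite /radius natrX.
have CC : C <= (log2 N)%:R.
  near: N; have := log2_cvg => /cvgnyPge /(_ (Num.truncn C).+1).
  by apply: filterS => N h; apply: ltW; apply: lt_le_trans (truncnS_gt _) _; rewrite ler_nat.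
have l0 : (0 : R) < (log2 N)%:R by rewrite ltr0n log2_gt0.
rewrite -(ler_pM2r l0) -exprSr; apply: le_trans (hC _) _.
rewrite mulrC [ln 2 * _]mulrC expRM_natl lnK ?posrE // ler_wpM2l // exprn_ge0 //.
Unshelve. all: by end_near. Qed.

End error_terms.

(** * Limits of the avoidance probabilities *)

Section asymptotics.
Context {R : realType}.
Variables (d : nat) (d2 : (2 <= d)%N) (z : R).
Local Notation g := (@latt_green R d).
Local Notation n N := (N%:R ^+ d : R).
Local Notation pot N := (@torus_pot R d N).
Local Notation eta := (@pot_eta R d).
Local Notation beta := (@pot_beta R d).
Local Notation lnn N := (ln (n N)).

Definition cover_level (N : nat) : R := n N * (g * (lnn N + z)).

(* Index of the last visit to the level 0 before the local time exceeds cover_level *)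
Definition visits (N : nat) : nat := (Num.truncn (cover_level N)).-1.

Let g0 : 0 < g. Proof. by apply: lt_le_trans (latt_green_ge d2); lra. Qed.

Let n_gt0 N : (1 < N)%N -> 0 < n N.
Proof. by move=> N1; rewrite exprn_gt0 // ltr0n ltnW. Qed.

Lemma cvg_bounded_by (u v : R^nat) : (\forall N \near \oo, `|u N| <= v N) ->
  v N @[N --> \oo] --> 0 -> u N @[N --> \oo] --> 0.
Proof.
move=> uv v0; apply: norm_cvg0.
apply: (@squeeze_cvgr _ _ _ _ (fun=> 0) v) => //; last exact: cvg_cst.
by apply: filterS uv => N ->; rewrite normr_ge0.
Qed.

Let cvg_ln_G : lnn N * (pot N 0 - g) @[N --> \oo] --> 0.
Proof.
apply: cvg_bounded_by (cvg_ln_eta d2); near=> N.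
have N1 : (1 < N)%N by near: N; exact: nbhs_infty_gt.
have l0 : 0 <= lnn N by rewrite ln_ge0 // exprn_ege1 // ler1n ltnW.
rewrite normrM (ger0_norm l0) ler_wpM2l //; apply: pot0_green => //.
by near: N; exact: near_radius_lt.
Unshelve. all: by end_near. Qed.

Let cvg_G : pot N 0 @[N --> \oo] --> g.
Proof.
apply/subr_cvg0.
apply: cvg_bounded_by (cvg_pot_eta d2); near=> N.
have N1 : (1 < N)%N by near: N; exact: nbhs_infty_gt.
apply: pot0_green => //.
by near: N; exact: near_radius_lt.
Unshelve. all: by end_near. Qed.

Let cvg_ln_div_n : lnn N / n N @[N --> \oo] --> 0.
Proof.
apply: cvg_bounded_by (_ : 2 * (lnn N * eta N) @[N --> \oo] --> 0); last first.
  rewrite (_ : nbhs 0 = nbhs (2 * 0 : R)); last by rewrite mulr0.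
  by apply: cvgMr; exact: cvg_ln_eta.
near=> N.
have N1 : (1 < N)%N by near: N; exact: nbhs_infty_gt.
have l0 : 0 <= lnn N by rewrite ln_ge0 // exprn_ege1 // ler1n ltnW.
rewrite normrM (ger0_norm l0) mulrCA ler_wpM2l // ger0_norm ?invr_ge0 ?(ltW (n_gt0 N1)) //.
have r1 : (1 : R) <= (radius N)%:R.
  by rewrite ler1n /radius expn_gt0 /log2 trunc_log_gt0 N1.
have h : (n N)^-1 <= (radius N)%:R / n N by rewrite ler_peMl // invr_ge0 ltW // n_gt0.
apply: le_trans h _; rewrite /pot_eta /pot_err.
have /andP[q0 q1] := @mix_rate_itv R d N N1.
have s0 : 0 <= @slice_tail R d N (radius N) (log2 N).
  apply: addr_ge0; first by rewrite divr_ge0 // !mulr_ge0 ?exprn_ge0 ?addr_ge0.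
  by rewrite mulr_ge0 // divr_ge0 ?exprn_ge0 // subr_ge0 ltW.
have t0 : 0 <= 27 * d.+1%:R ^+ 3 / Num.sqrt (radius N)%:R :> R.
  by rewrite divr_ge0 // mulr_ge0 // exprn_ge0.
by move: s0 t0; lra.
Unshelve. all: by end_near. Qed.

Let cvg_inv_n : (n N)^-1 @[N --> \oo] --> 0.
Proof.
apply: cvg_bounded_by cvg_ln_div_n; near=> N.
have N1 : (1 < N)%N by near: N; exact: nbhs_infty_gt.
have l1 : 1 <= lnn N by near: N; have := @cvg_ln_n R d d2 => /cvgryPge; exact.
by rewrite ger0_norm ?invr_ge0 ?(ltW (n_gt0 N1)) // ler_peMl // invr_ge0 ltW // n_gt0.
Unshelve. all: by end_near. Qed.

Let cvg_of_ln (A : R^nat) : lnn N * (A N - g) @[N --> \oo] --> 0 -> A N @[N --> \oo] --> g.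
Proof.
move=> h; apply/subr_cvg0.
have hn : `|lnn N * (A N - g)| @[N --> \oo] --> 0 by rewrite (_ : nbhs 0 = nbhs `|0 : R|); [exact: cvg_norm|rewrite normr0].
apply: cvg_bounded_by hn; near=> N.
have l1 : 1 <= lnn N by near: N; have := @cvg_ln_n R d d2 => /cvgryPge; exact.
rewrite /= normrM ler_peMl // ger0_norm // (le_trans ler01) //.
Unshelve. all: by end_near. Qed.

Lemma visits_bounds : \forall N \near \oo,
  cover_level N - 2 <= (visits N)%:R /\ (visits N)%:R <= cover_level N /\ (0 < visits N)%N /\ 0 <= lnn N + z.
Proof.
near=> N.
have N1 : (1 < N)%N by near: N; exact: nbhs_infty_gt.
have lz : 2 / g <= lnn N + z.
  rewrite -lerBlDr; near: N; have := @cvg_ln_n R d d2 => /cvgryPge; exact.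
have n1 : 1 <= n N by rewrite exprn_ege1 // ler1n ltnW.
have c2 : 2 <= cover_level N.
  rewrite /cover_level; apply: (@le_trans _ _ (g * (lnn N + z))).
    by rewrite mulrC -ler_pdivrMr.
  by rewrite ler_peMl // mulr_ge0 ?(ltW g0) //; apply: le_trans lz; rewrite divr_ge0 // (ltW g0).
have c0 : 0 <= cover_level N by apply: le_trans c2.
have /andP[t1 t2] := truncn_itv c0.
have tt : (1 < Num.truncn (cover_level N))%N.
  rewrite -(ltr_nat R); have : 2 < (Num.truncn (cover_level N)).+1%:R :> R by apply: le_lt_trans t2.
  by rewrite !ltr_nat.
have e : (visits N)%:R = (Num.truncn (cover_level N))%:R - 1 :> R.
  by rewrite /visits -[in RHS](prednK (ltnW tt)) -natr1 addrK.
rewrite e; split; first by move: t2; rewrite -natr1; lra.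
split; first by move: t1; lra.
split; first by rewrite /visits; move: tt; case: (Num.truncn _) => [|[]].
by apply: le_trans lz; rewrite divr_ge0 // (ltW g0).
Unshelve. all: by end_near. Qed.

(** With x = m / (n A), [cover_level] times x is m (ln n + z) g / A; hence m ln n - visits x tends
    to - m z exactly when A matches g up to o(1 / ln n). The squeeze is exp(- x / (1 - x)) <= 1 - x
    <= exp(- x). *)
Lemma cvg_rate (A : R^nat) (m : nat) : lnn N * (A N - g) @[N --> \oo] --> 0 ->
  n N ^+ m * (1 - m%:R / (n N * A N)) ^+ visits N @[N --> \oo] --> expR (- z) ^+ m.
Proof.
move=> hA; have cA := cvg_of_ln hA.
pose x N := m%:R / (n N * A N).
have cAV : (A N)^-1 @[N --> \oo] --> g^-1 by apply: cvgV => //; rewrite gt_eqF.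
have cx : x N @[N --> \oo] --> 0.
  rewrite (_ : nbhs 0 = nbhs (m%:R * (0 * g^-1) : R)); last by rewrite mul0r mulr0.
  rewrite (_ : x = fun N => m%:R * ((n N)^-1 * (A N)^-1)); last by apply/funext => N; rewrite /x invfM.
  by apply: cvgMr; apply: cvgM; [exact: cvg_inv_n|exact: cAV].
have cxl : x N * lnn N @[N --> \oo] --> 0.
  rewrite (_ : nbhs 0 = nbhs (m%:R * (0 * g^-1) : R)); last by rewrite mul0r mulr0.
  rewrite (_ : (fun N => _) = fun N => m%:R * (lnn N / n N * (A N)^-1)); last first.
    by apply/funext => N; rewrite /x invfM; ring.
  by apply: cvgMr; apply: cvgM.
(* Rounding error of [visits]; it is between 0 and 2 and is multiplied by x, which vanishes. *)
pose th N := cover_level N - (visits N)%:R.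
pose E N := m%:R / A N * (lnn N * (A N - g) - g * z) + th N * x N.
have cE : E N @[N --> \oo] --> - (m%:R * z).
  rewrite (_ : - (m%:R * z) = m%:R * g^-1 * (0 - g * z) + 0); last by field; rewrite gt_eqF.
  apply: cvgD.
    apply: cvgM; first by apply: cvgMr.
    by apply: cvgB => //; exact: cvg_cst.
  apply: cvg_bounded_by (_ : 2 * `|x N| @[N --> \oo] --> 0); last first.
    rewrite (_ : nbhs 0 = nbhs (2 * `|0 : R| : R)); last by rewrite normr0 mulr0.
    by apply: cvgMr; exact: cvg_norm.
  near=> N; have [h1 [h2 _]] : cover_level N - 2 <= (visits N)%:R /\ (visits N)%:R <= cover_level N /\ (0 < visits N)%N /\ 0 <= lnn N + z.
    by near: N; exact: visits_bounds.
  by rewrite normrM ler_wpM2r // ger0_norm /th; lra.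
have EE : \forall N \near \oo, m%:R * lnn N - (visits N)%:R * x N = E N.
  near=> N.
  have N1 : (1 < N)%N by near: N; exact: nbhs_infty_gt.
  have A0 : 0 < A N by near: N; exact: (cvgr_gt _ cA).
  rewrite /E /th /x /cover_level; move: (n_gt0 N1); move: (n N) (ln _) => nn ll nn0.
  by field; rewrite !gt_eqF.
pose E2 N := E N - (m%:R * lnn N - E N) * x N / (1 - x N).
have cE2 : E2 N @[N --> \oo] --> - (m%:R * z).
  rewrite (_ : - (m%:R * z) = - (m%:R * z) - (m%:R * 0 - (- (m%:R * z)) * 0) * (1 - 0)^-1); last by rewrite !mulr0 subr0 mul0r subr0.
  apply: cvgB => //.
  rewrite (_ : (fun N => _) = fun N => (m%:R * (x N * lnn N) - E N * x N) * (1 - x N)^-1); last by apply/funext => N; rewrite mulrBl -[m%:R * lnn N * _]mulrA [lnn N * _]mulrC.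
  apply: cvgM; first by apply: cvgB; [exact: cvgMr|exact: cvgM].
  by apply: cvgV; [rewrite subr0 oner_neq0|apply: cvgB => //; exact: cvg_cst].
rewrite -expRM_natl mulrN.
apply: (@squeeze_cvgr _ _ _ _ (fun N => expR (E2 N)) (fun N => expR (E N))); last 2 first.
- by apply: continuous_cvg => //; exact: continuous_expR.
- by apply: continuous_cvg => //; exact: continuous_expR.
near=> N.
have N1 : (1 < N)%N by near: N; exact: nbhs_infty_gt.
have A0 : 0 < A N by near: N; exact: (cvgr_gt _ cA).
have x0 : 0 <= x N by rewrite divr_ge0 // mulr_ge0 ?(ltW A0) // ltW // n_gt0.
have x1 : x N < 1 by near: N; exact: (cvgr_lt _ cx).
have e : m%:R * lnn N - (visits N)%:R * x N = E N by near: N; exact: EE.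
have nE : n N ^+ m = expR (m%:R * lnn N) by rewrite expRM_natl lnK // posrE n_gt0.
rewrite -/(x N) nE; apply/andP; split.
  have h : expR (- (x N / (1 - x N))) <= 1 - x N.
    rewrite expRN invf_ple ?posrE ?expR_gt0 ?subr_gt0 //.
    apply: le_trans (expR_ge1Dx _); rewrite le_eqVlt; apply/orP; left; apply/eqP.
    by field; rewrite subr_eq0 gt_eqF.
  apply: (@le_trans _ _ (expR (m%:R * lnn N) * expR (- (x N / (1 - x N))) ^+ visits N)).
    rewrite -expRM_natl -expRD ler_expR /E2 -e le_eqVlt; apply/orP; left; apply/eqP.
    by field; rewrite subr_eq0 gt_eqF.
  by rewrite ler_wpM2l ?expR_ge0 // lerXn2r ?nnegrE ?expR_ge0 // subr_ge0 ltW.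
rewrite -e expRD ler_wpM2l ?expR_ge0 // -[in leRHS]mulrN expRM_natl lerXn2r ?nnegrE ?expR_ge0 ?subr_ge0 ?(ltW x1) //.
exact: expR_ge1Dx.
Unshelve. all: by end_near. Qed.

Let cvg_ln_up m : lnn N * (pot N 0 + 2 * (m%:R * eta N) - g) @[N --> \oo] --> 0.
Proof.
rewrite (_ : nbhs 0 = nbhs (0 + 2 * m%:R * 0 : R)); last by rewrite mulr0 addr0.
rewrite (_ : (fun N => _) = fun N => lnn N * (pot N 0 - g) + 2 * m%:R * (lnn N * eta N)); last first.
  by apply/funext => N; ring.
by apply: cvgD => //; apply: cvgMr; exact: cvg_ln_eta.
Qed.

Let cvg_ln_low m : lnn N * (pot N 0 - m%:R * eta N - g) @[N --> \oo] --> 0.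
Proof.
rewrite (_ : nbhs 0 = nbhs (0 - m%:R * 0 : R)); last by rewrite mulr0 subr0.
rewrite (_ : (fun N => _) = fun N => lnn N * (pot N 0 - g) - m%:R * (lnn N * eta N)); last first.
  by apply/funext => N; ring.
by apply: cvgB => //; apply: cvgMr; exact: cvg_ln_eta.
Qed.

Let cvg_beta : beta N @[N --> \oo] --> 0.
Proof.
have hn : `|lnn N * beta N| @[N --> \oo] --> 0.
  by rewrite (_ : nbhs 0 = nbhs `|0 : R|); [apply: cvg_norm; exact: cvg_ln_beta|rewrite normr0].
apply: cvg_bounded_by hn; near=> N.
have l1 : 1 <= lnn N by near: N; have := @cvg_ln_n R d d2 => /cvgryPge; exact.
by rewrite normrM ler_peMl // ger0_norm // (le_trans ler01).
Unshelve. all: by end_near. Qed.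

Let near_half : \forall N \near \oo, 1 / 2 <= pot N 0.
Proof.
near=> N; near: N; apply: (cvgr_ge _ cvg_G).
by apply: lt_le_trans (latt_green_ge d2); lra.
Unshelve. all: by end_near. Qed.

Let cvg_meta m : m%:R * eta N @[N --> \oo] --> 0.
Proof.
rewrite (_ : nbhs 0 = nbhs (m%:R * 0 : R)); last by rewrite mulr0.
by apply: cvgMr; exact: cvg_pot_eta.
Qed.

Let cvg_visits_beta : (visits N)%:R / n N * beta N @[N --> \oo] --> 0.
Proof.
have h0 : g * (lnn N * beta N + z * beta N) @[N --> \oo] --> 0.
  rewrite (_ : nbhs 0 = nbhs (g * (0 + z * 0) : R)); last by rewrite mulr0 addr0 mulr0.
  by apply: cvgMr; apply: cvgD; [exact: cvg_ln_beta|apply: cvgMr; exact: cvg_beta].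
have hn : `|g * (lnn N * beta N + z * beta N)| @[N --> \oo] --> 0.
  by rewrite (_ : nbhs 0 = nbhs `|0 : R|); [exact: cvg_norm|rewrite normr0].
apply: cvg_bounded_by hn; near=> N.
have [_ [h [_ lz]]] : cover_level N - 2 <= (visits N)%:R /\ (visits N)%:R <= cover_level N /\ (0 < visits N)%N /\ 0 <= lnn N + z.
  by near: N; exact: visits_bounds.
have N1 : (1 < N)%N by near: N; exact: nbhs_infty_gt.
rewrite -[z * _ as X in lnn N * _ + X]/(z * beta N) -mulrDl mulrA !normrM ler_wpM2r //.
rewrite -normrM ger0_norm ?ger0_norm ?mulr_ge0 ?(ltW g0) ?divr_ge0 ?(ltW (n_gt0 N1)) //.
by rewrite ler_pdivrMr ?n_gt0 // mulrC.
Unshelve. all: by end_near. Qed.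

Let cvg_rate1 (A : R^nat) m : A N @[N --> \oo] --> g ->
  1 - m%:R / (n N * A N) @[N --> \oo] --> (1 : R).
Proof.
move=> cA.
rewrite (_ : nbhs (1 : R) = nbhs (1 - m%:R * (0 * g^-1) : R)); last by rewrite mul0r mulr0 subr0.
rewrite (_ : (fun N => _) = fun N => 1 - m%:R * ((n N)^-1 * (A N)^-1)); last by apply/funext => N; rewrite invfM.
apply: cvgB; first exact: cvg_cst.
apply: cvgMr; apply: cvgM; first exact: cvg_inv_n.
by apply: cvgV => //; rewrite gt_eqF.
Qed.

Let beta_ge0 N : (1 < N)%N -> 0 <= beta N.
Proof.
move=> N1; have e0 := @pot_eta_ge0 R d N N1.
apply: addr_ge0 => //; apply: mulr_ge0; first by rewrite addr_ge0 // (ltW g0).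
by rewrite divr_ge0 // exprn_ge0.
Qed.

Let n_large (c : R) : \forall N \near \oo, c <= n N.
Proof.
near=> N.
have N1 : (1 < N)%N by near: N; exact: nbhs_infty_gt.
apply: (@le_trans _ _ N%:R); last by rewrite ler_eXnr // ?ler1n ltnW // ltnW.
by near: N; exact: nbhs_infty_ger.
Unshelve. all: by end_near. Qed.

Local Notation p W N := (avoid_prob W (visits N) : R).

Let shuffle (nm rlk V k nV am mm b MM ap rk r : R) : r != 0 ->
  nm * rlk * V - k * nV * b * (mm * am * am * mm * (2 * MM / ap)) * (nm * (rk * r) / r) =
  nm * (rlk * V - k * (mm * am * nV * (am * (mm * b * (2 * MM / ap)))) * rk).
Proof. by move=> r0; rewrite [nm * (rk * r)]mulrA mulfK //; move: (ap^-1) => ?; ring. Qed.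

Let exponent_le (t v A B : R) : t <= 1 / 2 -> A - 2 * t <= v * t -> B <= A -> - (v * t) <= - B + 1.
Proof. by lra. Qed.

Let exponent_split (m1 e l w : R) :
  m1 * l + (- (m1 + e) * (l + w) + 1) = 1 - (m1 + e) * w + - e * l.
Proof. by ring. Qed.

Let half_sub (a b : R) : b < a / 4 -> 1 / 2 <= a -> 0 <= a - b. Proof. by lra. Qed.

(** The upper and lower bounds see W only through its cardinal m, which makes the convergence
    uniform over all separated sets. *)
Lemma separated_limit m (e : R) : 0 < e -> \forall N \near \oo, forall W : {set torus d N},
  #|W| = m -> far_apart (radius N) W ->
  `|n N ^+ m * p W N - expR (- z) ^+ m| <= e.
Proof.
move=> e0.
pose G N := pot N 0; pose me N := m%:R * eta N.
have cme := cvg_meta m; rewrite -/me in cme.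
have cAu : G N + 2 * me N @[N --> \oo] --> g by apply: cvg_of_ln; exact: cvg_ln_up.
have cG : G N @[N --> \oo] --> g by exact: cvg_G.
have cap : (G N + me N)^-1 @[N --> \oo] --> g^-1.
  by apply: cvgV; [rewrite gt_eqF|rewrite -[g]addr0; exact: cvgD].
have cam : (G N - me N)^-1 @[N --> \oo] --> g^-1.
  by apply: cvgV; [rewrite gt_eqF|rewrite -[g]subr0; exact: cvgB].
pose M N := 1 + (G N + me N)^-1 * me N.
have cM : M N @[N --> \oo] --> (1 : R).
  rewrite (_ : nbhs (1 : R) = nbhs (1 + g^-1 * 0 : R)); last by rewrite mulr0 addr0.
  by apply: cvgD; [exact: cvg_cst|exact: cvgM].
pose ru N := n N ^+ m * (1 - m%:R / (n N * (G N + 2 * me N))) ^+ visits N.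
have cru : ru N @[N --> \oo] --> expR (- z) ^+ m by apply: cvg_rate; exact: cvg_ln_up.
pose rl N := n N ^+ m * (1 - m%:R / (n N * (G N - me N))) ^+ visits N.
have crl : rl N @[N --> \oo] --> expR (- z) ^+ m by apply: cvg_rate; exact: cvg_ln_low.
have cup : ru N * (M N * (1 + 2 * m%:R * beta N)) @[N --> \oo] --> expR (- z) ^+ m.
  rewrite (_ : nbhs _ = nbhs (expR (- z) ^+ m * (1 * (1 + 2 * m%:R * 0)) : R)); last by rewrite mulr0 addr0 !mulr1.
  apply: cvgM => //; apply: cvgM => //; apply: cvgD; first exact: cvg_cst.
  by apply: cvgMr; exact: cvg_beta.
pose S N := m%:R * (G N - me N)^-1 * (G N - me N)^-1 * m%:R * (2 * M N / (G N + me N)^-1).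
have cS : S N @[N --> \oo] --> m%:R * g^-1 * g^-1 * m%:R * (2 * 1 / g^-1).
  apply: cvgM; last by apply: cvgM; [exact: cvgMr|apply: cvgV => //; rewrite invr_eq0 gt_eqF].
  by apply: cvgMl; apply: cvgM => //; exact: cvgMr.
have clow : (rl N * (1 - (G N - me N)^-1 * m%:R * beta N) -
   (visits N)%:R / n N * beta N * S N * (ru N / (1 - m%:R / (n N * (G N + 2 * me N))))) /
   (1 + (G N - me N)^-1 * me N) @[N --> \oo] --> expR (- z) ^+ m.
  rewrite (_ : nbhs _ = nbhs ((expR (- z) ^+ m * (1 - g^-1 * m%:R * 0) -
    0 * (m%:R * g^-1 * g^-1 * m%:R * (2 * 1 / g^-1)) * (expR (- z) ^+ m / 1)) / (1 + g^-1 * 0) : R)); last first.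
    by rewrite !mulr0 !mul0r addr0 !subr0 divr1 mulr1.
  apply: cvgM; last first.
    apply: cvgV; first by rewrite mulr0 addr0 oner_neq0.
    by apply: cvgD; [exact: cvg_cst|exact: cvgM].
  apply: cvgB.
    apply: cvgM => //; apply: cvgB; first exact: cvg_cst.
    by apply: cvgM; [exact: cvgMl|exact: cvg_beta].
  apply: cvgM; first by apply: cvgM => //; exact: cvg_visits_beta.
  by apply: cvgM => //; apply: cvgV; [exact: oner_neq0|exact: cvg_rate1].
have up : \forall N \near \oo, ru N * (M N * (1 + 2 * m%:R * beta N)) <= expR (- z) ^+ m + e.
  by near=> N; near: N; apply: (cvgr_le _ cup); rewrite ltrDl.
have low : \forall N \near \oo, expR (- z) ^+ m - e <= (rl N * (1 - (G N - me N)^-1 * m%:R * beta N) -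
   (visits N)%:R / n N * beta N * S N * (ru N / (1 - m%:R / (n N * (G N + 2 * me N))))) /
   (1 + (G N - me N)^-1 * me N).
  by near=> N; near: N; apply: (cvgr_ge _ clow); rewrite gtrDl oppr_lt0.
near=> N.
have N1 : (1 < N)%N by near: N; exact: nbhs_infty_gt.
have rN : (radius N <= N)%N by near: N; exact: near_radius_lt.
have e_ge0 := @pot_eta_ge0 R d N N1.
have Gh : 1 / 2 <= pot N 0 by near: N; exact: near_half.
have b0 : 0 <= beta N by exact: beta_ge0.
have me4 : me N < G N / 4.
  have h1 : me N <= 1 / 16 by near: N; apply: (cvgr_le _ cme); lra.
  by apply: le_lt_trans h1 _; rewrite /G; lra.
have n8 : 8 * m%:R <= n N by near: N; exact: n_large.
have r1 : 1 / 2 <= 1 - m%:R / (n N * (G N + 2 * me N)).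
  by near: N; apply: (cvgr_ge _ (@cvg_rate1 _ m cAu)); lra.
have v0 : (0 < visits N)%N by near: N; apply: filterS visits_bounds => N [_ [_ []]].
have nm : 0 < n N ^+ m by rewrite exprn_gt0 // n_gt0.
have upN : ru N * (M N * (1 + 2 * m%:R * beta N)) <= expR (- z) ^+ m + e by near: N; exact: up.
have lowN : expR (- z) ^+ m - e <= (rl N * (1 - (G N - me N)^-1 * m%:R * beta N) -
   (visits N)%:R / n N * beta N * S N * (ru N / (1 - m%:R / (n N * (G N + 2 * me N))))) /
   (1 + (G N - me N)^-1 * me N) by near: N; exact: low.
have W0 : 0 <= (G N - me N)^-1 * me N.
  rewrite mulr_ge0 ?invr_ge0 ?mulr_ge0 //.
  exact: half_sub me4 Gh.
move=> W Wm sW.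
have U := separated_upper N1 e_ge0 (fun x => pot_ge_eta d2 x N1)
  (fun x => @pot_far_eta R d d2 N x N1) Gh (pot_sum_beta d2 N1 rN) Wm sW n8 (visits N).
have L := separated_lower N1 e_ge0 b0 (fun x => pot_ge_eta d2 x N1)
  (fun x => @pot_far_eta R d d2 N x N1) Gh (pot_sum_beta d2 N1 rN) Wm sW me4 n8 (visits N).
rewrite ler_distl; apply/andP; split; last first.
  apply: le_trans upN; rewrite /ru -mulrA ler_wpM2l ?(ltW nm) //.
apply: le_trans lowN _; rewrite ler_pdivrMr; last first.
  exact: ltr_pwDl.
apply: (le_trans _ (_ : n N ^+ m * (p W N * (1 + (G N - me N)^-1 * me N)) <= _)); last by rewrite mulrA.
apply: le_trans (ler_wpM2l (ltW nm) L).
rewrite le_eqVlt; apply/orP; left; apply/eqP.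
rewrite /rl /ru /rate_low /rate_up -/(G N) -/(me N).
rewrite /S -/(M N); move: r1; set r := 1 - m%:R / (_ * (_ + 2 * _)) => r1.
have r0 : r != 0 by rewrite gt_eqF //; apply: lt_le_trans r1; rewrite divr_gt0.
have -> : r ^+ visits N = r ^+ (visits N).-1 * r by rewrite -exprSr prednK.
exact: shuffle.
Unshelve. all: by end_near. Qed.

(** Without error terms, g times the charge m / g + 2 / (2g - 1/2) equals m + 1 + 2 [gap_exp]. Half
    of the excess is kept, leaving room for the errors. *)
Definition gap_exp : R := (8 * g - 2)^-1.

Lemma gap_exp_gt0 : 0 < gap_exp.
Proof. by rewrite invr_gt0; have := @latt_green_ge R d d2; lra. Qed.

(** The set has m + 2 points, but the scale n^(m + 1) is the number of choices of x and J: a point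
    close to x is not counted, and the surplus n^(- gap_exp) has to pay for it. *)
Lemma cluster_decay m : exists2 C : R, 0 <= C & \forall N \near \oo,
  forall (J : {set torus d N}) x y, #|J| = m -> x != y -> x \notin J -> y \notin J ->
  far_apart (radius N) (x |: J)%SET -> far_apart (radius N) (y |: J)%SET ->
  n N ^+ m.+1 * p ([set x; y] :|: J)%SET N <= C * expR (- gap_exp * lnn N).
Proof.
pose ep := gap_exp.
exists ((4 * g + 1) * expR (1 - (m.+1%:R + ep) * z)).
  by rewrite mulr_ge0 ?expR_ge0 // addr_ge0 // mulr_ge0 // ltW.
pose G N := pot N 0; pose c N := (2 * m%:R + 2) * eta N.
have cG : G N @[N --> \oo] --> g by exact: cvg_G.
have cc : c N @[N --> \oo] --> 0.
  rewrite (_ : nbhs 0 = nbhs ((2 * m%:R + 2) * 0 : R)); last by rewrite mulr0.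
  by apply: cvgMr; exact: cvg_pot_eta.
have cGc : G N + c N @[N --> \oo] --> g by rewrite -[g]addr0; exact: cvgD.
pose K N := 1 + (m%:R + 2) * eta N / (G N + c N).
have cK : K N @[N --> \oo] --> (1 : R).
  rewrite (_ : nbhs (1 : R) = nbhs (1 + (m%:R + 2) * 0 * g^-1 : R)); last by rewrite mulr0 mul0r addr0.
  apply: cvgD; first exact: cvg_cst.
  apply: cvgM; first by apply: cvgMr; exact: cvg_pot_eta.
  by apply: cvgV => //; rewrite gt_eqF.
pose a N := (m%:R / (G N + c N) + 2 / (2 * G N - 1 / 2 + c N)) / K N.
have g34 : 3 / 4 <= g by exact: latt_green_ge.
have ca : a N * g @[N --> \oo] --> m.+1%:R + 2 * ep.
  have -> : m.+1%:R + 2 * ep = (m%:R / g + 2 / (2 * g - 1 / 2 + 0)) / 1 * g.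
    rewrite /ep /gap_exp -natr1; field.
    by rewrite !gt_eqF //; lra.
  apply: cvgMl; apply: cvgM; last by apply: cvgV => //; exact: oner_neq0.
  apply: cvgD; first by apply: cvgMr; apply: cvgV => //; rewrite gt_eqF.
  apply: cvgMr; apply: cvgV; first by rewrite addr0 gt_eqF //; lra.
  by apply: cvgD => //; apply: cvgB; [exact: cvgMr|exact: cvg_cst].
have ep0 : 0 < ep by exact: gap_exp_gt0.
have can : a N * (n N)^-1 @[N --> \oo] --> 0.
  rewrite (_ : nbhs 0 = nbhs ((m.+1%:R + 2 * ep) * (g^-1 * 0) : R)); last by rewrite !mulr0.
  rewrite (_ : (fun N => _) = fun N => (a N * g) * (g^-1 * (n N)^-1)); last first.
    by apply/funext => N; rewrite mulrA mulfK // gt_eqF.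
  by apply: cvgM => //; apply: cvgMr; exact: cvg_inv_n.
have cL : 4 * (G N + c N) * K N @[N --> \oo] --> 4 * g * 1.
  by apply: cvgM => //; exact: cvgMr.
near=> N.
have N1 : (1 < N)%N by near: N; exact: nbhs_infty_gt.
have rN : (radius N <= N)%N by near: N; exact: near_radius_lt.
have e_ge0 := @pot_eta_ge0 R d N N1.
have Gh : 1 / 2 <= pot N 0 by near: N; exact: near_half.
have b0 : 0 <= beta N by exact: beta_ge0.
have n8 : 8 * (m%:R + 2) <= n N by near: N; exact: n_large.
have L1 : 4 * (G N + c N) * K N <= 4 * g + 1 by near: N; apply: (cvgr_le _ cL); lra.
have a1 : m.+1%:R + ep <= a N * g by near: N; apply: (cvgr_ge _ ca); lra.
have an1 : a N * (n N)^-1 <= 1 / 2 by near: N; apply: (cvgr_le _ can); lra.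
have [v1 [v2 [_ lz]]] : cover_level N - 2 <= (visits N)%:R /\ (visits N)%:R <= cover_level N /\ (0 < visits N)%N /\ 0 <= lnn N + z.
  by near: N; exact: visits_bounds.
move=> J x y Jm xy xJ yJ sx sy.
have := cluster_upper N1 e_ge0 (fun x => pot_ge_eta d2 x N1)
  (fun x => @pot_far_eta R d d2 N x N1) Gh Jm xy xJ yJ sx sy n8 (visits N).
rewrite -/(G N) -/(c N) -/(K N) => U.
have nm : 0 < n N ^+ m.+1 by rewrite exprn_gt0 // n_gt0.
have rE : cluster_rate d N (eta N) m = 1 - a N / n N.
  by rewrite /cluster_rate -/(G N) -/(c N) -/(K N) /a invfM mulrA mulrAC.
have a0 : 0 <= a N.
  by rewrite -(pmulr_lge0 _ g0); apply: le_trans a1; rewrite addr_ge0 // ltW.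
(* Losing 2 steps to the rounding in [visits] costs at most a factor e, since 2 a / n <= 1. *)
have X : cluster_rate d N (eta N) m ^+ visits N <= expR (- (m.+1%:R + ep) * (lnn N + z) + 1).
  rewrite rE; apply: (@le_trans _ _ (expR (- (a N / n N)) ^+ visits N)).
    by rewrite lerXn2r ?nnegrE ?expR_ge0 //; [|exact: expR_ge1Dx]; rewrite subr_ge0 (le_trans an1) // ler_pdivrMr // mul1r ler1n.
  rewrite -expRM_natl ler_expR mulrN mulNr.
  have : (cover_level N - 2) * (a N / n N) <= (visits N)%:R * (a N / n N).
    by rewrite ler_wpM2r // divr_ge0 // ltW // n_gt0.
  have -> : (cover_level N - 2) * (a N / n N) = a N * g * (lnn N + z) - 2 * (a N / n N).
    by rewrite /cover_level; field; rewrite gt_eqF // n_gt0.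
  by move=> H; exact: exponent_le an1 H (ler_wpM2r lz a1).
apply: le_trans (ler_wpM2l (ltW nm) U) _.
have K0 : 0 <= 4 * (G N + c N) * K N.
  have c0 : 0 <= G N + c N by apply: addr_ge0; [apply: le_trans Gh; rewrite divr_ge0|rewrite mulr_ge0 // addr_ge0].
  by rewrite !mulr_ge0 // /K addr_ge0 // divr_ge0 // mulr_ge0 // addr_ge0.
apply: (@le_trans _ _ (n N ^+ m.+1 * ((4 * g + 1) * expR (- (m.+1%:R + ep) * (lnn N + z) + 1)))).
  rewrite ler_wpM2l ?(ltW nm) //.
  apply: (@le_trans _ _ (4 * (G N + c N) * K N * expR (- (m.+1%:R + ep) * (lnn N + z) + 1))).
    by rewrite ler_wpM2l.
  by rewrite ler_wpM2r // expR_ge0.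
have -> : n N ^+ m.+1 = expR (m.+1%:R * lnn N) by rewrite expRM_natl lnK // posrE n_gt0.
rewrite mulrCA -!mulrA ler_wpM2l ?addr_ge0 ?mulr_ge0 ?(ltW g0) //.
by rewrite -!expRD ler_expR -/ep exponent_split.
Unshelve. all: by end_near. Qed.

End asymptotics.

(** * Factorial moments of the late set *)

Lemma bin_mul_fact_le k m : ('C(k, m) * m`! <= k ^ m)%N.
Proof.
rewrite bin_ffact; elim: m k => [|m IH] k; first by rewrite ffactn0.
rewrite ffactnS expnS leq_mul2l; apply/orP; right.
by apply: leq_trans (IH _) _; case: m {IH} => // m; rewrite leq_exp2r // leq_pred.
Qed.

Section clusters.
Variables (d N : nat).
Local Notation T := (torus d N).
Implicit Types (A B J W : {set T}) (x y w : T) (r : nat).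

Definition nbhd r A : {set T} := [set v | [exists w in A, `[< in_box r (v - w) >]]]%SET.

Lemma card_nbhd r A : (#|nbhd r A| <= #|A| * r.*2.+1 ^ d)%N.
Proof.
pose F w : {set T} := [set v | `[< in_box r (v - w) >]]%SET.
have -> : nbhd r A = (\bigcup_(w in A) F w)%SET.
  apply/setP => v; rewrite inE; apply/existsP/bigcupP => [[w /andP[wA h]]|[w wA]].
    by exists w => //; rewrite inE.
  by rewrite inE => h; exists w; rewrite wA.
have cF w : (#|F w| <= r.*2.+1 ^ d)%N.
  have inj : injective (fun v : T => v - w) by move=> u v /addIr.
  rewrite -(card_imset _ inj); apply: card_in_box => _ /imsetP[v + ->].
  by rewrite inE => /asboolP.
rewrite -sum_nat_const; apply: (big_ind2 (fun (B : {set T}) k => (#|B| <= k)%N)).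
- by rewrite cards0.
- by move=> B k B' k' h h'; apply: leq_trans (leq_add h h'); apply: leq_of_leqif; exact: leq_card_setU.
- by move=> w _; exact: cF.
Qed.

(** Take a close pair x, y and a maximal J in B such that J is separated together with x and
    together with y. By maximality every point of B is close to x, y or J; closeness to y becomes
    closeness to x at twice the distance. So x and J locate all of B. *)
Lemma cluster_witness r B : ~ far_apart r B -> exists J x y,
  [/\ [/\ x != y, x \notin J & y \notin J], ([set x; y] :|: J)%SET \subset B,
      far_apart r (x |: J)%SET, far_apart r (y |: J)%SET & B \subset nbhd r.*2.*2 (x |: J)%SET].
Proof.
move=> nB.
have [x [y [xB yB xy hxy]]] : exists x y, [/\ x \in B, y \in B, x != y & in_box r.*2 (x - y)].
  apply: contrapT => h; apply: nB => x y xB yB xy hxy; apply: h.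
  by exists x, y.
pose P J := `[< [/\ x \notin J, y \notin J, J \subset B, far_apart r (x |: J)%SET & far_apart r (y |: J)%SET] >].
have s1 v : far_apart r (v |: finset.set0)%SET.
  by move=> a b; rewrite finset.setU0 !inE => /eqP -> /eqP ->; rewrite eqxx.
have P0 : P finset.set0 by apply/asboolP; rewrite !inE finset.sub0set.
have [J /maxsetP[/asboolP[xJ yJ JB sx sy] Jmax] _] := maxset_exists P0.
exists J, x, y; split => //.
  by apply/fintype.subsetP => v; rewrite !inE => /orP[/orP[/eqP->|/eqP->]|/(fintype.subsetP JB)].
apply/fintype.subsetP => w wB; apply: contrapT => nw.
have far v : v \in (x |: J)%SET -> ~ in_box r.*2.*2 (w - v).
  move=> vJ h; apply: nw; rewrite inE; apply/existsP; exists v; rewrite vJ /=; exact/asboolP.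
have far' v : v \in (x |: J)%SET -> ~ in_box r.*2 (w - v) by move=> vJ /sub_in_box; exact: far.
have fary : ~ in_box r.*2 (w - y).
  move=> h; apply: (far x); first by rewrite setU11.
  rewrite -(opprB x w); apply: in_boxN; apply: (@in_boxB _ _ _ y).
    by rewrite -opprB; exact: in_boxN.
  by rewrite -opprB; exact: in_boxN.
have wx : w != x.
  by apply/eqP => e; apply: (far x); rewrite ?setU11 // e subrr; exact: in_box0.
have wy : w != y by apply/eqP => e; apply: fary; rewrite e subrr; exact: in_box0.
have wJ : w \notin J.
  by apply/negP => h; apply: (far w); rewrite ?setU1r // subrr; exact: in_box0.
have PJ : P (w |: J)%SET.
  apply/asboolP; split.
  - by rewrite !inE negb_or eq_sym wx.
  - by rewrite !inE negb_or eq_sym wy.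
  - by apply/fintype.subsetP => v /setU1P[->|/(fintype.subsetP JB)].
  - by rewrite finset.setUCA; exact: separatedU1.
  - rewrite finset.setUCA; apply: separatedU1 => // v /setU1P[->//|vJ]; apply: far'.
    exact: setU1r.
have e := Jmax _ PJ (finset.subsetUr _ _).
by move: wJ; rewrite -e setU11.
Qed.

Lemma card_draws_le (I : finType) (U : {set I}) m : (\sum_(B : {set I} | (#|B| == m) && (B \subset U)) 1 <= #|U| ^ m)%N.
Proof.
rewrite sum1_card; have -> : #|[pred B : {set I} | (#|B| == m) && (B \subset U)]| = 'C(#|U|, m).
  by rewrite -cards_draws; apply: eq_card => B; rewrite !inE andbC.
by apply: leq_trans (bin_mul_fact_le _ _); apply: leq_pmulr; exact: fact_gt0.
Qed.

End clusters.

Section moments.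
Context {R : realType}.

Lemma avoid_prob_subset d N (W W' : {set torus d N}) k : (1 < N)%N -> W \subset W' ->
  avoid_prob W' k <= avoid_prob W k :> R.
Proof.
move=> N1 /fintype.subsetP WW; rewrite ler_wpM2r ?invr_ge0 ?exprn_ge0 //; apply: ler_sum => x _.
elim: k x => [|k IH] x /=.
  by rewrite !mulr1 ler_nat; have := WW x; case: (x \in W) => [->|] //; rewrite ?leq_b1.
apply: ler_pM => //; first by rewrite -(trace_op_cst (N := N) 0 x); apply: ler_trace_op => // y; exact: avoid_ge0.
  by rewrite ler_nat; have := WW x; case: (x \in W) => [->|] //; rewrite ?leq_b1.
exact: ler_trace_op.
Qed.

Variables (d : nat) (d2 : (2 <= d)%N) (z : R).
Local Notation n N := (N%:R ^+ d : R).
Local Notation lnn N := (ln (n N)).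
Local Notation ep := (@gap_exp R d).

Let n_gt0 N : (1 < N)%N -> 0 < n N.
Proof. by move=> N1; rewrite exprn_gt0 // ltr0n ltnW. Qed.

Lemma cvg_polylog A : (radius N)%:R ^+ A * expR (- ep * lnn N) @[N --> \oo] --> 0.
Proof.
have e0 : 0 < ep * ln (2 : R) by rewrite mulr_gt0 ?gap_exp_gt0 // ln_gt0 // ltr1n.
have [C C0 hC] := pow_le_exp (8 * A).+1 e0.
apply: cvg_bounded_by (cvg_div_log2 C); near=> N.
have N1 : (1 < N)%N by near: N; exact: nbhs_infty_gt.
have l0 : 0 < (log2 N)%:R :> R by rewrite ltr0n /log2 trunc_log_gt0 N1.
rewrite ger0_norm; last by rewrite mulr_ge0 ?exprn_ge0 ?expR_ge0.
rewrite /radius natrX -exprM ler_pdivlMr // mulrAC -exprSr.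
apply: (@le_trans _ _ (C * expR (ep * ln 2 * (log2 N)%:R) * expR (- ep * lnn N))).
  by rewrite ler_wpM2r // expR_ge0.
rewrite -mulrA -expRD -[leRHS]mulr1 ler_wpM2l ?(ltW C0) // -[leRHS]expR0 ler_expR.
rewrite -mulrA mulNr subr_le0 ler_wpM2l ?(ltW (gap_exp_gt0 d2)) //.
have [h _] := @log2_bounds R N (ltnW N1).
rewrite mulrC mulr_natl -lnXn ?ltr0n // ler_ln ?posrE ?exprn_gt0 ?ltr0n ?(ltnW N1) //.
by apply: le_trans h _; rewrite ler_eXnr // ?ler1n ltnW // ltnW.
Unshelve. all: by end_near. Qed.

Lemma cvg_moments m :
  \sum_(B : {set torus d N} | #|B| == m) `|avoid_prob B (visits d z N) - (expR (- z) / n N) ^+ m|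
    @[N --> \oo] --> (0 : R).
Proof.
have /choice[C hC] : forall j, exists c : R, 0 <= c /\ \forall N \near \oo,
  forall (J : {set torus d N}) x y, #|J| = j -> x != y -> x \notin J -> y \notin J ->
  far_apart (radius N) (x |: J)%SET -> far_apart (radius N) (y |: J)%SET ->
  n N ^+ j.+1 * avoid_prob ([set x; y] :|: J)%SET (visits d z N) <= c * expR (- ep * lnn N).
  by move=> j; have [c c0 hc] := cluster_decay d2 z j; exists c.
set la := expR (- z).
pose E N := expR (- ep * lnn N).
pose K N := ((radius N).*2.*2.*2.+1 ^ d)%N.
pose b j N : R := (n N)^-1 ^+ j.+1 * ((C j + la ^+ m) * E N).
have la0 : 0 <= la ^+ m by rewrite exprn_ge0 // expR_ge0.
(* Contribution of the non-separated B: at most n^(j + 1) witnesses of size j + 1, at most ((j + 1)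
   K)^m sets B around each, of weight [b j N]. The powers of n cancel, and a power of log N times
   n^(- ep) remains. *)
have small : \sum_(j < m) (C j + la ^+ m) * E N * (j.+1%:R * (K N)%:R) ^+ m @[N --> \oo] --> (0 : R).
  rewrite (_ : nbhs (0 : R) = nbhs (\sum_(j < m) (0 : R))); last by rewrite big1.
  apply: cvg_big => [|j _]; first exact: add_continuous.
  pose c : R := (C j + la ^+ m) * j.+1%:R ^+ m * (9 ^+ d) ^+ m.
  apply: (@cvg_bounded_by R _ (fun N => c * ((radius N)%:R ^+ (d * m) * E N))); last first.
    rewrite (_ : nbhs 0 = nbhs (c * 0 : R)); last by rewrite mulr0.
    by apply: cvgMr; exact: cvg_polylog.
  near=> N.
  have N1 : (1 < N)%N by near: N; exact: nbhs_infty_gt.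
  have c0 : 0 <= C j + la ^+ m by rewrite addr_ge0 //; have [] := hC j.
  rewrite ger0_norm; last by rewrite !mulr_ge0 ?exprn_ge0 ?mulr_ge0 ?expR_ge0.
  rewrite /c exprMn [leRHS](_ : _ = (C j + la ^+ m) * E N * (j.+1%:R ^+ m * ((9 ^+ d) ^+ m * (radius N)%:R ^+ (d * m)))); last by ring.
  rewrite ler_wpM2l // ?mulr_ge0 ?expR_ge0 // ler_wpM2l ?exprn_ge0 //.
  rewrite exprM -exprMn -exprMn lerXn2r ?nnegrE ?exprn_ge0 ?mulr_ge0 // /K natrX.
  rewrite lerXn2r ?nnegrE ?mulr_ge0 // -natrM ler_nat.
  have : (0 < radius N)%N by rewrite /radius expn_gt0 /log2 trunc_log_gt0 N1.
  by lia.
apply/cvgrPdist_le => e e0.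
have e2 : 0 < e / 2 by rewrite divr_gt0.
have hall : \forall N \near \oo, forall j : 'I_m.+1,
  forall (J : {set torus d N}) x y, #|J| = j -> x != y -> x \notin J -> y \notin J ->
  far_apart (radius N) (x |: J)%SET -> far_apart (radius N) (y |: J)%SET ->
  n N ^+ j.+1 * avoid_prob ([set x; y] :|: J)%SET (visits d z N) <= C j * expR (- ep * lnn N).
  by apply: filter_forall => j; have [] := hC j.
have smn : \forall N \near \oo, (1 < N)%N /\
    \sum_(j < m) (C j + la ^+ m) * E N * (j.+1%:R * (K N)%:R) ^+ m <= e / 2.
  near=> N; split; first by near: N; exact: nbhs_infty_gt.
  by near: N; exact: (cvgr_le _ small).
apply: filterS3 hall (separated_limit d2 z m e2) smn => N hN sep [N1 sm].
have n0 := n_gt0 N1.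
(* A non-separated B has m >= j + 2 points, so (la / n)^m has one factor 1/n to spare beyond n^(- j
   - 1); this factor is dominated by [E] because [ep <= 1]. *)
have nE : (n N)^-1 <= E N.
  rewrite -[leLHS]lnK ?posrE ?invr_gt0 // ler_expR lnV ?posrE // mulNr lerN2.
  have l0 : 0 <= lnn N by rewrite ln_ge0 // exprn_ege1 // ler1n ltnW.
  rewrite ler_piMl // /gap_exp invf_le1; have := @latt_green_ge R d d2; lra.
rewrite sub0r normrN ger0_norm; last exact: sumr_ge0.
set k := visits d z N.
have cardT : #|{: torus d N}|%:R = n N by rewrite (@card_torus d N N1) natrX.
pose F (j : 'I_m) (B : {set torus d N}) : R :=
  \sum_(A : {set torus d N} | #|A| == j.+1) (B \subset nbhd (radius N).*2.*2 A)%:R * b j N.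
have b0 j : 0 <= b j N.
  rewrite /b mulr_ge0 ?exprn_ge0 ?invr_ge0 ?(ltW n0) // mulr_ge0 ?expR_ge0 // addr_ge0 //.
  by have [] := hC j.
have F0 j B : 0 <= F j B by apply: sumr_ge0 => A _; rewrite mulr_ge0.
(* Separated sets get the uniform error of [separated_limit]; for any other B the summand of [F] at
   its witness x |: J already suffices. *)
have key (B : {set torus d N}) : #|B| == m ->
    `|avoid_prob B k - (la / n N) ^+ m| <= (n N)^-1 ^+ m * (e / 2) + \sum_(j < m) F j B.
  move=> /eqP Bm.
  have nm0 : 0 < n N ^+ m by rewrite exprn_gt0.
  case: (pselect (far_apart (radius N) B)) => [sB|nB].
    apply: ler_wpDr; first exact: sumr_ge0.
    rewrite exprVn [leRHS]mulrC ler_pdivlMr // -[X in _ * X]gtr0_norm // -normrM mulrBl.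
    rewrite exprMn exprVn divfK ?gt_eqF // mulrC.
    by apply: sep.
  have [J [x [y [[xy xJ yJ] sB sx sy cB]]]] := cluster_witness nB.
  have cJ : #|([set x; y] :|: J)%SET| = #|J|.+2.
    rewrite -finset.setUA cardsU1 cardsU1 !inE negb_or xy xJ yJ.
    by [].
  have jm : (#|J| < m)%N by rewrite -Bm; apply: leq_trans (subset_leq_card sB); rewrite cJ ltnW.
  have jm2 : (#|J|.+2 <= m)%N by rewrite -Bm -cJ; exact: subset_leq_card.
  apply: ler_wpDl; first by rewrite mulr_ge0 ?exprn_ge0 ?invr_ge0 ?(ltW n0) // ltW.
  rewrite (bigD1 (Ordinal jm)) //=; apply: ler_wpDr; first by apply: sumr_ge0.
  rewrite /F (bigD1 (x |: J)%SET) /=; last by rewrite cardsU1 xJ.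
  apply: ler_wpDr; first by apply: sumr_ge0 => A _; rewrite mulr_ge0.
  rewrite cB mul1r /b mulrDl mulrDr.
  apply: le_trans (ler_normB _ _) _; apply: lerD.
    rewrite ger0_norm; last by rewrite divr_ge0 ?exprn_ge0 // sumr_ge0 // => w _; exact: avoid_ge0.
    apply: le_trans (avoid_prob_subset k N1 sB) _.
    rewrite exprVn [leRHS]mulrC ler_pdivlMr ?(exprn_gt0 _ n0) //.
    rewrite [_ * n N ^+ _]mulrC; have := hN (Ordinal (leqW jm)) J x y (erefl _) xy xJ yJ sx sy; exact.
  rewrite ger0_norm; last by rewrite exprn_ge0 // divr_ge0 ?expR_ge0 // ltW.
  rewrite exprMn [leRHS]mulrCA ler_wpM2l //.
  apply: (@le_trans _ _ ((n N)^-1 ^+ #|J|.+2)).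
    apply: ler_wiXn2l => //; rewrite ?invr_ge0 ?(ltW n0) // invf_le1 // exprn_ege1 // ler1n ltnW //.
  by rewrite exprSr ler_wpM2l // exprn_ge0 // invr_ge0 ltW.
apply: le_trans (ler_sum _ key) _.
rewrite big_split /= [leRHS](splitr e); apply: lerD.
  rewrite sumr_const -[leLHS]mulr_natl mulrA -[leRHS]mul1r ler_wpM2r ?(ltW e2) //.
  rewrite exprVn ler_pdivrMr ?(exprn_gt0 _ n0) // mul1r -cardT -natrX ler_nat.
  have := card_draws_le [set: torus d N]%SET m.
  rewrite cardsT; apply: leq_trans; rewrite -sum1_card; apply: eq_leq; apply: eq_bigl => B.
  by rewrite finset.subsetT andbT.
apply: le_trans sm; rewrite exchange_big /=; apply: ler_sum => j _.
rewrite /F exchange_big /=.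
apply: (@le_trans _ _ (\sum_(A : {set torus d N} | #|A| == j.+1) ((j.+1%:R * (K N)%:R) ^+ m * b j N))).
  apply: ler_sum => A /eqP Aj; rewrite -mulr_suml ler_wpM2r //.
  apply: (@le_trans _ _ (#|nbhd (radius N).*2.*2 A| ^ m)%:R).
    apply: (le_trans _ (_ : (\sum_(B : {set torus d N} | (#|B| == m) && (B \subset nbhd (radius N).*2.*2 A)) 1)%:R <= _)); last by rewrite ler_nat card_draws_le.
    by rewrite natr_sum big_mkcondr /= le_eqVlt; apply/orP; left; apply/eqP; apply: eq_bigr => B _; case: ifP.
  rewrite natrX lerXn2r ?nnegrE ?mulr_ge0 // -natrM ler_nat /K -Aj; exact: card_nbhd.
rewrite sumr_const -[leLHS]mulr_natl /b.
rewrite [leLHS](_ : _ = (C j + la ^+ m) * E N * (j.+1%:R * (K N)%:R) ^+ m * (#|[pred A : {set torus d N} | #|A| == j.+1]|%:R * (n N)^-1 ^+ j.+1)); last by ring.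
rewrite -[leRHS]mulr1 ler_wpM2l //.
  by rewrite !mulr_ge0 ?exprn_ge0 ?mulr_ge0 ?expR_ge0 // addr_ge0 //; have [] := hC j.
rewrite exprVn ler_pdivrMr ?(exprn_gt0 _ n0) // mul1r -cardT -natrX ler_nat.
have := card_draws_le [set: torus d N]%SET j.+1.
rewrite cardsT; apply: leq_trans; rewrite -sum1_card; apply: eq_leq; apply: eq_bigl => B.
by rewrite finset.subsetT andbT.
Unshelve. all: by end_near. Qed.

End moments.

(** * Law of the late set *)

Section measurability.
Context d (T : measurableType d) {R : realType} (P : probability T R).

Lemma measurable_and (b c : T -> bool) : measurable [set w | b w] -> measurable [set w | c w] ->
  measurable [set w | b w && c w].
Proof.
move=> mb mc; rewrite (_ : [set w | _] = [set w | b w] `&` [set w | c w]); first exact: measurableI.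
by apply/seteqP; split => w /= => [/andP//|[-> ->]].
Qed.

Lemma measurable_or (b c : T -> bool) : measurable [set w | b w] -> measurable [set w | c w] ->
  measurable [set w | b w || c w].
Proof.
move=> mb mc; rewrite (_ : [set w | _] = [set w | b w] `|` [set w | c w]); first exact: measurableU.
by apply/seteqP; split => w /= /orP.
Qed.

(** The walk is measurable only through its fibres; with countably many values these determine every
    event. *)
Lemma measurable_countable_rv (V : countType) (Y : T -> V) (Q : V -> Prop) :
  (forall v, measurable [set w | Y w = v]) -> measurable [set w | Q (Y w)].
Proof.
move=> mY; rewrite (_ : [set w | _] = \bigcup_v ([set w | Y w = v] `&` [set w | Q v])).
  apply: countable_bigcupT_measurable; first exact: countableP.
  by move=> v; apply: measurableI => //; case: (pselect (Q v)) => q;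
    [rewrite (_ : [set w | Q v] = setT)|rewrite (_ : [set w | Q v] = set0)] => //; apply/seteqP; split.
apply/seteqP; split => w /=; first by move=> q; exists (Y w).
by move=> [v _ [/= ->]].
Qed.

Lemma measurable_fiber_seq (V : eqType) (Y : T -> V) (r : seq V) :
  (forall v, measurable [set w | Y w = v]) -> measurable [set w | Y w \in r].
Proof.
move=> mY; elim: r => [|v r IH]; first by rewrite (_ : [set w | _] = set0) //; apply/seteqP; split.
rewrite (_ : [set w | _] = [set w | Y w = v] `|` [set w | Y w \in r]); first exact: measurableU.
apply/seteqP; split => w /=; first by rewrite inE => /orP[/eqP|]; [left|right].
by rewrite inE => -[->|->]; rewrite ?eqxx ?orbT.
Qed.

Lemma sum_prob_fiber (V : eqType) (Y : T -> V) (s : seq V) (B : set T) : uniq s ->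
  (forall v, measurable [set w | Y w = v]) -> measurable B ->
  (\sum_(v <- s) P (B `&` [set w | Y w = v]) = P (B `&` [set w | Y w \in s]))%E.
Proof.
move=> us mY mB; have mU r := measurable_fiber_seq r mY.
elim: s us => [_|v r IH /= /andP[vr ur]].
  by rewrite big_nil (_ : [set w | _] = set0) ?setI0 ?measure0 //; apply/seteqP; split.
rewrite big_cons IH // -measureU.
- congr (P _); rewrite -setIUr; congr (_ `&` _); apply/seteqP; split => w /=.
    by rewrite inE => -[->|->]; rewrite ?eqxx ?orbT.
  by rewrite inE => /orP[/eqP|]; [left|right].
- by apply: measurableI.
- by apply: measurableI.
- by apply/seteqP; split => w //= [[_ yv] [_ yr]]; rewrite -yv yr in vr.
Qed.

(** [is_srw] constrains the law and not each trajectory, so a path may leave the list s on a null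
    event. Discarding it permits conditioning on the next vertex along the finite list of
    neighbours. *)
Lemma prob_split (V : eqType) (Y : T -> V) (s : seq V) (E A : set T) : uniq s ->
  (forall v, measurable [set w | Y w = v]) -> measurable E -> measurable A ->
  (\sum_(v <- s) P (E `&` [set w | Y w = v]) = P E)%E ->
  (P (E `&` A) = \sum_(v <- s) P (E `&` A `&` [set w | Y w = v]))%E.
Proof.
move=> us mY mE mA eE.
have mU := measurable_fiber_seq s mY.
have sumU B (mB : measurable B) := sum_prob_fiber us mY mB.
rewrite sumU; last exact: measurableI.
set U := [set w | Y w \in s].
rewrite (measureDI P (measurableI _ _ mE mA) mU) -[RHS]add0e; congr (_ + _)%E.
apply/eqP; rewrite eq_le measure_ge0 andbT.
have z : P (E `\` U) = 0%E.
  have e := sumU E mE; rewrite eE -/U in e.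
  have : P E = (P (E `\` U) + P (E `&` U))%E := measureDI P mE mU.
  rewrite -e.
  have /fineK <- : P E \is a fin_num by exact: fin_num_measure.
  have /fineK <- : P (E `\` U) \is a fin_num by apply: fin_num_measure; exact: measurableD mE mU.
  by rewrite -EFinD => -[e']; congr EFin; move: e'; lra.
by rewrite -z le_measure ?inE //; [exact: measurableD (measurableI _ _ mE mA) mU|exact: measurableD mE mU|move=> w [[]]].
Qed.

End measurability.

Section success.
Context {R : realType} (d N : nat).
Local Notation T := (torus d N).
Implicit Types (B : {set T}) (p : nat -> cylinder d N).

(* Within M steps the path makes more than j visits to the level 0, the first
   j of which avoid B *)
Fixpoint avoids B M j p : bool :=
  if (p 0%N).2 == 0 then
    if j is i.+1 then ((p 0%N).1 \notin B) && (if M is k.+1 then avoids B k i (p \o succn) else false)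
    else true
  else if M is k.+1 then avoids B k j (p \o succn) else false.

(** The recursion of [avoids] with the shift of the path replaced by its mean over one step of the
    walk. *)
Fixpoint avoids_prob B M j (x : T) (h : int) : R :=
  if h == 0 then
    if j is i.+1 then (x \notin B)%:R * (if M is k.+1 then cyl_avg (avoids_prob B k i) x 0 else 0)
    else 1
  else if M is k.+1 then cyl_avg (avoids_prob B k j) x h else 0.

Definition level_visits p M : nat := \sum_(i < M.+1) ((p i).2 == 0).

Lemma level_visitsS p M : level_visits p M.+1 = (((p 0%N).2 == 0) + level_visits (p \o succn) M)%N.
Proof. by rewrite /level_visits big_ord_recl. Qed.

Lemma leq_level_visits p M M' : (M <= M')%N -> (level_visits p M <= level_visits p M')%N.
Proof.
move=> /subnK <-; elim: (M' - M)%N => // k IH; apply: leq_trans IH _.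
by rewrite addSn /level_visits [leqRHS]big_ord_recr leq_addr.
Qed.

(** A visit to B at time i is itself counted in [level_visits p i]; the strict inequality therefore
    says that j visits precede it. *)
Lemma avoidsP B M j p : avoids B M j p <-> (j < level_visits p M)%N /\
  forall i, (i <= M)%N -> (p i).2 = 0 -> (p i).1 \in B -> (j < level_visits p i)%N.
Proof.
elim: M j p => [|M IH] j p /=.
  rewrite /level_visits big_ord1; case: eqP => p0; last by split=> // -[].
  case: j => [|j]; last by rewrite andbF; split => // -[].
  split=> // _; split=> // i; rewrite leqn0 => /eqP -> _ _.
  by rewrite big_ord1 p0 eqxx.
have v0 : level_visits p 0 = ((p 0%N).2 == 0) by rewrite /level_visits big_ord1.
rewrite level_visitsS; case: (eqVneq (p 0%N).2 0) => p0 /=; last first.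
  rewrite add0n IH; split=> -[h1 h2]; split=> // i iM.
    case: i iM => [_ /eqP|i iM]; first by rewrite (negbTE p0).
    by rewrite level_visitsS (negbTE p0) add0n; exact: h2.
  by move=> q0 qB; have := h2 i.+1 iM q0 qB; rewrite level_visitsS (negbTE p0).
case: j => [|j].
  split=> // _; split=> // i _ _ _; apply: (@leq_trans (level_visits p 0)).
    by rewrite v0 p0 eqxx.
  exact: leq_level_visits.
rewrite add1n ltnS; split.
  move=> /andP[pB /IH[h1 h2]]; split=> // -[_ _|i iM q0 qB]; first by rewrite (negbTE pB).
  by rewrite level_visitsS p0 eqxx add1n ltnS; exact: h2.
move=> [h1 h2]; apply/andP; split.
  by apply/negP => pB; have := h2 0%N (leq0n _) p0 pB; rewrite v0 p0 eqxx.
apply/IH; split=> // i iM q0 qB; have := h2 i.+1 iM q0 qB.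
by rewrite level_visitsS p0 eqxx.
Qed.

Lemma avoids_mono B M M' j p : (M <= M')%N -> avoids B M j p -> avoids B M' j p.
Proof.
move=> MM /avoidsP[h1 h2]; apply/avoidsP; split; first exact: leq_trans (leq_level_visits _ MM).
move=> i _ q0 qB; have [iM|Mi] := leqP i M; first exact: h2.
by apply: leq_trans h1 (leq_level_visits _ (ltnW Mi)).
Qed.

(** A common horizon is the maximum of the individual ones. B is nonempty because [avoids] also asks
    for more than j visits, which some point of B must provide. *)
Lemma avoids_bigcap B j p : B != finset.set0 ->
  (exists M, avoids B M j p) <-> (forall y, y \in B -> exists M, avoids [set y]%SET M j p).
Proof.
move=> /set0Pn[y0 y0B]; split=> [[M /avoidsP[h1 h2]] y yB|h].
  by exists M; apply/avoidsP; split=> // i iM q0; rewrite inE => /eqP e; apply: h2; rewrite ?e.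
have {}h y : exists M, y \in B -> avoids [set y]%SET M j p.
  by case: (boolP (y \in B)) => yB; [have [M hM] := h y yB; exists M|exists 0%N].
have [f hf] := choice h.
exists (\max_y f y); apply/avoidsP.
have hB y : y \in B -> avoids [set y]%SET (\max_y f y) j p.
  by move=> yB; apply: avoids_mono (hf y yB); exact: leq_bigmax.
split; first by have /avoidsP[] := hB _ y0B.
by move=> i iM q0 qB; have /avoidsP[_] := hB _ qB; apply; rewrite ?inE.
Qed.

Lemma avoids_prob_itv B M j x h : 0 <= avoids_prob B M j x h <= 1.
Proof.
elim: M j x h => [|M IH] j x h /=.
  by case: eqP => _; rewrite ?lexx ?ler01 //; case: j => [|j]; rewrite ?mulr0 ?lexx ?ler01.
have avg i y k : 0 <= cyl_avg (avoids_prob B M i) y k <= 1.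
  apply/andP; split.
    by rewrite -(cyl_avg_cst 0 y k); apply: ler_cyl_avg => y' k'; have /andP[] := IH i y' k'.
  by rewrite -[leRHS](cyl_avg_cst 1 y k); apply: ler_cyl_avg => y' k'; have /andP[] := IH i y' k'.
case: eqP => // _; case: j => [|j]; first by rewrite ler01 lexx.
by case: (x \notin B); rewrite ?mul1r ?mul0r ?lexx ?ler01.
Qed.

Lemma avoids_prob_incr B M j x h : avoids_prob B M j x h <= avoids_prob B M.+1 j x h.
Proof.
elim: M j x h => [|M IH] j x h.
  rewrite [leLHS]/=; case: (eqVneq h 0) => h0; last by have /andP[] := avoids_prob_itv B 1 j x h.
  case: j => [|j]; first by rewrite /= h0 eqxx.
  by rewrite mulr0; have /andP[] := avoids_prob_itv B 1 j.+1 x h.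
rewrite [leLHS]/= [leRHS]/=; case: eqP => // _; last by apply: ler_cyl_avg => y k; exact: IH.
case: j => // j; rewrite ler_wpM2l //; apply: ler_cyl_avg => y k; exact: IH.
Qed.

Definition avoids_lim B j x h : R := limn (fun M => avoids_prob B M j x h).

Lemma cvg_avoids B j x h : avoids_prob B M j x h @[M --> \oo] --> avoids_lim B j x h.
Proof.
suff : cvgn (fun M => avoids_prob B M j x h) by [].
apply: nondecreasing_is_cvgn.
  by apply/nondecreasing_seqP => M; exact: avoids_prob_incr.
by exists 1 => _ [M _ <-]; have /andP[] := avoids_prob_itv B M j x h.
Qed.

Lemma cvg_cyl_avg (u : nat -> T -> int -> R) F x h :
  (forall y k, u M y k @[M --> \oo] --> F y k) -> cyl_avg (u M) x h @[M --> \oo] --> cyl_avg F x h.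
Proof.
move=> c; apply: cvgMl; apply: cvgD; last by apply: cvgD; exact: c.
apply: (@cvg_big _ _ +%R 0 xpredT add_continuous) => i _.
by apply: cvgD; exact: c.
Qed.

(** In the limit the function is bounded and harmonic off the level 0, so a cylinder step from the
    level becomes a trace step by [trace_ker_harmonic]. The first i + 1 visits are the trace times 0
    to i, whence the shift of index. *)
Lemma avoids_limE B j x : (1 < N)%N ->
  avoids_lim B j x 0 = if j is i.+1 then avoid B i x else 1.
Proof.
move=> N1.
have harm i y k : k != 0 -> avoids_lim B i y k = cyl_avg (avoids_lim B i) y k.
  move=> k0; have := @cvg_avoids B i y k; rewrite -cvg_shiftS => h.
  apply: cvg_unique h _ => //.
  rewrite (_ : (fun M => _) = fun M => cyl_avg (avoids_prob B M i) y k); last by apply/funext => M /=; rewrite (negbTE k0).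
  by apply: cvg_cyl_avg => y' k'; exact: cvg_avoids.
have step i y : avoids_lim B i.+1 y 0 = (y \notin B)%:R * trace_op (fun v => avoids_lim B i v 0) y.
  rewrite /trace_op (@trace_ker_harmonic R d N (avoids_lim B i) 1); last 2 first.
  - move=> v k; rewrite ger0_norm.
      apply: (cvgr_to_le (@cvg_avoids B i v k)); near=> M.
      by have /andP[] := avoids_prob_itv B M i v k.
    apply: (cvgr_to_ge (@cvg_avoids B i v k)); near=> M.
    by have /andP[] := avoids_prob_itv B M i v k.
  - by move=> v k; exact: harm.
  have := @cvg_avoids B i.+1 y 0; rewrite -cvg_shiftS => h.
  apply: cvg_unique h _ => //; apply: cvgMr.
  by apply: cvg_cyl_avg => y' k'; exact: cvg_avoids.
elim: j x => [|j IH] x.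
  apply: cvg_unique (@cvg_avoids B 0 x 0) _ => //.
  rewrite (_ : (fun M => _) = fun=> 1); first exact: cvg_cst.
  by apply/funext => -[].
rewrite step; case: j IH => [|j] IH /=; congr (_ * _).
  by rewrite /trace_op; under eq_bigr do rewrite IH; rewrite -/(trace_op (fun=> 1) x) trace_op_cst.
by apply: eq_bigr => y _; rewrite IH.
Unshelve. all: by end_near. Qed.

End success.

Lemma Zp_one_neqN1 N : (2 < N)%N -> (1 : 'Z_N) != -1.
Proof.
move=> N3; apply/eqP => e; have := @Zp_natr_eq N 0 2 (ltnW N3) isT N3.
by rewrite mulr2n [X in 0 == X + _]e addNr eqxx.
Qed.

(** * From path probabilities to the trace *)

Section law.
Context {R : realType} (d N : nat) (N3 : (2 < N)%N).
Context disp (Om : measurableType disp) (P : probability Om R) (X : nat -> Om -> cylinder d N).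
Hypothesis hX : is_srw (@cylinder_nbrs d N) P (@uniform_zero_level R d N) X.
Local Notation T := (torus d N).
Local Notation V := (cylinder d N).
Implicit Types (B : {set T}) (x : nat -> V).

Let N1 : (1 < N)%N. Proof. exact: ltnW. Qed.

Let two_neq : (1 : 'Z_N) != -1. Proof. exact: Zp_one_neqN1. Qed.

Let uniq_nbrs (v : V) : uniq (cylinder_nbrs v).
Proof.
rewrite /cylinder_nbrs cat_uniq; apply/and3P; split.
- by rewrite map_inj_uniq ?undup_uniq // => a b [].
- apply/hasPn => _ /[!inE] /orP[] /eqP ->; apply/mapP => -[y _ [_ /eqP]].
    by rewrite addrC -subr_eq0 addrK.
  by rewrite addrC -subr_eq0 addrK.
- by rewrite /= inE andbT; apply/eqP => -[/addrI].
Qed.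

Lemma sum_cylinder_step (f : V -> R) (v : V) :
  \sum_(u <- cylinder_nbrs v) srw_step (@cylinder_nbrs d N) v u * f u =
  cyl_avg (fun y k => f (y, k)) v.1 v.2.
Proof.
rewrite sum_srw_step /cyl_avg; congr (_ / _).
  by rewrite big_cat /= big_map big_lattice_nbrs // !big_cons big_nil addr0.
rewrite size_cat size_map size_lattice_nbrs //= -natrM; congr (_%:R).
by rewrite mulnS addnC.
Qed.

Let mX := hX.1.

Let measurable_X (Q : V -> Prop) n : measurable [set w | Q (X n w)].
Proof. exact: (@measurable_countable_rv _ Om (T * int)%type (X n) Q (mX n)). Qed.

Lemma measurable_avoids B M j s : measurable [set w | avoids B M j (fun i => X (s + i)%N w)].
Proof.
elim: M j s => [|M IH] j s.
  rewrite (_ : [set w | _] = [set w | avoids B 0 j (fun=> X s w)]); first exact: (measurable_X (fun v => avoids B 0 j (fun=> v))).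
  by apply/seteqP; split => w /=; rewrite addn0.
pose q1 w := ((X s w).2 == 0) && (j == 0%N).
pose q2 w := [&& (X s w).2 == 0, (0 < j)%N & (X s w).1 \notin B].
pose q3 w := (X s w).2 != 0.
rewrite (_ : [set w | _] = [set w | q1 w || (q2 w && avoids B M j.-1 (fun i => X (s.+1 + i)%N w) ||
  q3 w && avoids B M j (fun i => X (s.+1 + i)%N w))]).
  apply: measurable_or; first exact: (measurable_X (fun v => (v.2 == 0) && (j == 0%N))).
  apply: measurable_or; apply: measurable_and; try exact: IH.
    exact: (measurable_X (fun v => [&& v.2 == 0, (0 < j)%N & v.1 \notin B])).
  exact: (measurable_X (fun v => v.2 != 0)).
have e w : (fun i => X (s + i)%N w) \o succn = fun i => X (s.+1 + i)%N w.
  by apply/funext => i /=; rewrite addnS.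
apply/seteqP; split => w /=; rewrite e addn0 /q1 /q2 /q3; case: eqP => //= _;
  by case: j {IH q1 q2} => [|j] //=; rewrite ?orbF.
Qed.

Definition prefix s x : set Om := [set w | forall k, (k <= s)%N -> X k w = x k].

Let extend x s v k : V := if k == s.+1 then v else x k.

Let measurable_prefix s x : measurable (prefix s x).
Proof.
elim: s => [|s IH].
  rewrite (_ : prefix 0 x = [set w | X 0 w = x 0%N]); first exact: mX.
  by apply/seteqP; split => w /=; [apply|move=> e k; rewrite leqn0 => /eqP ->].
rewrite (_ : prefix s.+1 x = prefix s x `&` [set w | X s.+1 w = x s.+1]); first by apply: measurableI => //; exact: mX.
apply/seteqP; split => w /= => [h|[h1 h2] k].
  by split; [move=> k ks; apply: h; exact: leqW|apply: h].
by rewrite leq_eqVlt => /orP[/eqP->|]; [exact: h2|exact: h1].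
Qed.

Let prefix_extend s x v : prefix s x `&` [set w | X s.+1 w = v] = prefix s.+1 (extend x s v).
Proof.
apply/seteqP; split => w /= => [[h1 h2] k|h].
  by rewrite leq_eqVlt ltnS /extend => /orP[/eqP->|ks]; rewrite ?eqxx // ltn_eqF //; exact: h1.
split=> [k ks|]; last by have := h s.+1 (leqnn _); rewrite /extend eqxx.
by have := h k (leqW ks); rewrite /extend ltn_eqF.
Qed.

Definition path_prob s x : R :=
  uniform_zero_level (x 0%N) * \prod_(k < s) srw_step (@cylinder_nbrs d N) (x k) (x k.+1).

Let path_prob_extend s x v : path_prob s.+1 (extend x s v) = path_prob s x * srw_step (@cylinder_nbrs d N) (x s) v.
Proof.
rewrite /path_prob big_ord_recr /= mulrA /extend eqxx (ltn_eqF (ltnSn s)); congr (_ * _ * _).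
by apply: eq_bigr => k _; rewrite !ltn_eqF // ?ltnS // ltnW.
Qed.

(** The Markov property, drawn from path probabilities alone: adding a vertex to a prefix multiplies
    its weight by [srw_step], and the horizon M drops by one. *)
Lemma prob_avoids_prefix B M j s x :
  P (prefix s x `&` [set w | avoids B M j (fun i => X (s + i)%N w)]) =
  (path_prob s x * avoids_prob B M j (x s).1 (x s).2)%:E.
Proof.
move: M j s x; have step M' j' s' x' : (forall v, P (prefix s'.+1 (extend x' s' v) `&` [set w | avoids B M' j' (fun i => X (s'.+1 + i)%N w)]) =
    (path_prob s'.+1 (extend x' s' v) * avoids_prob B M' j' v.1 v.2)%:E) ->
    P (prefix s' x' `&` [set w | avoids B M' j' (fun i => X (s'.+1 + i)%N w)]) =
    (path_prob s' x' * cyl_avg (avoids_prob B M' j') (x' s').1 (x' s').2)%:E.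
  move=> h; rewrite (@prob_split _ _ _ P V (X s'.+1) (cylinder_nbrs (x' s')) (prefix s' x')) //.
  - under eq_bigr do rewrite setIAC prefix_extend h path_prob_extend -mulrA.
    by rewrite sumEFin -mulr_sumr (sum_cylinder_step (fun v => avoids_prob B M' j' v.1 v.2)).
  - exact: measurable_avoids.
  - under eq_bigr do rewrite prefix_extend hX.2 -/(path_prob _ _) path_prob_extend.
    rewrite sumEFin -mulr_sumr [RHS]hX.2 -/(path_prob s' x').
    rewrite (_ : \sum_(v <- _) _ = 1) ?mulr1 //.
    transitivity (\sum_(u <- cylinder_nbrs (x' s')) srw_step (@cylinder_nbrs d N) (x' s') u * 1 : R).
      by apply: eq_bigr => u _; rewrite mulr1.
    by rewrite (sum_cylinder_step (fun=> 1)) cyl_avg_cst.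
have e s' w : (fun i => X (s' + i)%N w) \o succn = fun i => X (s'.+1 + i)%N w.
  by apply/funext => i /=; rewrite addnS.
have pE s x A : (forall w, prefix s x w -> A w) -> P (prefix s x `&` A) = (path_prob s x * 1)%:E.
  move=> h; rewrite mulr1 -hX.2; congr (P _); apply/seteqP; split => w /=; first by case.
  by move=> pw; split => //; exact: h.
have p0 s x A : (forall w, prefix s x w -> ~ A w) -> P (prefix s x `&` A) = (path_prob s x * 0)%:E.
  move=> h; rewrite mulr0 -[RHS](measure0 P); congr (P _); apply/seteqP; split => w //= [pw /h]; exact.
have pext s x A A' : (forall w, prefix s x w -> A w <-> A' w) -> P (prefix s x `&` A) = P (prefix s x `&` A').
  by move=> h; congr (P _); apply/seteqP; split => w /= [pw Aw]; split => //; have [h1 h2] := h w pw; auto.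
elim=> [|M IH] j s x.
  rewrite /=; case: eqP => h0; last first.
    by apply: p0 => w pw /=; rewrite addn0 (pw s) //; case: eqP.
  case: j => [|j]; first by apply: pE => w pw /=; rewrite addn0 (pw s) // h0 eqxx.
  by rewrite mulr0; apply: p0 => w pw /=; rewrite addn0 (pw s) // h0 eqxx andbF.
have nxt i : P (prefix s x `&` [set w | avoids B M i (fun i => X (s.+1 + i)%N w)]) =
    (path_prob s x * cyl_avg (avoids_prob B M i) (x s).1 (x s).2)%:E.
  by apply: step => v; rewrite IH /extend eqxx.
rewrite [avoids_prob _ _ _ _ _]/=; case: eqP => h0; last first.
  rewrite -nxt; apply: pext => w pw /=; rewrite addn0 (pw s) // e.
  by case: eqP.
case: j => [|j]; first by apply: pE => w pw /=; rewrite addn0 (pw s) // h0 eqxx.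
case: (boolP ((x s).1 \in B)) => xB.
  by rewrite mul0r; apply: p0 => w pw /=; rewrite addn0 (pw s) // h0 eqxx xB.
rewrite mul1r -h0 -nxt; apply: pext => w pw /=; rewrite addn0 (pw s) // e h0 eqxx (negbTE xB) /=.
by [].
Qed.

Lemma prob_avoids B M j :
  P [set w | avoids B M j (X ^~ w)] = ((\sum_x avoids_prob B M j x 0) / N%:R ^+ d)%:E.
Proof.
have cT : #|{: T}|%:R = N%:R ^+ d :> R by rewrite card_torus // natrX.
have n0 : N%:R ^+ d != 0 :> R by rewrite expf_neq0 // pnatr_eq0 -lt0n ltnW.
pose s : seq V := [seq at_zero y | y <- enum {: T}].
have us : uniq s by rewrite map_inj_uniq ?enum_uniq // => a b [].
have p0 v : P [set w | X 0 w = v] = (uniform_zero_level v)%:E.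
  transitivity (P (prefix 0 (fun=> v))).
    by congr (P _); apply/seteqP; split => w /=; [move=> e k; rewrite leqn0 => /eqP->|apply].
  by rewrite hX.2 big_ord0 mulr1.
have := @prob_split _ _ _ P V (X 0%N) s setT [set w | avoids B M j (X ^~ w)] us (mX 0%N) measurableT (measurable_avoids B M j 0).
rewrite !setTI => ->.
  rewrite big_map big_enum /= mulr_suml -sumEFin; apply: eq_bigr => y _.
  have := prob_avoids_prefix B M j 0 (fun=> at_zero y).
  rewrite /path_prob big_ord0 mulr1 /uniform_zero_level eqxx cT mul1r mulrC => <-.
  rewrite setIC; congr (P (_ `&` _)); apply/seteqP; split => w /=; last by apply.
  by move=> e k; rewrite leqn0 => /eqP->.
rewrite probability_setT; under eq_bigr do rewrite setTI p0.
rewrite big_map big_enum /=; transitivity (\sum_(y : T) (#|{: T}|%:R^-1 : R)%:E)%E.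
  by apply: eq_bigr => y _; rewrite /uniform_zero_level eqxx mul1r.
by rewrite sumEFin sumr_const -[X in X%:E]mulr_natr mulVf // cT.
Qed.

Lemma prob_avoids_forever B j : P [set w | exists M, avoids B M j.+1 (X ^~ w)] = (avoid_prob B j)%:E.
Proof.
have mF M : measurable [set w | avoids B M j.+1 (X ^~ w)] by exact: (measurable_avoids B M j.+1 0).
have eU : [set w | exists M, avoids B M j.+1 (X ^~ w)] = \bigcup_M [set w | avoids B M j.+1 (X ^~ w)].
  by apply/seteqP; split => w /= [M h]; [exists M|exists M].
rewrite eU.
have c1 := @nondecreasing_cvg_mu _ _ _ P (fun M => [set w | avoids B M j.+1 (X ^~ w)]) mF (bigcupT_measurable _ mF).
have {}c1 := c1 _.
apply: cvg_unique (c1 _) _ => //.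
  by move=> M M' MM; apply/subsetPset => w /=; exact: avoids_mono.
rewrite (_ : P \o _ = fun M => ((\sum_x avoids_prob B M j.+1 x 0) / N%:R ^+ d)%:E); last first.
  by apply/funext => M /=; rewrite prob_avoids.
apply: cvg_EFin; first by near=> M.
apply: cvgMl; apply: (@cvg_big _ _ +%R 0 xpredT add_continuous) => y _.
by have := @cvg_avoids R d N B j.+1 y 0; rewrite avoids_limE.
Unshelve. all: by end_near. Qed.

End law.

Section late.
Context {R : realType} (d N : nat).
Local Notation T := (torus d N).
Implicit Types (B : {set T}) (p : nat -> cylinder d N).

Lemma counting_gt (A : set nat) (t : R) : 0 <= t ->
  (t%:E < counting A)%E <-> exists M, (Num.truncn t < \sum_(i < M.+1) `[< A i >])%N.
Proof.
move=> t0.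
have part m : (counting (A `&` [set i | (i < m)%N]) = (\sum_(i < m) `[< A i >])%:R%:E :> \bar R)%E.
  elim: m => [|m IH].
    by rewrite big_ord0 (_ : _ `&` _ = set0) ?measure0 //; apply/seteqP; split => i //= [].
  rewrite big_ord_recr /= natrD EFinD -IH.
  rewrite (_ : A `&` _ = (A `&` [set i | (i < m)%N]) `|` (A `&` [set m])); last first.
    apply/seteqP; split => i /=.
      by rewrite ltnS leq_eqVlt => -[Ai /orP[/eqP|]]; [right|left].
    by move=> [[Ai im]|[Ai im]]; split => //; [exact: leqW|rewrite im].
  rewrite measureU //; last first.
    by apply/seteqP; split => i //= [[_ im] [_ e]]; rewrite e ltnn in im.
  congr (_ + _)%E; case: asboolP => Am.
    rewrite (_ : A `&` _ = [set m]); last by apply/seteqP; split => i /=; [case|move=> ->].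
    transitivity (counting [set m] : \bar R) => //.
    by rewrite /counting asboolT ?fset_set1 ?finmap.cardfs1 //; exact: finite_set1.
  rewrite (_ : A `&` _ = set0) ?measure0 //.
  by apply/seteqP; split => i //= [Ai e]; apply: Am; rewrite -e.
have gt m : (Num.truncn t < m)%N = (t < m%:R) by rewrite truncn_lt_nat.
split=> [tA|[M]]; last first.
  rewrite gt -lte_fin -part => h; apply: lt_le_trans h _.
  by apply: le_measure; rewrite ?inE.
apply: contrapT => h; move: tA; apply/negP; rewrite -leNgt.
have eA : A = \bigcup_m (A `&` [set i | (i < m.+1)%N]).
  by apply/seteqP; split => [i Ai|i [m _ []]//]; exists i => //; split => //=.
rewrite eA.
have mono : {homo (fun m => A `&` [set i | (i < m.+1)%N]) : m m' / (m <= m')%N >-> (m <= m')%O}.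
  by move=> m m' mm; apply/subsetPset => i /= [Ai im]; split => //; exact: leq_trans im _.
have c := @nondecreasing_cvg_mu _ _ R counting (fun m => A `&` [set i | (i < m.+1)%N]) (fun=> I) I mono.
rewrite -(cvg_lim _ c) //; apply: lime_le; first by apply/cvg_ex; eexists; exact: c.
near=> m; rewrite /= part lee_fin leNgt -gt; apply/negP => hm; apply: h; by exists m.
Unshelve. all: by end_near. Qed.

Definition late_set (z : R) p : {set T} :=
  [set y | ((N%:R ^+ d)%:E * level d N z < local_time p (hitting_time p (at_zero y)))%E]%SET.

(** The local time at the hitting time counts the hitting visit, so exceeding t means that the first
    trunc t visits avoid y. If y is never hit, the hitting time is infinite, all visits count, and
    [avoids] asks for just as many. *)
Lemma late_setP z p y : (2 <= d)%N -> (1 < N)%N -> 0 <= cover_level d z N ->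
  y \in late_set z p <-> exists M, avoids [set y]%SET M (Num.truncn (cover_level d z N)) p.
Proof.
move=> d2 N1 c0; rewrite inE /level greenE // card_torus // natrX -!EFinM -/(cover_level d z N).
rewrite /local_time counting_gt //; set k := Num.truncn _.
have [[i0 e0]|nv] := pselect (exists i, p i = at_zero y); last first.
  rewrite /hitting_time (_ : [set _ | n in _] = set0); last first.
    by apply/seteqP; split => r //= [i /= e]; case: nv; exists i.
  rewrite ereal_inf0; have cnt M : (\sum_(i < M.+1) `[< (i%:R%:E <= +oo :> \bar R)%E /\ zero_level (p i) >] = level_visits p M)%N.
    apply: eq_bigr => i _; congr (nat_of_bool _); apply/asboolP/eqP => [[]//|h]; split => //; exact: leey.
  split=> -[M h]; exists M; first rewrite cnt in h; last by rewrite cnt; have /avoidsP[] := h.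
  apply/avoidsP; split=> // i iM q0; rewrite inE => /eqP q1.
  by case: nv; exists i; rewrite [p i]surjective_pairing q0 q1.
have ex : exists i, p i == at_zero y by exists i0; rewrite e0.
pose H := ex_minn ex.
have [pH Hmin] : p H = at_zero y /\ forall i, p i = at_zero y -> (H <= i)%N.
  by rewrite /H; case: ex_minnP => h /eqP ph hm; split=> // i /eqP; exact: hm.
have -> : hitting_time p (at_zero y) = H%:R%:E :> \bar R.
  apply/eqP; rewrite eq_le; apply/andP; split.
    by apply: ereal_inf_lbound; exists H.
  by apply: le_ereal_inf_tmp => _ [i /= e <-]; rewrite lee_fin ler_nat; exact: Hmin.
have cnt M : (\sum_(i < M.+1) `[< (i%:R%:E <= H%:R%:E :> \bar R)%E /\ zero_level (p i) >] = level_visits p (minn M H))%N.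
  elim: M => [|M IH].
    rewrite min0n /level_visits !big_ord1; congr (nat_of_bool _); apply/asboolP/eqP => [[]//|h].
    by split => //; rewrite lee_fin ler_nat.
  rewrite big_ord_recr /= IH; case: (leqP M.+1 H) => MH.
    rewrite (minn_idPl (ltnW MH)) /level_visits [RHS]big_ord_recr /=; congr (_ + nat_of_bool _)%N.
    by apply/asboolP/eqP => [[]//|h]; split => //; rewrite lee_fin ler_nat.
  rewrite ltnS in MH; rewrite (minn_idPr MH) -[RHS]addn0; congr addn; case: asboolP => // -[].
  by rewrite lee_fin ler_nat leqNgt ltnS MH.
split=> -[M h].
  rewrite cnt in h; exists (minn M H); apply/avoidsP; split=> // i iM q0; rewrite inE => /eqP q1.
  have Hi : (H <= i)%N by apply: Hmin; rewrite [p i]surjective_pairing q0 q1.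
  apply: leq_trans h _; apply: leq_level_visits; exact: leq_trans (geq_minr _ _) Hi.
exists M; rewrite cnt; move: h => /avoidsP[h1 h2].
case: (leqP M H) => MH //; apply: h2; rewrite ?pH ?inE //; exact: ltnW.
Qed.

End late.

Section late_law.
Context {R : realType} (d N : nat) (d2 : (2 <= d)%N) (N3 : (2 < N)%N) (z : R).
Hypotheses (level_ge0 : 0 <= cover_level d z N) (visits_gt0 : (0 < visits d z N)%N).
Context disp (Om : measurableType disp) (P : probability Om R) (X : nat -> Om -> cylinder d N).
Hypothesis hX : is_srw (@cylinder_nbrs d N) P (@uniform_zero_level R d N) X.
Implicit Types B : {set torus d N}.

Let k := Num.truncn (cover_level d z N).

Let k_gt0 : k = (visits d z N).+1.
Proof. by move: visits_gt0; rewrite /visits -/k; case: k => [|[]]. Qed.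

Let subset_late B w : B != finset.set0 ->
  (exists M, avoids B M k (X ^~ w)) <-> B \subset late_set z (X ^~ w).
Proof.
move=> B0; rewrite avoids_bigcap //; split=> [h|/fintype.subsetP h y /h].
  by apply/fintype.subsetP => y yB; apply/(@late_setP R d N z (X ^~ w) y d2 (ltnW N3) level_ge0); exact: h.
by move=> /(@late_setP R d N z (X ^~ w) y d2 (ltnW N3) level_ge0); exact.
Qed.

Lemma measurable_late_superset B : measurable [set w | B \subset late_set z (X ^~ w)].
Proof.
have [->|B0] := eqVneq B finset.set0.
  by rewrite (_ : [set w | _] = setT) //; apply/seteqP; split => w //= _; rewrite finset.sub0set.
rewrite (_ : [set w | _] = \bigcup_M [set w | avoids B M k (X ^~ w)]).
  by apply: bigcupT_measurable => M; exact: (measurable_avoids hX B M k 0).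
apply/seteqP; split => w /=; first by move=> /(subset_late _ B0) [M h]; exists M.
by move=> [M _ h]; apply/(subset_late _ B0); exists M.
Qed.

Lemma prob_late_superset B :
  P [set w | B \subset late_set z (X ^~ w)] = (avoid_prob B (visits d z N))%:E.
Proof.
have [->|B0] := eqVneq B finset.set0.
  rewrite (_ : [set w | _] = setT); last by apply/seteqP; split => w //= _; rewrite finset.sub0set.
  rewrite probability_setT /avoid_prob; congr EFin.
  have h1 j (x : torus d N) : avoid (finset.set0 : {set torus d N}) j x = 1 :> R.
    elim: j x => [|j IH] x /=; rewrite finset.in_set0 mul1r //.
    by rewrite -[RHS](trace_op_cst (N := N) 1 x) //; apply: eq_bigr => y _; rewrite IH.
  under eq_bigr do rewrite h1; rewrite sumr_const card_torus ?(ltnW N3) //.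
  by rewrite natrX mulfV // expf_neq0 // pnatr_eq0 -lt0n ltnW // ltnW.
rewrite -(prob_avoids_forever N3 hX) -k_gt0; congr (P _); apply/seteqP.
by split => w /= /(subset_late _ B0).
Qed.

Lemma measurable_late B : measurable [set w | late_set z (X ^~ w) = B].
Proof.
rewrite (_ : [set w | _] = [set w | B \subset late_set z (X ^~ w)] `&`
    \bigcap_(y in [set y | y \notin B]) ~` [set w | finset.set1 y \subset late_set z (X ^~ w)]).
  apply: measurableI; first exact: measurable_late_superset.
  by apply: fin_bigcap_measurable => // y _; apply: measurableC; exact: measurable_late_superset.
apply/seteqP; split => w /=.
  move=> e; split; first by rewrite e.
  by move=> y /= yB; rewrite /setC /= finset.sub1set e; exact/negP.
move=> [/fintype.subsetP h1 h2]; apply/setP => y; apply/idP/idP => [|/h1//].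
by apply: contraTT => yB; apply/negP => yS; apply: (h2 y) => //=; rewrite finset.sub1set.
Qed.

End late_law.

(** * From factorial moments to total variation *)

Section bonferroni.
Context {R : realFieldType} (T : finType).
Implicit Types (A B C D S U : {set T}) (m j : nat).

Let alternating_bin s m : \sum_(j < m.+1) (-1) ^+ j * 'C(s.+1, j)%:R = (-1) ^+ m * 'C(s, m)%:R :> R.
Proof.
elim: m => [|m IH]; first by rewrite big_ord1 !bin0.
by rewrite big_ord_recr /= IH binS natrD exprS; ring.
Qed.

Lemma sum_by_card (P : pred {set T}) m (G : {set T} -> R) :
  \sum_(C : {set T} | P C && (#|C| < m)%N) G C = \sum_(j < m) \sum_(C : {set T} | P C && (#|C| == j)) G C.
Proof.
rewrite [RHS](exchange_big_dep (fun C : {set T} => P C && (#|C| < m)%N)) /=; last first.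
  by move=> j C _ /andP[-> /eqP ->] /=.
apply: eq_bigr => C /andP[PC Cm]; rewrite (bigD1 (Ordinal Cm)) /=; last by rewrite PC eqxx.
rewrite big1 ?addr0 // => j /andP[/andP[_ /eqP Cj]]; case/eqP; exact: val_inj.
Qed.

(** The alternating partial sum of a binomial row is a single signed coefficient of the previous
    row, which Pascal's rule bounds by the first omitted term. *)
Lemma bonferroni U m : (0 < m)%N ->
  `|(U == finset.set0)%:R - \sum_(D : {set T} | (D \subset U) && (#|D| < m)%N) (-1) ^+ #|D| : R| <=
  \sum_(D : {set T} | (D \subset U) && (#|D| == m)) 1.
Proof.
case: m => // m _.
have cnt j (c : R) : \sum_(D : {set T} | (D \subset U) && (#|D| == j)) c = 'C(#|U|, j)%:R * c.
  by rewrite sumr_const mulr_natl -cards_draws cardsE; congr (_ *+ _); apply: eq_card => D; rewrite !inE.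
rewrite cnt mulr1.
have -> : \sum_(D : {set T} | (D \subset U) && (#|D| < m.+1)%N) (-1) ^+ #|D| =
    \sum_(j < m.+1) (-1) ^+ j * 'C(#|U|, j)%:R :> R.
  rewrite (sum_by_card (fun D => D \subset U)); apply: eq_bigr => j _.
  rewrite -mulrC -cnt; apply: eq_bigr => D /andP[_ /eqP ->] //.
rewrite -cards_eq0; case: (#|U|) => [|s] /=.
  rewrite big_ord_recl /= bin0 mulr1 expr0 big1 ?addr0 ?subrr ?normr0 ?ler0n // => j _.
  by rewrite bin_small // mulr0.
by rewrite sub0r normrN alternating_bin normrM normrX normrN1 expr1n mul1r normr_nat ler_nat binS leq_addl.
Qed.

Lemma subsets_above A S (P : pred nat) (F : nat -> R) : A \subset S ->
  \sum_(C : {set T} | [&& A \subset C, C \subset S & P #|C|]) F #|C| =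
  \sum_(D : {set T} | (D \subset S :\: A)%SET && P (#|A| + #|D|)%N) F (#|A| + #|D|)%N.
Proof.
move=> AS.
rewrite (reindex_onto (fun D => A :|: D)%SET (fun C => C :\: A)%SET) /=; last first.
  by move=> C /and3P[AC _ _]; rewrite finset.setDE finset.setUIr finset.setUCr finset.setIT; exact/finset.setUidPr.
have e D : (D \subset S :\: A)%SET -> #|(A :|: D)%SET| = (#|A| + #|D|)%N.
  by rewrite subsetD => /andP[_ dis]; rewrite cardsU -[RHS]subn0; congr (_ - _)%N;
     apply/eqP; rewrite cards_eq0 finset.setIC setI_eq0.
have sub D : ((D \subset S :\: A)%SET = (A :|: D \subset S)%SET && ((A :|: D) :\: A == D)%SET).
  rewrite finset.setDUl finset.setDv finset.set0U finset.subUset AS /= finset.subsetD.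
  by congr (_ && _); apply/idP/eqP => /finset.setDidPl.
apply: eq_big => [D|D].
  rewrite finset.subsetUl /= andbAC -sub; case: (boolP (D \subset _)) => //= h; by rewrite e.
by rewrite finset.subsetUl /= andbAC -sub => /andP[h _]; rewrite e.
Qed.

Lemma sum_subset_exp U (r : R) : \sum_(D : {set T} | D \subset U) r ^+ #|D| = (1 + r) ^+ #|U|.
Proof.
rewrite exprDn; under [RHS]eq_bigr do rewrite expr1n mul1r.
transitivity (\sum_(D : {set T} | (D \subset U) && (#|D| < #|U|.+1)%N) r ^+ #|D|).
  apply: eq_bigl => D; case: (boolP (D \subset U)) => //= DU; rewrite ltnS.
  by rewrite subset_leq_card.
rewrite (sum_by_card (fun D => D \subset U)); apply: eq_bigr => j _.
transitivity (\sum_(D : {set T} | (D \subset U) && (#|D| == j)) r ^+ j).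
  by apply: eq_bigr => D /andP[_ /eqP ->].
rewrite sumr_const -cards_draws; congr (_ *+ _).
by rewrite [RHS]cardsE.
Qed.

Variables q q' : {set T} -> R.
Hypotheses (q_ge0 : forall A, 0 <= q A) (q'_ge0 : forall A, 0 <= q' A).

Definition superset_mass (f : {set T} -> R) B : R := \sum_(A : {set T} | B \subset A) f A.

(** Moebius inversion over supersets cut at size m; without the cut it recovers f from its superset
    masses. *)
Let trunc m A f : R := \sum_(C : {set T} | (A \subset C) && (#|C| < m)%N) (-1) ^+ (#|C| - #|A|) * superset_mass f C.

Let trunc_err m A f : (forall S, 0 <= f S) -> (#|A| < m)%N ->
  `|f A - trunc m A f| <= \sum_(C : {set T} | (A \subset C) && (#|C| == m)) superset_mass f C.
Proof.
move=> f0 Am.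
have swap (P : pred {set T}) (G : {set T} -> R) : \sum_(C | P C) G C * superset_mass f C =
    \sum_S f S * \sum_(C | P C && (C \subset S)) G C.
  under eq_bigr do rewrite mulr_sumr; rewrite (exchange_big_dep predT) //=.
  by apply: eq_bigr => S _; rewrite mulr_sumr; apply: eq_bigr => C _; rewrite mulrC.
have fA : f A = \sum_S f S * (S == A)%:R.
  by rewrite (bigD1 A) //= eqxx mulr1 big1 ?addr0 // => S /negbTE ->; rewrite mulr0.
rewrite {1}fA /trunc swap -sumrB.
have -> : \sum_(C : {set T} | (A \subset C) && (#|C| == m)) superset_mass f C =
    \sum_S f S * \sum_(C : {set T} | ((A \subset C) && (#|C| == m)) && (C \subset S)) 1.
  by rewrite -swap; apply: eq_bigr => C _; rewrite mul1r.
apply: le_trans (ler_norm_sum _ _ _) _; apply: ler_sum => S _.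
rewrite -mulrBr normrM (ger0_norm (f0 S)) ler_wpM2l //.
case: (boolP (A \subset S)) => AS; last first.
  have no (P : pred {set T}) (G : {set T} -> R) : \sum_(C : {set T} | ((A \subset C) && P C) && (C \subset S)) G C = 0.
    by rewrite big_pred0 // => C; apply/negbTE/negP => /andP[/andP[AC _] CS]; move/negP: AS; apply; apply/fintype.subsetP => x /(fintype.subsetP AC); exact: (fintype.subsetP CS).
  rewrite !no subr0 (_ : S == A = false) ?normr0 //.
  by apply/negbTE; apply: contraNneq AS => ->.
have m0 : (0 < m - #|A|)%N by rewrite subn_gt0.
have := bonferroni (S :\: A)%SET m0.
have -> : ((S :\: A)%SET == finset.set0) = (S == A).
  by rewrite finset.setD_eq0 finset.eqEsubset AS andbT.
have -> : \sum_(D : {set T} | (D \subset S :\: A)%SET && (#|D| < m - #|A|)%N) (-1) ^+ #|D| =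
    \sum_(C : {set T} | ((A \subset C) && (#|C| < m)%N) && (C \subset S)) (-1) ^+ (#|C| - #|A|) :> R.
  have := subsets_above (fun c => (c < m)%N) (fun c => (-1) ^+ (c - #|A|)) AS.
  under [in X in _ = X -> _]eq_bigr do rewrite addKn.
  under [in X in _ = X -> _]eq_bigl do rewrite -ltn_subRL.
  by move=> <-; apply: eq_bigl => C; rewrite -andbA [(_ \subset S) && _]andbC.
have -> : \sum_(D : {set T} | (D \subset S :\: A)%SET && (#|D| == m - #|A|)%N) 1 =
    \sum_(C : {set T} | ((A \subset C) && (#|C| == m)) && (C \subset S)) 1 :> R.
  have := subsets_above (fun c => c == m) (fun c => 1) AS.
  under [in X in _ = X -> _]eq_bigl do rewrite -[X in _ == X](subnKC (ltnW Am)) eqn_add2l.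
  by move=> <-; apply: eq_bigl => C; rewrite -andbA [(_ \subset S) && _]andbC.
by [].
Qed.

(** Summing the bounds over A counts each C once per subset, whence 2^j. The extra 1 covers the sets
    A with at least m points, each of which contains some C of size m. *)
Lemma total_variation_le m :
  \sum_A `|q A - q' A| <=
  \sum_(j < m) 2 ^+ j * \sum_(C : {set T} | #|C| == j) `|superset_mass q C - superset_mass q' C| +
  (2 ^+ m + 1) * \sum_(C : {set T} | #|C| == m) (superset_mass q C + superset_mass q' C).
Proof.
have sm0 f C : (forall A, 0 <= f A) -> 0 <= superset_mass f C by move=> f0; exact: sumr_ge0.
pose D C := `|superset_mass q C - superset_mass q' C|.
pose Y C := superset_mass q C + superset_mass q' C.
have Y0 C : 0 <= Y C by rewrite addr_ge0 ?sm0.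
have key A : `|q A - q' A| <= \sum_(C : {set T} | (A \subset C) && (#|C| < m)%N) D C +
    \sum_(C : {set T} | (A \subset C) && (#|C| == m)) Y C + (m <= #|A|)%:R * (q A + q' A).
  have [Am|Am] := ltnP #|A| m; last first.
    rewrite mul1r; apply: le_trans (ler_normB _ _) _; rewrite !ger0_norm //.
    by rewrite lerDr addr_ge0 // sumr_ge0 // => C _; exact: normr_ge0.
  rewrite mul0r addr0.
  have t1 := trunc_err q_ge0 Am; have t2 := trunc_err q'_ge0 Am.
  have t3 : `|trunc m A q - trunc m A q'| <= \sum_(C : {set T} | (A \subset C) && (#|C| < m)%N) D C.
    rewrite /trunc -sumrB; apply: le_trans (ler_norm_sum _ _ _) _; apply: ler_sum => C _.
    by rewrite -mulrBr normrM normrX normrN1 expr1n mul1r.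
  rewrite big_split /=.
  have -> : q A - q' A = (q A - trunc m A q) + ((trunc m A q - trunc m A q') - (q' A - trunc m A q')).
    by ring.
  apply: le_trans (ler_normD _ _) _; rewrite [leRHS]addrCA; apply: lerD => //.
  by apply: le_trans (ler_normB _ _) _; apply: lerD.
apply: le_trans (ler_sum _ (fun A _ => key A)) _.
have below (P : pred nat) (G : {set T} -> R) : \sum_(A : {set T}) \sum_(C : {set T} | (A \subset C) && P #|C|) G C =
    \sum_(C : {set T} | P #|C|) 2 ^+ #|C| * G C.
  rewrite (exchange_big_dep (fun C : {set T} => P #|C|)) /=; last by move=> A C _ /andP[].
  apply: eq_bigr => C PC; rewrite sumr_const -[LHS]mulr_natl; congr (_ * _).
  rewrite -natrX -card_powerset; congr (_%:R); apply: eq_card => A.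
  by rewrite powersetE /in_mem /= PC andbT.
rewrite [leLHS]big_split /= [X in X + _]big_split /= (below (fun j => (j < m)%N)) (below (fun j => j == m)).
rewrite mulrDl mul1r addrA; apply: lerD; last first.
  have mk (f : {set T} -> R) : (forall A, 0 <= f A) -> \sum_(A : {set T}) (m <= #|A|)%:R * f A <= \sum_(C : {set T} | #|C| == m) superset_mass f C.
    move=> f0; rewrite /superset_mass (exchange_big_dep predT) //=; apply: ler_sum => A _.
    rewrite sumr_const -[leRHS]mulr_natl; apply: ler_wpM2r => //.
    rewrite ler_nat; case: (leqP m #|A|) => // mA.
    have : (0 < 'C(#|A|, m))%N by rewrite bin_gt0.
    rewrite -cards_draws => h; apply: leq_trans h _; rewrite cardsE; apply: eq_leq.
    by apply: eq_card => C; rewrite /in_mem /= andbC.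
  under eq_bigr do rewrite mulrDr.
  by rewrite big_split /= [leRHS]big_split /=; apply: lerD; exact: mk.
apply: lerD.
  rewrite (sum_by_card predT) /=; apply: ler_sum => j _; rewrite mulr_sumr.
  by apply: ler_sum => C /eqP ->.
by rewrite mulr_sumr; apply: ler_sum => C /eqP ->.
Qed.

End bonferroni.

Section convergence.
Context {R : realType}.
Variables (T : nat -> finType) (la : R).
Hypothesis la0 : 0 <= la.
Local Notation n N := (#|T N|%:R : R).
Variables q q' : forall N, {set T N} -> R.
Hypotheses (q_ge0 : forall N (A : {set T N}), 0 <= q A) (q'_ge0 : forall N (A : {set T N}), 0 <= q' A).
Hypothesis n_gt0 : \forall N \near \oo, 0 < n N.

Let dev (f : forall N, {set T N} -> R) m N : R :=
  \sum_(B : {set T N} | #|B| == m) `|superset_mass (@f N) B - (la / n N) ^+ m|.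

Hypothesis q_moments : forall m, dev (@q) m N @[N --> \oo] --> (0 : R).
Hypothesis q'_moments : forall m, dev (@q') m N @[N --> \oo] --> (0 : R).

(* Probability laws on finite sets with the same Poissonian factorial moments merge. *)
Lemma cvg_total_variation : \sum_(A : {set T N}) `|q A - q' A| @[N --> \oo] --> (0 : R).
Proof.
apply/cvgrPdist_le => e e0.
(* The m-point sets carry the mass at most la^m / m!, and the factorial beats 2^m; so m can be fixed
   first and N sent to infinity afterwards. *)
have c1 : (2 ^+ m + 1) * (2 * (la ^+ m / m`!%:R)) @[m --> \oo] --> (0 : R).
  rewrite (_ : nbhs (0 : R) = nbhs (2 * 0 + 2 * 0 : R)); last by rewrite !mulr0 addr0.
  rewrite (_ : (fun m => _) = fun m => 2 * exp_coeff (2 * la) m + 2 * exp_coeff la m).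
    by apply: cvgD; apply: cvgMr; exact: cvg_exp_coeff.
  by apply/funext => m; rewrite !exp_coeffE exprMn; ring.
have e2 : 0 < e / 2 by rewrite divr_gt0.
have [m _ /(_ _ (leqnn m)) hm] := cvgr_le _ c1 _ e2.
pose err N := \sum_(j < m) 2 ^+ j * (dev (@q) j N + dev (@q') j N) + (2 ^+ m + 1) * (dev (@q) m N + dev (@q') m N).
have cerr : err N @[N --> \oo] --> (0 : R).
  rewrite (_ : nbhs 0 = nbhs (\sum_(j < m) 2 ^+ j * (0 + 0) + (2 ^+ m + 1) * (0 + 0) : R)); last first.
    by rewrite addr0 mulr0 addr0 big1 // => j _; rewrite mulr0.
  apply: cvgD; last by apply: cvgMr; apply: cvgD.
  apply: (@cvg_big _ _ +%R 0 xpredT add_continuous) => j _.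
  by apply: cvgMr; apply: cvgD.
near=> N.
have n0 : 0 < n N by near: N.
have eN : err N <= e / 2 by near: N; apply: (cvgr_le _ cerr); rewrite divr_gt0.
rewrite sub0r normrN ger0_norm; last exact: sumr_ge0.
apply: le_trans (total_variation_le (@q_ge0 N) (@q'_ge0 N) m) _.
rewrite [leRHS](splitr e) -/(n N); apply: le_trans (lerD eN hm).
rewrite /err -addrA; apply: lerD.
  apply: ler_sum => j _; rewrite ler_wpM2l ?exprn_ge0 // /dev -big_split /=.
  apply: ler_sum => B _; rewrite [X in _ <= _ + X]distrC; exact: ler_distD.
rewrite -mulrDr ler_wpM2l ?addr_ge0 ?exprn_ge0 //.
have up (f : {set T N} -> R) : \sum_(C : {set T N} | #|C| == m) superset_mass f C <=
    \sum_(C : {set T N} | #|C| == m) `|superset_mass f C - (la / n N) ^+ m| + la ^+ m / m`!%:R.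
  have h : \sum_(C : {set T N} | #|C| == m) (la / n N) ^+ m <= la ^+ m / m`!%:R.
    rewrite sumr_const -[leLHS]mulr_natl exprMn mulrCA ler_wpM2l ?exprn_ge0 //.
    rewrite exprVn ler_pdivrMr ?(exprn_gt0 _ n0) // ler_pdivlMl ?ltr0n ?fact_gt0 //.
    rewrite -natrX -natrM ler_nat; apply: leq_trans (bin_mul_fact_le _ _).
    rewrite -cardsT -cards_draws mulnC leq_mul2r; apply/orP; right; apply: eq_leq.
    by apply: eq_card => C; rewrite [RHS]inE finset.subsetT.
  apply: le_trans (lerD (lexx _) h); rewrite -big_split /=; apply: ler_sum => C _.
  by rewrite -lerBlDr ler_norm.
rewrite big_split /= mulr2n mulrDl mul1r addrACA; apply: lerD; exact: up.
Unshelve. all: by end_near. Qed.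

End convergence.

(** * Poisson process as a mixture of iid samples *)

Section iid.
Context {R : realType} d (T : measurableType d).

Definition tuple_cons n (p : T * n.-tuple T) : n.+1.-tuple T := [tuple of p.1 :: p.2].

Lemma measurable_tuple_cons n : measurable_fun setT (@tuple_cons n).
Proof. exact: measurable_cons. Qed.

HB.instance Definition _ n :=
  isMeasurableFun.Build _ _ _ _ (@tuple_cons n) (@measurable_tuple_cons n).

Variable mu : probability T R.

Fixpoint iid n : probability (n.-tuple T) R :=
  if n is m.+1 then distribution (mu \x iid m)%E (@tuple_cons m) else \d_[tuple].

Section counts.
Variables (I : finType) (c : T -> option I).
Hypothesis mc : forall o, measurable [set y | c y = o].
Implicit Types (k : I -> nat) (s : seq T).

Definition class_count s (i : I) : nat := count (fun y => c y == Some i) s.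

Definition class_prob o : R := fine (mu [set y | c y = o]).

(** Multinomial probability divided by m!, the normalization for which the recursion [weightS] is
    clean. [None] collects the points of no class, and the leading indicator guards the truncated
    subtraction. *)
Let weight m k : R := (\sum_i k i <= m)%N%:R * (class_prob None ^+ (m - \sum_i k i) / (m - \sum_i k i)`!%:R) *
  \prod_i (class_prob (Some i) ^+ k i / (k i)`!%:R).

Let decr k i j : nat := if j == i then (k j).-1 else k j.

Let sum_decr k i : (0 < k i)%N -> (\sum_j k j = (\sum_j decr k i j).+1)%N.
Proof.
move=> ki; rewrite (bigD1 i) //= [in RHS](bigD1 i) //= {1}/decr eqxx -addSn prednK //; congr addn.
by apply: eq_bigr => j /negbTE ji; rewrite /decr ji.
Qed.

Let weight0 k : weight 0 k = (\sum_i k i == 0)%N%:R.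
Proof.
rewrite /weight leqn0; case: (boolP (\sum_i k i == 0)%N) => [/eqP s0|_]; last by rewrite !mul0r.
rewrite s0 subn0 expr0 fact0 divr1 !mul1r big1 // => i _.
by move/eqP: s0; rewrite sum_nat_eq0 => /forallP/(_ i) /= /eqP ->; rewrite expr0 fact0 divr1.
Qed.

Let weightS m k : m.+1%:R * weight m.+1 k =
  class_prob None * weight m k + \sum_i (0 < k i)%N%:R * (class_prob (Some i) * weight m (decr k i)).
Proof.
set s := (\sum_i k i)%N.
have e1 i : (0 < k i)%N%:R * (class_prob (Some i) * weight m (decr k i)) = (k i)%:R * weight m.+1 k.
  case: (posnP (k i)) => [->|ki]; first by rewrite !mul0r.
  rewrite mul1r /weight (sum_decr ki) ltnS subSS.
  rewrite [\prod_j (_ ^+ decr k i j / _)](bigD1 i) //= [\prod_j (_ ^+ k j / _)](bigD1 i) //=.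
  have di : decr k i i = (k i).-1 by rewrite /decr eqxx.
  rewrite !di.
  rewrite (eq_bigr (fun j => class_prob (Some j) ^+ k j / (k j)`!%:R)); last first.
    by move=> j /negbTE ji; rewrite /decr ji.
  rewrite -[in RHS](prednK ki) exprS factS natrM prednK //.
  have k0 : (k i)%:R != 0 :> R by rewrite pnatr_eq0 -lt0n.
  have f0 : (k i).-1`!%:R != 0 :> R by rewrite pnatr_eq0 -lt0n fact_gt0.
  move: (_ <= _)%N%:R (class_prob None ^+ _ / _) (\prod_(_ | _) _) => a b e.
  by field; rewrite k0 f0.
under eq_bigr do rewrite e1.
rewrite -mulr_suml -natr_sum -/s.
have e0 : class_prob None * weight m k = (m.+1 - s)%N%:R * weight m.+1 k.
  rewrite /weight -/s; case: (ltngtP s m.+1) => sm.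
  - have -> : (s <= m)%N = true by rewrite -ltnS.
    rewrite subSn // exprS factS natrM.
    have f0 : (m - s)`!%:R != 0 :> R by rewrite pnatr_eq0 -lt0n fact_gt0.
    have k0 : (m - s).+1%:R != 0 :> R by rewrite pnatr_eq0.
    by move: (\prod_(_ | _) _) (_.+1%:R) k0 => e K k0; field; rewrite k0 f0.
  - by have -> : (s <= m)%N = false; [apply/negbTE; rewrite -ltnNge ltnW|rewrite !mul0r !mulr0].
  - by rewrite sm ltnn subnn !mul0r mulr0.
rewrite e0 -mulrDl -natrD.
case: (leqP s m.+1) => sm; first by rewrite subnK.
by rewrite /weight -/s leqNgt sm !mul0r !mulr0.
Qed.

Lemma measurable_class_count m (Q : (I -> nat) -> Prop) : measurable [set t : m.-tuple T | Q (class_count t)].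
Proof.
have e (t : m.-tuple T) : class_count t = fun i => count (pred1 (Some i)) (map_tuple c t).
  by apply/funext => i; rewrite /= count_map.
have -> : [set t : m.-tuple T | Q (class_count t)] =
    [set t : m.-tuple T | Q (fun i => count (pred1 (Some i)) (map_tuple c t))].
  by apply/seteqP; split => t /=; rewrite e.
suff h v : measurable [set t : m.-tuple T | map_tuple c t = v].
  exact: (@measurable_countable_rv _ _ (m.-tuple (option I)) (map_tuple c) (fun v => Q (fun i => count (pred1 (Some i)) v)) h).
rewrite (_ : [set t | _] = \bigcap_(j in [set: 'I_m]) ((fun t : m.-tuple T => tnth t j) @^-1` [set y | c y = tnth v j])).
  apply: fin_bigcap_measurable => // j _; rewrite -[X in measurable X]setTI.
  by apply: measurable_tnth => //; exact: mc.
apply/seteqP; split => t /= => [<- j _|h]; first by rewrite /= tnth_map.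
by apply: eq_from_tnth => j; rewrite tnth_map; exact: h.
Qed.

Let mu_fiber o : mu [set y | c y = o] = (class_prob o)%:E.
Proof. by rewrite fineK // fin_num_measure. Qed.

(** Induction on the sample size, splitting on the class of the first point; [weightS] is the
    resulting identity. *)
Lemma iid_class_count m k : iid m [set t | class_count t = k] = (m`!%:R * weight m k)%:E.
Proof.
elim: m k => [|m IH] k.
  rewrite /= weight0 fact0 mul1r diracE; congr ((nat_of_bool _)%:R%:E).
  apply/idP/idP => [|/eqP s0]; last first.
    rewrite inE /=; apply/funext => i; rewrite /class_count /=.
    by move/eqP: s0; rewrite sum_nat_eq0 => /forallP/(_ i) /= /eqP ->.
  by rewrite inE /= => <-; rewrite big1.
rewrite /= /distribution /pushforward; set A := _ @^-1` _.
have mA : measurable A by rewrite -[A]setTI; apply: measurable_tuple_cons => //; exact: (measurable_class_count (fun c => c = k)).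
pose Y (p : T * m.-tuple T) := c p.1.
have mY o : measurable [set p | Y p = o].
  by have := @measurable_fst _ _ T (m.-tuple T) measurableT _ (mc o); rewrite setTI.
have := sum_prob_fiber (mu \x iid m)%E (enum_uniq {: option I}) mY mA.
rewrite (_ : A `&` [set w | Y w \in enum {: option I}] = A); last first.
  by apply/seteqP; split => w /=; [case|move=> h; split => //; rewrite mem_enum].
move=> <-; rewrite big_enum /= sum_option.
rewrite factS natrM -mulrA [_%:R * (_ * _)]mulrCA weightS mulrDr EFinD; congr (_ + _)%E.
  rewrite (_ : A `&` _ = [set y | c y = None] `*` [set t : m.-tuple T | class_count t = k]).
    rewrite product_measure1E //; last exact: (measurable_class_count (fun c => c = k)).
    transitivity ((class_prob None)%:E * (m`!%:R * weight m k)%:E)%E.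
      by congr (_ * _)%E; [exact: mu_fiber|exact: IH].
    by rewrite -EFinM; congr EFin; ring.
  apply/seteqP; split => -[y t] /=; rewrite /A /Y /class_count /=.
    by move=> [h cy]; split=> //; rewrite -h; apply/funext => i; rewrite cy.
  by move=> [cy h]; split => //; rewrite -h; apply/funext => i; rewrite cy.
rewrite mulr_sumr -sumEFin; apply: eq_bigr => i _.
have [ki|ki] := posnP (k i).
  rewrite mul0r mulr0 (_ : _ `&` _ = set0) ?measure0 //.
  apply/seteqP; split => -[y t] //=; rewrite /A /Y /class_count /= => -[h cy].
  by move/(congr1 (fun f => f i)): h; rewrite cy eqxx ki.
rewrite mul1r (_ : A `&` _ = [set y | c y = Some i] `*` [set t : m.-tuple T | class_count t = decr k i]).
  rewrite product_measure1E //; last exact: (measurable_class_count (fun c => c = decr k i)).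
  transitivity ((class_prob (Some i))%:E * (m`!%:R * weight m (decr k i))%:E)%E.
    by congr (_ * _)%E; [exact: mu_fiber|exact: IH].
  by rewrite -EFinM; congr EFin; ring.
apply/seteqP; split => -[y t] /=; rewrite /A /Y /class_count /decr /=.
  move=> [h cy]; split=> //; rewrite -h; apply/funext => j; rewrite cy.
  have -> : (Some i == Some j) = (j == i) by rewrite eq_sym.
  by case: eqP.
move=> [cy h]; split => //; apply/funext => j; rewrite cy.
have -> : (Some i == Some j) = (j == i) by rewrite eq_sym.
move/(congr1 (fun f => f j)): h => /= ->.
by case: eqP => [->|_]; rewrite ?add0n // add1n prednK.
Qed.

Lemma sum_class_prob : class_prob None + \sum_i class_prob (Some i) = 1.
Proof.
have := sum_prob_fiber mu (enum_uniq {: option I}) mc measurableT.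
rewrite (_ : setT `&` _ = setT) ?probability_setT; last first.
  by rewrite setTI; apply/seteqP; split => y //= _; rewrite mem_enum.
rewrite big_enum /= sum_option setTI mu_fiber => e; apply: EFin_inj; rewrite -e EFinD -sumEFin.
by congr (_ + _)%E; apply: eq_bigr => i _; rewrite setTI mu_fiber.
Qed.

End counts.

(** Ordered samples of every finite length; an event is measurable when its part in each length
    is. *)
Definition configs := {k : nat & k.-tuple T}.

HB.instance Definition _ := gen_eqMixin configs.
HB.instance Definition _ := gen_choiceMixin configs.
HB.instance Definition _ := isPointed.Build configs (existT (fun k => k.-tuple T) 0%N [tuple]).

Definition slice (A : set configs) k : set (k.-tuple T) := [set t | A (existT _ k t)].
Arguments slice : clear implicits.

Let configs_measurable (A : set configs) := forall k, measurable (slice A k).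

Let configs_measurable0 : configs_measurable set0.
Proof. by move=> k; exact: measurable0. Qed.

Let configs_measurableC A : configs_measurable A -> configs_measurable (~` A).
Proof. by move=> mA k; exact: measurableC (mA k). Qed.

Let configs_measurable_bigcup (F : (set configs)^nat) :
  (forall i, configs_measurable (F i)) -> configs_measurable (\bigcup_i F i).
Proof. by move=> mF k; exact: bigcupT_measurable (fun i => mF i k). Qed.

HB.instance Definition _ := @isMeasurable.Build default_measure_display configs
  configs_measurable configs_measurable0 configs_measurableC configs_measurable_bigcup.

Definition points (w : configs) : seq T := tval (tagged w).

Definition config_of k (t : k.-tuple T) : configs := existT _ k t.

Lemma measurable_config_of k : measurable_fun setT (@config_of k).
Proof. by move=> _ A mA; rewrite setTI; exact: mA. Qed.

HB.instance Definition _ k :=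
  isMeasurableFun.Build _ _ _ _ (@config_of k) (@measurable_config_of k).

Variable la : R.
Hypothesis la0 : 0 < la.

Let pmf_ge0 k : 0 <= expR (- la) * (la ^+ k / k`!%:R).
Proof. by rewrite mulr_ge0 ?expR_ge0 // divr_ge0 // exprn_ge0 // ltW. Qed.

(** A Poisson number of points with mean la, then independent positions: the construction of a
    Poisson process of finite intensity. *)
Definition poisson_law : set configs -> \bar R :=
  mseries (fun k => mscale (NngNum (pmf_ge0 k)) (distribution (iid k) (@config_of k))) 0.

HB.instance Definition _ := Measure.on poisson_law.

Lemma poisson_lawE A : poisson_law A =
  (\sum_(0 <= k <oo) ((expR (- la) * (la ^+ k / k`!%:R))%:E * iid k (slice A k)))%E.
Proof. by []. Qed.

Let exp_series (x : R) s : series (fun k => (s <= k)%N%:R * (x ^+ (k - s) / (k - s)`!%:R)) M @[M --> \oo] --> expR x.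
Proof.
pose u k := (s <= k)%N%:R * (x ^+ (k - s) / (k - s)`!%:R).
suff e : (fun M => series u (M + s)%N) = series (exp_coeff x).
  by rewrite -(cvg_shiftn s) /= e; exact: is_cvg_series_exp_coeff.
apply/funext => M.
rewrite /series /u /= (@big_cat_nat _ _ _ s) ?leq_addl //= big_nat big1 ?add0r; last first.
  by move=> k /andP[_ ks]; rewrite leqNgt ks mul0r.
rewrite -{1}[s]add0n big_addn addnK; apply: eq_bigr => k _.
by rewrite leq_addl addnK mul1r exp_coeffE mulrC.
Qed.

Let poisson_law_setT : poisson_law setT = 1%E.
Proof.
have h : series (fun k => expR (- la) * ((0 <= k)%N%:R * (la ^+ (k - 0) / (k - 0)`!%:R))) M @[M --> \oo] --> (1 : R).
  rewrite (_ : nbhs (1 : R) = nbhs (expR (- la) * expR la)); last by rewrite -expRD addNr expR0.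
  rewrite (_ : series _ = fun M => expR (- la) * series (fun k => (0 <= k)%N%:R * (la ^+ (k - 0) / (k - 0)`!%:R)) M).
    by apply: cvgMr; exact: exp_series.
  by apply/funext => M; rewrite /series /= mulr_sumr.
rewrite poisson_lawE; transitivity ((limn (series (fun k => expR (- la) * ((0 <= k)%N%:R * (la ^+ (k - 0) / (k - 0)`!%:R)))))%:E); last by rewrite (cvg_lim _ h).
rewrite -EFin_lim; last by apply/cvg_ex; eexists; exact: h.
congr (limn _); apply/funext => M; rewrite /series /= -sumEFin; apply: eq_bigr => k _.
rewrite (_ : slice setT k = setT) // probability_setT mule1; congr EFin.
by rewrite subn0 mul1r.
Qed.

HB.instance Definition _ := Measure_isProbability.Build _ _ _ poisson_law poisson_law_setT.

(** Poisson splitting: the m! of the multinomial law cancels that of the Poisson weight, and summing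
    over the number of points of class [None] leaves exp(la p None), which reduces exp(- la) to the
    product over the classes. *)
Lemma poisson_class_count (I : finType) (c : T -> option I) (k : I -> nat) :
  (forall o, measurable [set y | c y = o]) ->
  poisson_law [set w | class_count c (points w) = k] =
  (\prod_i (expR (- (la * class_prob c (Some i))) * ((la * class_prob c (Some i)) ^+ k i / (k i)`!%:R)))%:E.
Proof.
move=> mc; set s := (\sum_i k i)%N; set p := class_prob c; set D := \prod_i (p (Some i) ^+ k i / (k i)`!%:R).
pose u m := expR (- la) * la ^+ s * D * ((s <= m)%N%:R * ((la * p None) ^+ (m - s) / (m - s)`!%:R)).
have h : series u M @[M --> \oo] --> expR (- la) * la ^+ s * D * expR (la * p None).
  rewrite (_ : series _ = fun M => expR (- la) * la ^+ s * D * series (fun m => (s <= m)%N%:R * ((la * p None) ^+ (m - s) / (m - s)`!%:R)) M).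
    by apply: cvgMr; exact: exp_series.
  by apply/funext => M; rewrite /series /= mulr_sumr.
have -> : \prod_i (expR (- (la * p (Some i))) * ((la * p (Some i)) ^+ k i / (k i)`!%:R)) =
    expR (- la) * la ^+ s * D * expR (la * p None).
  rewrite big_split /= -expR_sum.
  under [X in _ * X]eq_bigr do rewrite exprMn -mulrA.
  rewrite big_split /= -/D prodrXr -/s sumrN -mulr_sumr.
  have := sum_class_prob mc; rewrite -/p => e.
  have -> : - la = la * (- \sum_i p (Some i)) - la * p None.
    by rewrite -[X in - X](mulr1 la) -e; ring.
  rewrite expRD mulrN.
  have : expR (- (la * p None)) * expR (la * p None) = 1 by rewrite -expRD addNr expR0.
  move: (expR (- (la * p None))) (expR (la * p None)) => E1 E2 E12.
  rewrite [RHS](_ : _ = expR (- (la * \sum_i p (Some i))) * (la ^+ s * D) * (E1 * E2)); last by ring.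
  by rewrite E12 mulr1.
rewrite poisson_lawE -(cvg_lim _ h) //= -EFin_lim; last by apply/cvg_ex; eexists; exact: h.
congr (limn _); apply/funext => M; rewrite /series /= -sumEFin; apply: eq_bigr => m _.
rewrite (_ : slice _ m = [set t : m.-tuple T | class_count c t = k]) // iid_class_count //.
rewrite -EFinM; congr EFin; rewrite /u -/s -/p -/D.
case: (leqP s m) => sm; last by rewrite !mul0r !mulr0.
have f0 : m`!%:R != 0 :> R by rewrite pnatr_eq0 -lt0n fact_gt0.
rewrite !mul1r -{1}(subnKC sm) exprD exprMn.
have f1 : (m - s)`!%:R != 0 :> R by rewrite pnatr_eq0 -lt0n fact_gt0.
by field; rewrite f0 f1.
Qed.

End iid.

(** * Point measures on (R/Z)^d x R *)

Section state_space.
Context {R : realType} (d : nat).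
Local Notation E := (borel_state R d).
Local Notation pm := (point_measure R d).
Local Notation cube_pt := (d.-tuple R).

Definition torus_point (y : d.-tuple R) : E := (\row_i mod_Z (tnth y i), 0).

Lemma continuous_row_mod_Z :
  continuous ((fun M => (\row_i mod_Z (M 0 i), 0 : R)) : 'rV[R]_d -> state R d).
Proof.
move=> M U [[A B] /= [[P MP PA] /nbhs_singleton B0] AB].
exists (fun i j => @mod_Z R @^-1` P i j).
  move=> i j; have := MP i j; rewrite mxE (ord1 i) => h.
  by have := @pi_continuous _ _ (M 0 j) _ h.
by move=> M' hM; apply: AB; split => //=; apply: PA => i j; rewrite mxE (ord1 i); exact: hM.
Qed.

Lemma torus_point_nbhs (y : d.-tuple R) (U : set (state R d)) : nbhs (torus_point y : state R d) U ->
  exists2 e : R, 0 < e & forall y' : d.-tuple R, (forall i, `|tnth y i - tnth y' i| < e) -> U (torus_point y').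
Proof.
have eM (y' : d.-tuple R) : torus_point y' = (\row_i mod_Z ((\row_j tnth y' j : 'rV[R]_d) 0 i), 0).
  by congr (_, _); apply/rowP => i; rewrite !mxE.
rewrite eM => /continuous_row_mod_Z /nbhs_ballP [e e0 he]; exists e => // y' hy.
rewrite eM; apply: (he (\row_j tnth y' j)); split=> // i j; rewrite !mxE; exact: hy.
Qed.

(** Tuples carry the product sigma-algebra, so the preimage of an open set is displayed as a
    countable union of boxes with rational centres and radii. *)
Lemma measurable_torus_point : measurable_fun setT (torus_point : cube_pt -> E).
Proof.
apply: (@measurability _ _ cube_pt E setT torus_point (@open (state R d))) => // _ [U oU <-]; rewrite setTI.
pose box (q : d.-tuple rat * rat) : set cube_pt := [set y | forall i, `|tnth y i - ratr (tnth q.1 i)| < ratr q.2].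
have mbox q : measurable (box q).
  rewrite (_ : box q = \bigcap_(i in [set: 'I_d]) ((fun y : cube_pt => tnth y i) @^-1` (ball (ratr (tnth q.1 i) : R) (ratr q.2)))).
    apply: fin_bigcap_measurable => // i _; rewrite -[X in measurable X]setTI.
    by apply: measurable_tnth => //; exact: measurable_ball.
  by apply/seteqP; split => y h i; [move=> _|]; rewrite /ball /= distrC; exact: h.
rewrite (_ : _ @^-1` _ = \bigcup_q (if `[< box q `<=` torus_point @^-1` U >] then box q else set0)).
  apply: countable_bigcupT_measurable; first exact: countableP.
  by move=> q; case: ifP.
apply/seteqP; split => y /=; last by move=> [q _]; case: asboolP => // h; exact: h.
move=> Uy; have [e e0 he] := torus_point_nbhs (open_nbhs_nbhs (conj oU Uy)).
have [r] := rat_in_itvoo (divr_gt0 e0 (ltr0n R 2)); rewrite in_itv /= => /andP[r0 re].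
have /choice[q hq] i : exists q, `|tnth y i - ratr q| < ratr r.
  have h : tnth y i - ratr r < tnth y i + ratr r by move: r0; lra.
  have [q] := rat_in_itvoo h; rewrite in_itv /= => /andP[h1 h2].
  by exists q; rewrite ltr_norml; apply/andP; split; lra.
exists ([tuple q i | i < d], r) => //; case: asboolP => [_|]; first by move=> i; rewrite tnth_mktuple.
case=> y' hy' /=; apply: he => i; have := hy' i; rewrite tnth_mktuple => h.
rewrite -(subrKA (ratr (q i))); apply: le_lt_trans (ler_normD _ _) _.
by have := hq i; rewrite distrC in h; move: h re; lra.
Qed.

Lemma cvg_torus_point (y_ : nat -> d.-tuple R) y (f : state R d -> R) : continuous f ->
  (forall i, tnth (y_ n) i @[n --> \oo] --> tnth y i) ->
  f (torus_point (y_ n)) @[n --> \oo] --> f (torus_point y).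
Proof.
move=> cf cy V hV; have /torus_point_nbhs[e e0 he] := cf (torus_point y) V hV.
have h : \forall n \near \oo, forall i : 'I_d, `|tnth y i - tnth (y_ n) i| < e.
  by apply: filter_forall => i; have /cvgrPdist_lt/(_ e e0) := cy i.
by apply: filterS h => n; exact: he.
Qed.

Lemma measurable_continuous_state (f : state R d -> R) : continuous f ->
  measurable_fun setT (f : E -> measurableTypeR R).
Proof.
move=> /continuousP cf; apply: (measurability _ (RGenOpens.measurableE R)).
move=> _ [_ [a [b ->] <-]]; rewrite setTI; apply: sub_sigma_algebra; exact/cf/interval_open.
Qed.

Lemma dirac_sum_integral (I : finType) (a : pred I) (f : I -> E) (h : compactly_supported R d) :
  pm_integrals (dirac_sum_pm a f) h = \sum_(i | a i) sval h (f i).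
Proof.
have mh := measurable_continuous_state (svalP h).1.
pose s := [seq f i | i <- [seq i <- enum I | a i]].
have sE (V : nmodType) (G : E -> V) : \sum_(i | a i) G (f i) = \sum_(k < size s) G (nth point s k).
  rewrite -(big_mkord xpredT (fun k => G (nth point s k))) -(big_nth point xpredT G) big_map big_filter.
  by rewrite big_enum_cond.
pose m_ k : measure E R := \d_(nth point s k).
have pos (g : E -> \bar R) : measurable_fun setT g -> (forall x, 0 <= g x)%E ->
    (\int[dirac_sum_pm a f]_x g x = \sum_(i | a i) g (f i))%E.
  move=> mg g0.
  rewrite (@eq_measure_integral _ _ _ _ (msum m_ (size s))); last first.
    by move=> A mA _; exact: (sE _ (fun x => \d_x A)).
  rewrite ge0_integral_measure_sum // sE; apply: eq_bigr => k _.
  by rewrite integral_dirac // diracT mul1e.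
rewrite /pm_integrals /Rintegral integralE !pos //; last 2 first.
- by apply: measurable_funeneg; exact/measurable_EFinP.
- by apply: measurable_funepos; exact/measurable_EFinP.
under eq_bigr do rewrite funeposE -EFin_max.
under [X in (_ - X)%E]eq_bigr do rewrite funenegE -EFinN -EFin_max.
rewrite !sumEFin -EFinB /= -sumrB; apply: eq_bigr => i _.
move: (sval h (f i)) => t; rewrite !maxEle.
by case: (leP t 0) => ?; case: (leP (- t) 0) => ?; lra.
Qed.

(** The vague topology is pulled back from pointwise convergence along [pm_integrals], and the
    pointwise topology is a supremum over the test functions, so each h can be treated
    separately. *)
Lemma continuous_pm_cvg (F : pm -> R) (m_ : nat -> pm) (m : pm) : continuous F ->
  (forall h, pm_integrals (m_ n) h @[n --> \oo] --> pm_integrals m h) ->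
  F (m_ n) @[n --> \oo] --> F m.
Proof.
move=> cF hm V hV; have := cF m V hV; rewrite nbhsE => -[B [[C oC <-] /= Cm] BA].
have c : {ptws, (pm_integrals (m_ n) @[n --> \oo]) --> pm_integrals m}.
  rewrite cvg_sup => h; rewrite cvg_image; last by rewrite eqEsubset; split=> v // _; exists (cst v).
  move=> W hW; exists (@^~ h @^-1` W); first exact: hm.
  by rewrite eqEsubset; split => [j [? + <-//]|j Wj]; exists (fun _ => j).
have hC : \forall n \near \oo, C (pm_integrals (m_ n)) := c C (open_nbhs_nbhs (conj oC Cm)).
by apply: (@filterS _ _ _ _ _ _ hC) => n; exact: BA.
Qed.

End state_space.

Section poisson_process.
Context {R : realType} (d : nat) (la : R) (la0 : 0 < la).
Local Notation E := (borel_state R d).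
Local Notation cube_pt := (d.-tuple R).
Local Notation mu := (@lebesgue_cube R d : probability cube_pt R).
Local Notation Q := (poisson_law mu la0).

Definition poisson_points (w : configs cube_pt) : point_measure R d :=
  dirac_sum_pm [pred j : 'I_(tag w) | true] (fun j => torus_point (tnth (tagged w) j)).

Lemma poisson_pointsE w (A : set E) :
  poisson_points w A = (count (fun y => torus_point y \in A) (points w))%:R%:E.
Proof.
case: w => k t; rewrite /poisson_points /= /dirac_sum /points /= -sum1_count big_mkcond big_tuple natr_sum -sumEFin /=.
rewrite [RHS]big_mkcond; by apply: eq_bigr => j _; rewrite diracE; case: ifP.
Qed.

Section classes.
Variables (I : finType) (A : I -> set E).
Hypothesis mA : forall i, measurable (A i).
Hypothesis dA : forall i j x, A i x -> A j x -> i = j.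

(** Disjointness makes the index unique and [None] stands for the complement of all the sets, so
    that joint counts of points become class counts. *)
Definition cell (y : cube_pt) : option I := [pick i | torus_point y \in A i].

Lemma cellE y i : (cell y == Some i) = (torus_point y \in A i).
Proof.
rewrite /cell; case: pickP => [j /set_mem jA|no]; last by rewrite no.
apply/eqP/idP => [[<-]|/set_mem iA]; first exact/mem_set.
by congr Some; exact: dA iA.
Qed.

Lemma measurable_point_preimage (B : set E) : measurable B -> measurable [set y : cube_pt | B (torus_point y)].
Proof. by move=> mB; rewrite -[X in measurable X]setTI; exact: measurable_torus_point. Qed.

Lemma measurable_cell o : measurable [set y | cell y = o].
Proof.
have mS i : measurable [set y | cell y = Some i].
  rewrite (_ : [set y | _] = [set y | A i (torus_point y)]); first exact: measurable_point_preimage.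
  by apply/seteqP; split => y /=; [move/eqP; rewrite cellE => /set_mem|move=> h; apply/eqP; rewrite cellE; exact/mem_set].
case: o => [i|]; first exact: mS.
rewrite (_ : [set y | _] = \bigcap_(i in [set: I]) ~` [set y | cell y = Some i]).
  by apply: fin_bigcap_measurable => // i _; exact: measurableC.
apply/seteqP; split => y; first by move=> /= e i _ /=; rewrite /setC /= e.
by move=> h; case e : (cell y) => [i|//]; have := h i Logic.I; rewrite /= e.
Qed.

Lemma class_count_cell w i : class_count cell (points w) i = count (fun y => torus_point y \in A i) (points w).
Proof. by apply: eq_count => y; exact: cellE. Qed.

Lemma poisson_joint_counts (k : I -> nat) :
  Q [set w | forall i, poisson_points w (A i) = (k i)%:R%:E] =
  (\prod_i (expR (- (la * fine (lebesgue_torus0 (A i)))) *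
    ((la * fine (lebesgue_torus0 (A i))) ^+ k i / (k i)`!%:R)))%:E.
Proof.
rewrite (_ : [set w | _] = [set w | class_count cell (points w) = k]).
  apply: (etrans (poisson_class_count mu la0 k measurable_cell)); congr EFin; apply: eq_bigr => i _.
  rewrite (_ : class_prob mu cell (Some i) = fine (lebesgue_torus0 (A i))) //.
  congr (fine (_ _)); apply/seteqP; split => y /=.
    by move/eqP; rewrite cellE => /set_mem.
  by move=> h; apply/eqP; rewrite cellE; exact/mem_set.
apply/seteqP; split => w /=.
  move=> h; apply/funext => i; have := h i; rewrite poisson_pointsE => -[/eqP].
  by rewrite eqr_nat class_count_cell => /eqP.
by move=> h i; rewrite poisson_pointsE -class_count_cell h.
Qed.

End classes.

Lemma measurable_poisson_points (A : set E) : measurable A ->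
  measurable_fun setT (fun w => poisson_points w A).
Proof.
move=> mA _ Y mY; rewrite setTI; move=> k.
have mc := @measurable_cell unit (fun=> A) (fun=> mA) (fun i j _ _ _ => match i, j with tt, tt => erefl end).
have := @measurable_class_count _ cube_pt unit _ mc k (fun c => Y (c tt)%:R%:E).
rewrite (_ : [set t : k.-tuple cube_pt | _] = slice ((fun w => poisson_points w A) @^-1` Y) (k := k)) //.
have e (t : k.-tuple cube_pt) : poisson_points (existT _ k t) A = (class_count (cell (fun=> A)) t tt)%:R%:E.
  rewrite poisson_pointsE; congr (_%:R%:E); apply: esym.
  by apply: (@class_count_cell unit (fun=> A) _ (existT _ k t) tt) => -[] [].
by apply/seteqP; split => t /= h; [rewrite /slice /preimage /= e|rewrite -e].
Qed.

Lemma lebesgue_torus0_fin (A : set E) : measurable A -> lebesgue_torus0 A \is a fin_num.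
Proof. by move=> mA; apply: (@fin_num_measure _ _ _ mu); exact: measurable_point_preimage. Qed.

Lemma poisson_probE (t : R) (k : nat) : 0 <= t ->
  poisson_prob t 0%N [set k] = (expR (- t) * (t ^+ k / k`!%:R))%:E.
Proof.
rewrite le_eqVlt => /orP[/eqP <-|t0]; rewrite /poisson_prob.
  rewrite ltxx oppr0 expR0 mul1r diracE; congr EFin; case: k => [|k].
    by rewrite expr0 fact0 divr1 mem_set.
  by rewrite expr0n mul0r memNset.
by rewrite t0 esum_set1 ?lee_fin ?poisson_pmf_ge0 // /poisson_pmf t0 mulrC.
Qed.

Lemma poisson_count (A : set E) (k : nat) : measurable A ->
  Q [set w | poisson_points w A = k%:R%:E] = poisson_prob (la * fine (lebesgue_torus0 A)) 0%N [set k].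
Proof.
move=> mA; rewrite poisson_probE; last first.
  by rewrite mulr_ge0 ?(ltW la0) // fine_ge0 // (@measure_ge0 _ _ _ mu).
have := @poisson_joint_counts unit (fun=> A) (fun=> mA) (fun i j _ _ _ => match i, j with tt, tt => erefl end) (fun=> k).
rewrite big_const card_unit /= mulr1 => <-; congr (Q _).
by apply/seteqP; split => w /=; [move=> h _|move=> /(_ tt)].
Qed.

Lemma poisson_points_process (nu : set E -> \bar R) : (forall A, nu A = (la%:E * lebesgue_torus0 A)%E) ->
  poisson_point_process Q nu poisson_points.
Proof.
move=> nuE; have nu_fin A : measurable A -> fine (nu A) = la * fine (lebesgue_torus0 A).
  by move=> mA; rewrite nuE -[lebesgue_torus0 A]fineK ?lebesgue_torus0_fin.
split.
- exact: measurable_poisson_points.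
- by move=> A mA _ k; rewrite nu_fin //; exact: poisson_count.
(* The intensity has total mass la, so the value +oo is contradictory. *)
- move=> A mA; rewrite nuE -[lebesgue_torus0 A]fineK ?lebesgue_torus0_fin //.
- move=> n A mA tA k.
  have dA i j x : A i x -> A j x -> i = j by move=> Ai Aj; apply: (tA i j) => //; exists x.
  case: (pselect (forall i, exists m : nat, k i = m%:R%:E)) => [/choice[m hm]|].
    rewrite (_ : [set w | _] = [set w | forall i, poisson_points w (A i) = (m i)%:R%:E]); last first.
      by apply/seteqP; split => w /= h i; rewrite h hm.
    apply: (etrans (poisson_joint_counts mA dA m)); rewrite -prodEFin; apply: eq_bigr => i _.
    rewrite hm; apply: esym; apply: (etrans (poisson_count _ (mA i))); rewrite poisson_probE //.
    by rewrite mulr_ge0 ?(ltW la0) // fine_ge0 // (@measure_ge0 _ _ _ mu).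
  (* If some k i0 is not a natural number, the count never takes this value and both sides are 0. *)
  move=> /existsNP[i0 hi0].
  have e0 : [set w | poisson_points w (A i0) = k i0] = set0.
    by apply/seteqP; split => w //= e; apply: hi0; eexists; rewrite -e poisson_pointsE.
  rewrite (bigD1 i0) //= e0 measure0 mul0e (_ : [set w | _] = set0) ?measure0 //.
  by apply/seteqP; split => w //= /(_ i0) h; have : [set w | poisson_points w (A i0) = k i0] w by []; rewrite e0.
Qed.

End poisson_process.

(** * Discretization at mesh 1/N *)

Section boxes.
Context {R : realType}.
Implicit Types N : nat.

Definition cell_index N (t : R) : 'Z_N := (Num.floor (N%:R * t))%:~R.

Lemma measurable_cell_index N (c : 'Z_N) : (0 < N)%N -> measurable [set t : R | cell_index N t = c].
Proof.
move=> N0; have N0' : 0 < N%:R :> R by rewrite ltr0n.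
suff h m : measurable [set t : R | Num.floor (N%:R * t) = m].
  exact: (@measurable_countable_rv _ R int (fun t => Num.floor (N%:R * t)) (fun m => m%:~R = c) h).
rewrite (_ : [set t | _] = `[m%:~R / N%:R, (m + 1)%:~R / N%:R[%classic); first exact: measurable_itv.
apply/seteqP; split => t /=; rewrite in_itv /=.
  by move=> <-; rewrite ler_pdivrMr // ltr_pdivlMr // mulrC floor_le_tmp floorD1_gt.
move=> /andP[h1 h2]; apply: floor_def.
by rewrite mulrC -ler_pdivrMr // h1 -ltr_pdivlMr.
Qed.

(** Each class contains a half-open interval of length 1/N in [0, 1], hence has probability at least
    1/N; as there are N classes and the total is 1, equality holds. The endpoint 1 and the
    wrap-around need no discussion. *)
Lemma uniform_cell_index N (c : 'Z_N) : (1 < N)%N ->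
  uniform_prob (@ltr01 R) [set t | cell_index N t = c] = (N%:R^-1)%:E.
Proof.
move=> N1; have N0 : (0 < N)%N by exact: ltnW.
have N0' : 0 < N%:R :> R by rewrite ltr0n.
pose P := uniform_prob (@ltr01 R).
have mc b := measurable_cell_index b N0.
have cN : #|{: 'Z_N}| = N by rewrite card_ord Zp_cast.
have lo b : ((N%:R^-1)%:E <= P [set t | cell_index N t = b])%E.
  pose J : set R := `[(b : nat)%:R / N%:R, (b : nat).+1%:R / N%:R[%classic.
  have bN : ((b : nat) < N)%N by rewrite -{2}(Zp_cast N1).
  have mJ : measurable J by exact: measurable_itv.
  have PJ : P J = (N%:R^-1)%:E.
    rewrite /P /uniform_prob (eq_integral (fun=> 1%E)).
      apply: (etrans (@integral_cst _ (measurableTypeR R) R lebesgue_measure J mJ 1%E)); rewrite mul1e; apply: (etrans (lebesgue_measure_itv `[(b : nat)%:R / N%:R, (b : nat).+1%:R / N%:R[)); rewrite /= lte_fin.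
      rewrite ltr_pM2r ?invr_gt0 // ltr_nat ltnSn -EFinB; congr EFin.
      by rewrite -mulrBl -natrB // subSnn mul1r.
    move=> x; rewrite inE /J /= in_itv /= => /andP[h1 h2]; rewrite /uniform_pdf subr0 invr1.
    rewrite (_ : 0 <= x <= 1) //; apply/andP; split; first by apply: le_trans h1; rewrite divr_ge0.
    by apply: (le_trans (ltW h2)); rewrite ler_pdivrMr // mul1r ler_nat.
  rewrite -PJ; apply: le_measure; rewrite ?inE //; first exact: mc.
  move=> t; rewrite /J /= in_itv /= => /andP[h1 h2].
  rewrite /cell_index (@floor_def _ _ (b : nat)%:Z); first by rewrite -pmulrn natr_Zp.
  by rewrite mulrC -ler_pdivrMr // h1 -ltr_pdivlMr // intrD natr1.
have tot : (\sum_(b : 'Z_N) P [set t | cell_index N t = b] = 1)%E.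
  have := sum_prob_fiber P (enum_uniq {: 'Z_N}) mc measurableT.
  rewrite (_ : setT `&` _ = setT) ?probability_setT; last first.
    by rewrite setTI; apply/seteqP; split => y //= _; rewrite mem_enum.
  by rewrite big_enum /=; under eq_bigr do rewrite setTI.
have fK b : P [set t | cell_index N t = b] = (fine (P [set t | cell_index N t = b]))%:E.
  by apply: esym; apply: fineK; apply: fin_num_measure; exact: mc.
have lo' b : N%:R^-1 <= fine (P [set t | cell_index N t = b]) by rewrite -lee_fin -fK.
have : \sum_(b : 'Z_N) (fine (P [set t | cell_index N t = b]) - N%:R^-1) = 0.
  rewrite sumrB sumr_const cN -[_ *+ N]mulr_natr mulVf ?gt_eqF //; apply/eqP; rewrite subr_eq0; apply/eqP.
  by apply: EFin_inj; rewrite -sumEFin -tot; apply: eq_bigr => b _; rewrite -fK.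
move/eqP; rewrite psumr_eq0; last by move=> b _; rewrite subr_ge0.
move=> /allP /(_ c (mem_index_enum _)) /= /eqP /subr0_eq e.
by rewrite -/P fK e.
Qed.

Lemma lebesgue_cube_rect n (E : 'I_n -> set R) : (forall i, measurable (E i)) ->
  lebesgue_cube R n [set s | forall i, E i (tnth s i)] = (\prod_i uniform_prob (@ltr01 R) (E i))%E.
Proof.
elim: n E => [|n IH] E mE.
  by rewrite big_ord0 /= diracE mem_set // => -[].
rewrite big_ord_recl -IH // /= /distribution /pushforward.
rewrite (_ : _ @^-1` _ = E ord0 `*` [set s : n.-tuple R | forall i, E (lift ord0 i) (tnth s i)]).
  rewrite product_measure1E //; first exact: mE.
  rewrite (_ : [set s | _] = \bigcap_(i in [set: 'I_n]) ((fun s : n.-tuple R => tnth s i) @^-1` E (lift ord0 i))).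
    apply: fin_bigcap_measurable => // i _; rewrite -[X in measurable X]setTI.
    by apply: measurable_tnth => //; exact: mE.
  by apply/seteqP; split => s h i; [move=> _|]; apply: h.
apply/seteqP; split => -[t s] /=.
  move=> h; split; first exact: (h ord0).
  by move=> i; have := h (lift ord0 i); rewrite /cube_cons /= tnthS.
by move=> [h0 h] i; case: (unliftP ord0 i) => [j|] ->; rewrite /cube_cons /= ?tnthS.
Qed.

Variable d : nat.

Definition box_of N (y : d.-tuple R) : torus d N := \row_i cell_index N (tnth y i).

Lemma box_ofE N (b : torus d N) : [set y | box_of N y = b] =
  [set y | forall i, [set t | cell_index N t = b 0 i] (tnth y i)].
Proof.
apply/seteqP; split => y /=; first by move=> <- i /=; rewrite mxE.
by move=> h; apply/rowP => i; rewrite mxE; exact: h.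
Qed.

Lemma measurable_box_of N (b : torus d N) : (0 < N)%N -> measurable [set y : d.-tuple R | box_of N y = b].
Proof.
move=> N0; rewrite box_ofE.
rewrite (_ : [set y | _] = \bigcap_(i in [set: 'I_d]) ((fun s : d.-tuple R => tnth s i) @^-1` [set t | cell_index N t = b 0 i])).
  apply: fin_bigcap_measurable => // i _; rewrite -[X in measurable X]setTI.
  by apply: measurable_tnth => //; exact: measurable_cell_index.
by apply/seteqP; split => s h i; [move=> _|]; apply: h.
Qed.

Lemma lebesgue_box N (b : torus d N) : (1 < N)%N ->
  lebesgue_cube R d [set y | box_of N y = b] = ((N%:R ^+ d)^-1)%:E.
Proof.
move=> N1; rewrite box_ofE.
apply: (etrans (@lebesgue_cube_rect d (fun i => [set t | cell_index N t = b 0 i]) _)).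
  by move=> i; apply: measurable_cell_index; exact: ltnW.
under eq_bigr do rewrite uniform_cell_index //.
by rewrite prodEFin prodr_const card_ord exprVn.
Qed.

End boxes.

(** * Factorial moments of the occupied boxes *)

Section poisson_moments.
Context {R : realType} (T : finType) (la : R).
Hypothesis la0 : 0 < la.
Local Notation n := (#|T|%:R : R).
Hypothesis n_ge2la : 2 * la <= n.

(* Law of the set of occupied sites when la points fall on average, uniformly over T. *)
Definition occupation_law (A : {set T}) : R := expR (- la) * (la / n) ^+ #|A|.

(** Binomial theorem over the sites outside B. *)
Lemma occupation_superset (B : {set T}) :
  superset_mass occupation_law B = expR (- la) * (la / n) ^+ #|B| * (1 + la / n) ^+ (#|T| - #|B|).
Proof.
rewrite /superset_mass.
transitivity (\sum_(C : {set T} | [&& B \subset C, C \subset [set: T]%SET & predT #|C|]) occupation_law C).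
  by apply: eq_bigl => C; rewrite finset.subsetT !andbT.
rewrite (subsets_above predT (fun k => expR (- la) * (la / n) ^+ k) (finset.subsetT B)).
under eq_bigl do rewrite andbT.
under eq_bigr do rewrite exprD mulrA.
rewrite -mulr_sumr sum_subset_exp; congr (_ * _ ^+ _).
by rewrite finset.cardsD finset.setTI finset.cardsT.
Qed.

Let r := la / n.
Let n0 : 0 < n. Proof. by apply: lt_le_trans n_ge2la; rewrite mulr_gt0. Qed.
Let r0 : 0 < r. Proof. exact: divr_gt0. Qed.

Let weight_le1 m : expR (- la) * (1 + r) ^+ (#|T| - m) <= 1.
Proof.
have h : (1 + r) ^+ (#|T| - m) <= expR la.
  apply: le_trans (_ : (1 + r) ^+ #|T| <= _).
    by apply: ler_weXn2l; [rewrite lerDl ltW|rewrite leq_subr].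
  apply: le_trans (_ : expR r ^+ #|T| <= _).
    by apply: lerXn2r; rewrite ?nnegrE ?expR_ge0 ?expR_ge1Dx // addr_ge0 // ltW.
  by rewrite -expRM_natr /r divfK // gt_eqF.
by rewrite -[leRHS](_ : expR (- la) * expR la = 1) ?ler_pM2l ?expR_gt0 // -expRD addNr expR0.
Qed.

(** Rests on exp(r - r^2) <= 1 + r for 0 < r <= 1/2, the range secured by 2 la <= n; since r n = la,
    the defect is of order 1/n. *)
Let weight_ge m : 1 - (r * (la + m%:R)) <= expR (- la) * (1 + r) ^+ (#|T| - m).
Proof.
have h1 : expR (r - r ^+ 2) <= 1 + r.
  have : 1 - (r - r ^+ 2) <= expR (- (r - r ^+ 2)) by exact: expR_ge1Dx.
  rewrite expRN => h2.
  have r1 : r <= 2^-1 by rewrite /r ler_pdivrMr // mulrC ler_pdivlMr // mulrC.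
  have p0 : 0 < 1 - (r - r ^+ 2) by move: r0 r1; nra.
  have := lef_pV2 (x := (expR (r - r ^+ 2))^-1) (y := 1 - (r - r^+2)).
  rewrite !posrE p0 invr_gt0 expR_gt0 invrK => /(_ isT isT); rewrite h2 => h3.
  apply: le_trans h3 _; rewrite -[leLHS]mul1r ler_pdivrMr //.
  by move: r0 r1; nra.
have hm : expR ((r - r ^+ 2) *+ (#|T| - m)) <= (1 + r) ^+ (#|T| - m).
  by rewrite -mulr_natr expRM_natr; apply: lerXn2r; rewrite ?nnegrE ?expR_ge0 // addr_ge0 // ltW.
have : expR (- la + (r - r ^+ 2) *+ (#|T| - m)) <= expR (- la) * (1 + r) ^+ (#|T| - m).
  by rewrite expRD ler_pM2l ?expR_gt0.
apply: le_trans; apply: le_trans (expR_ge1Dx _); rewrite lerD2l -[_ *+ (_ - _)]mulr_natr.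
have rn : r * n = la by rewrite /r divfK // gt_eqF.
have r1 : r <= 2^-1 by rewrite /r ler_pdivrMr // mulrC ler_pdivlMr // mulrC.
have : n - m%:R <= (#|T| - m)%N%:R by rewrite lerBlDr -natrD ler_nat addnC -leq_subLR.
move=> hs.
have : (r - r ^+ 2) * (n - m%:R) <= (r - r ^+ 2) * (#|T| - m)%N%:R.
  by apply: ler_wpM2l => //; move: r0 r1; nra.
have m0 : 0 <= m%:R :> R by [].
have e : (r - r ^+ 2) * (n - m%:R) = la - r * la - (r - r ^+ 2) * m%:R by rewrite -{1 2}rn; ring.
rewrite e.
have : 0 <= r ^+ 2 * m%:R by rewrite mulr_ge0 // sqr_ge0.
move: (_%N%:R) => s; lra.
Qed.

Lemma occupation_moments m :
  \sum_(B : {set T} | #|B| == m) `|superset_mass occupation_law B - (la / n) ^+ m| <= la ^+ m * (la * (la + m%:R)) / n.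
Proof.
have hB (B : {set T}) : #|B| == m -> `|superset_mass occupation_law B - r ^+ m| <= r ^+ m * (r * (la + m%:R)).
  move=> /eqP Bm; rewrite occupation_superset Bm -/r.
  rewrite (_ : _ - _ = r ^+ m * (expR (- la) * (1 + r) ^+ (#|T| - m) - 1)); last by ring.
  rewrite normrM ger0_norm ?exprn_ge0 ?(ltW r0) // ler_pM2l ?exprn_gt0 // ler0_norm ?subr_le0 //.
  by rewrite opprB; have := weight_ge m; move: (_ * _ ^+ _) (_ * (_ + _)) => s t; rewrite !lerBlDr addrC.
apply: le_trans (ler_sum _ hB) _.
rewrite sumr_const.
have -> : #|[pred B : {set T} | #|B| == m]| = 'C(#|T|, m).
  rewrite -finset.cardsT -cards_draws cardsE; apply: eq_card => B.
  by rewrite /in_mem /= /in_mem /= finset.subsetT.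
rewrite -[_ *+ 'C(_, _)]mulr_natr -[leRHS](_ : r ^+ m * (r * (la + m%:R)) * n ^+ m = _).
  apply: ler_wpM2l; first by rewrite !mulr_ge0 ?exprn_ge0 ?addr_ge0 // ltW.
  rewrite -natrX ler_nat; apply: leq_trans (bin_mul_fact_le #|T| m).
  by rewrite leq_pmulr // fact_gt0.
rewrite mulrAC -exprMn /r divfK ?gt_eqF //.
by rewrite [in LHS]mulrAC !mulrA.
Qed.

Lemma occupation_law_ge0 A : 0 <= occupation_law A.
Proof. by rewrite mulr_ge0 ?expR_ge0 // exprn_ge0 // divr_ge0 // ltW. Qed.

End poisson_moments.

Section fiberwise_expectation.
Context {disp} {Om : measurableType disp} {R : realType} (P : probability Om R).
Variables (f : Om -> R) (B : R).
Hypotheses (mf : measurable_fun setT f) (fB : forall w, `|f w| <= B).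

Lemma integrable_bounded A : measurable A -> P.-integrable A (EFin \o f).
Proof.
move=> mA; apply: measurable_bounded_integrable => //.
- by apply: le_lt_trans (probability_le1 P mA) _; rewrite ltry.
- exact: measurable_funS mf.
- exists B; split; first exact: num_real.
  by move=> y By w _ /=; apply: le_trans (fB w) (ltW By).
Qed.

Lemma expectation_bounded_fin_num : ('E_P[f] \is a fin_num)%E.
Proof. by rewrite unlock; apply: integrable_fin_num => //; exact: integrable_bounded. Qed.

Variables (V : finType) (Y : Om -> option V).
Hypothesis mY : forall o, measurable [set w | Y w = o].

Lemma sum_prob_option (p : option V -> R) : \sum_o p o = p None + \sum_v p (Some v).
Proof.
rewrite (bigD1 None) //=; congr (_ + _).
rewrite (@reindex_omap _ _ _ _ _ Some id) /=; last by case.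
by apply: eq_bigl => v; rewrite eqxx.
Qed.

(** On the fibres over [Some v] the variable is constant; on the fibre over [None] only the bound B
    is known, and its probability is exactly the missing mass. *)
Lemma expectation_fiber_dist (G : V -> R) : (forall w v, Y w = Some v -> f w = G v) ->
  `|fine 'E_P[f]%E - \sum_v fine (P [set w | Y w = Some v]) * G v| <=
  B * (1 - \sum_v fine (P [set w | Y w = Some v])).
Proof.
move=> hG; pose F o : set Om := [set w | Y w = o].
have D : setT = \big[setU/set0]_(o <- index_enum (option V)) F o.
  by rewrite -bigcup_seq; apply/seteqP; split => // w _; exists (Y w) => //=; exact: mem_index_enum.
have EF : 'E_P[f]%E = (\sum_o (\int[P]_(w in F o) f w)%:E)%E.
  rewrite unlock D integral_bigsetU_EFin //.
  - by apply: eq_bigr => v _; rewrite fineK //; apply: integrable_fin_num; [exact: mY|apply: integrable_bounded; exact: mY].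
  - exact: index_enum_uniq.
  - by move=> u v _ _ [w [] ]; rewrite /F /= => -> ->.
  - by rewrite -D; exact/measurable_EFinP.
have FG v : \int[P]_(w in F (Some v)) f w = fine (P [set w | Y w = Some v]) * G v.
  transitivity (\int[P]_(w in F (Some v)) G v).
    by apply: eq_Rintegral => w; rewrite inE /F /= => e; rewrite (hG _ _ e).
  by rewrite mulrC; exact: (Rintegral_cst P (mY (Some v))).
have tot : 1 - \sum_v fine (P [set w | Y w = Some v]) = fine (P (F None)).
  apply/eqP; rewrite subr_eq -(sum_prob_option (fun o => fine (P (F o)))) eq_sym; apply/eqP.
  apply: EFin_inj; rewrite -sumEFin -(probability_setT P).
  have := sum_prob_fiber P (index_enum_uniq (option V)) mY measurableT.
  rewrite (_ : setT `&` _ = setT); last first.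
    by rewrite setTI; apply/seteqP; split => w //= _; exact: mem_index_enum.
  by move=> <-; apply: eq_bigr => o _; rewrite setTI fineK // fin_num_measure //; exact: mY.
rewrite EF sumEFin /= sum_prob_option (eq_bigr _ (fun v _ => FG v)) addrK tot.
have iF : P.-integrable (F None) (EFin \o f) by apply: integrable_bounded; exact: mY.
apply: le_trans (le_normr_Rintegral _ iF) _; first exact: mY.
rewrite -(Rintegral_cst P (mY None)).
apply: le_Rintegral => //; first exact: mY.
- exact: integrable_norm iF.
- by apply: finite_measure_integrable_cst; exact: mY.
Qed.

End fiberwise_expectation.

Section discretization.
Context {R : realType} (d : nat).
Local Notation E := (borel_state R d).
Local Notation pm := (point_measure R d).
Local Notation cube_pt := (d.-tuple R).
Implicit Types (N : nat) (w : configs cube_pt).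

Lemma sum_by_class (S : Type) (I : finType) (c : S -> I) (s : seq S) (g : I -> R) :
  \sum_(y <- s) g (c y) = \sum_i (count (fun y => c y == i) s)%:R * g i.
Proof.
elim: s => [|y s IH]; first by rewrite big_nil big1 // => i _; rewrite mul0r.
rewrite big_cons IH; under [RHS]eq_bigr do rewrite /= natrD mulrDl.
rewrite big_split /=; congr (_ + _).
rewrite (bigD1 (c y)) //= eqxx mul1r big1 ?addr0 // => i /negbTE.
by rewrite eq_sym => ->; rewrite mul0r.
Qed.

Lemma eq_mod_Z (s t : R) : s - t \is a Num.int -> mod_Z s = mod_Z t.
Proof. by move=> h; apply/eqmodP; rewrite /= Quotient.equivE. Qed.

Lemma Zp_int_lift N (m : int) : (1 < N)%N -> exists k : int, ((m%:~R : 'Z_N) : nat)%:Z = m + k * N%:Z.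
Proof.
move=> N1; exists (- (m %/ N%:Z)%Z).
have N0 : N%:Z != 0 by rewrite -lt0n ltnW.
have e := divz_eq m N%:Z.
have r0 := modz_ge0 m N0.
have rN : (m %% N%:Z)%Z < N%:Z by apply: ltz_pmod; rewrite ltz_nat ltnW.
have -> : (m%:~R : 'Z_N) = `|(m %% N%:Z)%Z|%N%:R.
  rewrite {1}e intrD intrM -[N%:Z%:~R]pmulrn pchar_Zp // mulr0 add0r.
  by rewrite -{1}(gez0_abs r0) -pmulrn.
rewrite val_Zp_nat // modn_small; last by rewrite -ltz_nat gez0_abs.
by rewrite gez0_abs // {2}e mulNr addrAC subrr add0r.
Qed.

Definition grid_point N (y : cube_pt) : cube_pt :=
  [tuple (Num.floor (N%:R * tnth y i))%:~R / N%:R | i < d].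

(** The floor and its representative in Z/N differ by a multiple of N, hence by an integer after
    division by N, which vanishes in R/Z. *)
Lemma rescale_box N y : (1 < N)%N -> rescale R (at_zero (box_of N y)) = torus_point (grid_point N y).
Proof.
move=> N1; rewrite /rescale /torus_point /at_zero /=; congr (_, _); last by rewrite mul0r.
apply/rowP => i; rewrite !mxE tnth_mktuple; apply: eq_mod_Z.
have [k hk] := Zp_int_lift (Num.floor (N%:R * tnth y i)) N1.
have N0 : N%:R != 0 :> R by rewrite pnatr_eq0 -lt0n ltnW.
by rewrite -mulrBl /cell_index [X in X - _]pmulrn hk intrD addrAC subrr add0r intrM -pmulrn mulfK //.
Qed.

Lemma cvg_grid_point y i : tnth (grid_point n.+2 y) i @[n --> \oo] --> tnth y i.
Proof.
apply/subr_cvg0; apply: cvg_bounded_by (@cvg_harmonic R); apply: nearW => n.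
rewrite tnth_mktuple; have n0 : 0 < n.+2%:R :> R by [].
have h1 := floor_le_tmp (n.+2%:R * tnth y i); have h2 := floorD1_gt (n.+2%:R * tnth y i).
rewrite intrD in h2; move: (Num.floor _)%:~R h1 h2 => m h1 h2.
apply: le_trans (_ : n.+2%:R^-1 <= _); last by rewrite lef_pV2 ?posrE // ler_nat.
rewrite -[X in _ - X](mulKf (lt0r_neq0 n0)) mulrC -mulrBr normrM gtr0_norm ?invr_gt0 //.
rewrite -[leRHS]mulr1 ler_pM2l ?invr_gt0 // ler_norml.
by apply/andP; split; lra.
Qed.

Definition grid_points N w : pm :=
  dirac_sum_pm [pred j : 'I_(tag w) | true] (fun j => rescale R (at_zero (box_of N (tnth (tagged w) j)))).

Definition site_points N (A : {set torus d N}) : pm :=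
  dirac_sum_pm (mem A) (fun b => rescale R (at_zero b)).

(** [None] signals two points in one box. The law of the remaining values is thus a sub-probability,
    whose defect is the chance of such a coincidence. *)
Definition occupied N w : option {set torus d N} :=
  let c := class_count (fun y => Some (box_of N y)) (points w) in
  if [forall b, (c b <= 1)%N] then Some [set b | (0 < c b)%N]%SET else None.

Lemma occupied_SomeE N w A : occupied N w = Some A <->
  class_count (fun y => Some (box_of N y)) (points w) = fun b => (b \in A : nat).
Proof.
rewrite /occupied; set c := class_count _ _; split.
  case: ifP => // /forallP c1 [<-]; apply/funext => b; rewrite inE.
  by have := c1 b; case: (c b) => [|[|n] ].
move=> e; rewrite e; case: ifP => [_|/negbT/forallPn[b] ]; last by case: (b \in A).
by congr Some; apply/setP => b; rewrite inE; case: (b \in A).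
Qed.

Lemma measurable_occupied N o : (0 < N)%N -> measurable [set w | occupied N w = o].
Proof.
move=> N0; have mc (o' : option (torus d N)) : measurable [set y : cube_pt | Some (box_of N y) = o'].
  case: o' => [b|]; last by rewrite (_ : [set y | _] = set0) //; apply/seteqP; split.
  rewrite (_ : [set y | _] = [set y | box_of N y = b]); first exact: measurable_box_of.
  by apply/seteqP; split => y /= [->].
move=> k; exact: (measurable_class_count mc (fun c =>
  (if [forall b, (c b <= 1)%N] then Some [set b | (0 < c b)%N]%SET else None) = o)).
Qed.

(** The constant sequence m also converges vaguely to m', and limits of F in R are unique; no
    theorem identifying a measure from its integrals is called upon. *)
Lemma pm_integrals_inj (F : pm -> R) (m m' : pm) : continuous F ->
  (forall h, pm_integrals m h = pm_integrals m' h) -> F m = F m'.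
Proof.
move=> cF e; have c : F m @[_ --> \oo] --> F m'.
  by apply: (@continuous_pm_cvg _ _ F (fun=> m) m' cF) => h; rewrite e; exact: cvg_cst.
have c' : F m @[_ --> \oo] --> F m by exact: cvg_cst.
exact: (@cvg_unique _ (@Rhausdorff R) (F m @[_ --> \oo]) _ _ _ c' c).
Qed.

Lemma grid_points_integral N w h : pm_integrals (grid_points N w) h =
  \sum_(y <- points w) sval h (rescale R (at_zero (box_of N y))).
Proof. by rewrite dirac_sum_integral big_tuple. Qed.

Lemma grid_points_occupied (F : pm -> R) N w A : continuous F -> occupied N w = Some A ->
  F (grid_points N w) = F (site_points A).
Proof.
move=> cF /occupied_SomeE e; apply: pm_integrals_inj => // h.
rewrite grid_points_integral dirac_sum_integral (sum_by_class (box_of N) _ (fun b => sval h (rescale R (at_zero b)))).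
rewrite [RHS]big_mkcond; apply: eq_bigr => b _.
have -> : mem A b = (b \in A) by [].
rewrite (_ : count _ _ = (b \in A : nat)); last by rewrite -[RHS](congr1 (fun c => c b) e).
by case: (b \in A); rewrite ?mul1r ?mul0r.
Qed.

(** Point measures carry no sigma-algebra here, but on samples of a given length the grid process
    takes finitely many values, so any F will do. For continuous F the Poisson process inherits
    measurability as a pointwise limit. *)
Lemma measurable_grid_points (F : pm -> R) N : (0 < N)%N -> measurable_fun setT (fun w => F (grid_points N w)).
Proof.
move=> N0 _ U mU; rewrite setTI; move=> k.
pose D (s : k.-tuple (torus d N)) : pm := dirac_sum_pm [pred j : 'I_k | true] (fun j => rescale R (at_zero (tnth s j))).
rewrite (_ : @slice _ _ _ k = [set t | U (F (D (map_tuple (box_of N) t)))]); last first.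
  rewrite /slice /preimage; apply/funext => t /=; congr (U (F _)).
  by rewrite /grid_points /D /=; congr dirac_sum_pm; apply/funext => j; rewrite tnth_map.
suff h s : measurable [set t : k.-tuple cube_pt | map_tuple (box_of N) t = s].
  exact: (@measurable_countable_rv _ _ (k.-tuple (torus d N)) (map_tuple (box_of N)) (fun s => U (F (D s))) h).
rewrite (_ : [set t | _] = \bigcap_(j in [set: 'I_k]) ((fun t : k.-tuple cube_pt => tnth t j) @^-1` [set y | box_of N y = tnth s j])).
  apply: fin_bigcap_measurable => // j _; rewrite -[X in measurable X]setTI.
  by apply: measurable_tnth => //; exact: measurable_box_of.
apply/seteqP; split => t /= => [<- j _|h]; first by rewrite /= tnth_map.
by apply: eq_from_tnth => j; rewrite tnth_map; exact: h.
Qed.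

(** For fixed w there are finitely many points and each coordinate moves by at most 1/N, so the
    integral of a continuous function converges. The shift by 2 keeps N > 1. *)
Lemma cvg_grid_points (F : pm -> R) w : continuous F ->
  F (grid_points n.+2 w) @[n --> \oo] --> F (poisson_points w).
Proof.
move=> cF; apply: continuous_pm_cvg => // h; rewrite /poisson_points dirac_sum_integral.
under eq_cvg do rewrite dirac_sum_integral.
apply: (@cvg_big _ _ +%R 0 _ add_continuous) => j _.
under eq_cvg do rewrite rescale_box //.
by apply: cvg_torus_point; [exact: (svalP h).1|exact: cvg_grid_point].
Qed.

Variables (la : R) (la0 : 0 < la).
Local Notation mu := (@lebesgue_cube R d : probability cube_pt R).
Local Notation Q := (poisson_law mu la0).

Lemma prob_occupied N (A : {set torus d N}) : (1 < N)%N ->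
  fine (Q [set w | occupied N w = Some A]) = occupation_law la A.
Proof.
move=> N1; have N0 : N%:R != 0 :> R by rewrite pnatr_eq0 -lt0n ltnW.
have cT : #|{: torus d N}|%:R = N%:R ^+ d :> R by rewrite card_torus // natrX.
have mb b : measurable [set y : cube_pt | box_of N y = b] by apply: measurable_box_of; exact: ltnW.
have e b : [set y : cube_pt | Some (box_of N y) = Some b] = [set y | box_of N y = b].
  by apply/seteqP; split => y /= [->].
have mc (o : option (torus d N)) : measurable [set y : cube_pt | Some (box_of N y) = o].
  case: o => [b|]; first by rewrite e.
  by rewrite (_ : [set y | _] = set0) //; apply/seteqP; split.
rewrite (_ : [set w | _] = [set w | class_count (fun y => Some (box_of N y)) (points w) = fun b => (b \in A : nat)]); last first.
  by apply/seteqP; split => w /= /occupied_SomeE.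
have := poisson_class_count mu la0 (fun b => (b \in A : nat)) mc => ->.
have pb b : class_prob mu (fun y => Some (box_of N y)) (Some b) = #|{: torus d N}|%:R^-1.
  by rewrite /class_prob e lebesgue_box //= cT.
under eq_bigr do rewrite pb.
rewrite /= big_split /= prodr_const -expRM_natr mulNr divfK; last by rewrite cT expf_neq0.
congr (_ * _); transitivity (\prod_(b : torus d N) (la / #|{: torus d N}|%:R) ^+ (b \in A)).
  by apply: eq_bigr => b _; case: (b \in A); rewrite ?fact0 divr1.
by rewrite prodrXr -sum1_card [in RHS]big_mkcond; congr (_ ^+ _); apply: eq_bigr => b _; case: (b \in A).
Qed.

Lemma cvg_expectation_grid (F : pm -> R) (B : R) : continuous F -> (forall m, `|F m| <= B) ->
  fine 'E_Q[fun w => F (grid_points n.+2 w)] @[n --> \oo] --> fine 'E_Q[fun w => F (poisson_points w)] /\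
  ('E_Q[fun w => F (poisson_points w)] \is a fin_num)%E.
Proof.
move=> cF FB; have cg w := @cvg_grid_points F w cF.
have mg n := measurable_grid_points F (isT : (0 < n.+2)%N).
have mp : measurable_fun setT (fun w => F (poisson_points w)) by apply: measurable_fun_cvg mg _ => w _; exact: cg.
have fn : ('E_Q[fun w => F (poisson_points w)] \is a fin_num)%E.
  by apply: expectation_bounded_fin_num mp _ => w; exact: FB.
split=> //; apply: fine_cvg; rewrite fineK // unlock.
have [|||||_ _ +] := @dominated_convergence _ _ _ Q setT measurableT
  (fun n w => (F (grid_points n.+2 w))%:E) (fun w => (F (poisson_points w))%:E) (fun=> B%:E).
- by move=> n; apply/measurable_EFinP; exact: mg.
- exact/measurable_EFinP.
- by apply: aeW => w _; apply: cvg_EFin; [exact: nearW|exact: cg].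
- exact: finite_measure_integrable_cst.
- by apply: aeW => w n _; rewrite lee_fin; exact: FB.
by move=> h; exact: h.
Qed.

End discretization.

(** * Convergence in law *)

Section coupling.
Context {R : realType} (d : nat) (d2 : (2 <= d)%N) (z : R).
Context (disp : nat -> measure_display) (Om : forall N : nat, measurableType (disp N))
  (P : forall N : nat, probability (Om N) R) (X : forall N : nat, nat -> Om N -> cylinder d N).
Arguments X : clear implicits.
Hypothesis hX : forall N : nat, (2 <= N)%N ->
  is_srw (@cylinder_nbrs d N) (P N) (@uniform_zero_level R d N) (X N).
Local Notation la := (expR (- z)).
Local Notation mu := (@lebesgue_cube R d : probability (d.-tuple R) R).
Local Notation Q := (poisson_law mu (expR_gt0 (- z))).
Local Notation pm := (point_measure R d).

Definition late N (w : Om N) : {set torus d N} := late_set z (X N ^~ w).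

(** Written with [Some] to fit [expectation_fiber_dist]; the fibre over [None] is empty here. *)
Definition late_law N (A : {set torus d N}) : R := fine (P N [set w | Some (late w) = Some A]).

Let late_law_ge0 N (A : {set torus d N}) : 0 <= late_law A.
Proof. exact: fine_ge0. Qed.

Let large : \forall N \near \oo, [/\ (2 < N)%N, 0 <= cover_level d z N & (0 < visits d z N)%N].
Proof.
near=> N.
have [_ [h1 [h2 _] ] ] : cover_level d z N - 2 <= (visits d z N)%:R /\ (visits d z N)%:R <= cover_level d z N /\
    (0 < visits d z N)%N /\ 0 <= ln (N%:R ^+ d : R) + z by near: N; exact: visits_bounds.
split=> //; first by near: N; exact: nbhs_infty_gt.
by apply: le_trans h1.
Unshelve. all: by end_near. Qed.

Let measurable_some_late N o : (2 < N)%N -> 0 <= cover_level d z N ->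
  measurable [set w : Om N | Some (late w) = o].
Proof.
move=> N3 c0; case: o => [A|]; last by rewrite (_ : [set w | _] = set0) //; apply/seteqP; split.
rewrite (_ : [set w | _] = [set w | late_set z (X N ^~ w) = A]).
  exact: (measurable_late d2 N3 c0 (hX (ltnW N3)) A).
by apply/seteqP; split => w /= h; [case: h|congr Some].
Qed.

Lemma late_law_superset N (B : {set torus d N}) : (2 < N)%N -> 0 <= cover_level d z N -> (0 < visits d z N)%N ->
  superset_mass (@late_law N) B = avoid_prob B (visits d z N).
Proof.
move=> N3 c0 v0; apply: EFin_inj; rewrite -(prob_late_superset d2 N3 c0 v0 (hX (ltnW N3)) B).
have mL A : measurable [set w : Om N | late w = A] by exact: (measurable_late d2 N3 c0 (hX (ltnW N3)) A).
rewrite /superset_mass -sumEFin -big_filter.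
have := sum_prob_fiber (P N) (filter_uniq (fun A : {set torus d N} => B \subset A) (index_enum_uniq _)) mL measurableT.
rewrite setTI (_ : [set w | late w \in _] = [set w | B \subset late_set z (X N ^~ w)]); last first.
  by apply/seteqP; split => w /=; rewrite mem_filter mem_index_enum andbT.
move=> <-; apply: eq_bigr => A _; rewrite setTI /late_law fineK.
  by congr (P N _); apply/seteqP; split => w /= h; [case: h|congr Some].
by rewrite fin_num_measure //; exact: measurable_some_late.
Qed.

Let card_gt N : (1 < N)%N -> (N <= #|{: torus d N}|)%N.
Proof. by move=> N1; rewrite card_torus // -{1}(expn1 N) leq_pexp2l // ltnW. Qed.

Let late_moments m :
  \sum_(B : {set torus d N} | #|B| == m) `|superset_mass (@late_law N) B - (la / #|{: torus d N}|%:R) ^+ m|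
    @[N --> \oo] --> (0 : R).
Proof.
apply: cvg_trans (cvg_moments d2 z m); apply: near_eq_cvg; near=> N.
have [N3 c0 v0] : [/\ (2 < N)%N, 0 <= cover_level d z N & (0 < visits d z N)%N] by near: N; exact: large.
by apply: eq_bigr => B _; rewrite late_law_superset // card_torus ?natrX // ltnW.
Unshelve. all: by end_near. Qed.

Let poisson_moments m :
  \sum_(B : {set torus d N} | #|B| == m)
    `|superset_mass (@occupation_law R (torus d N) la) B - (la / #|{: torus d N}|%:R) ^+ m|
    @[N --> \oo] --> (0 : R).
Proof.
pose C := la ^+ m * (la * (la + m%:R)).
have C0 : 0 <= C by rewrite !mulr_ge0 ?exprn_ge0 ?addr_ge0 ?expR_ge0.
apply: (@cvg_bounded_by _ _ (fun N => C * N%:R^-1)); last first.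
  rewrite (_ : nbhs (0 : R) = nbhs (C * 0 : R)); last by rewrite mulr0.
  by apply: cvgMr; rewrite -cvg_shiftS; exact: cvg_harmonic.
near=> N.
have N1 : (1 < N)%N by near: N; exact: nbhs_infty_gt.
have nN : N%:R <= #|{: torus d N}|%:R :> R by rewrite ler_nat card_gt.
have N2 : 2 * la <= N%:R by near: N; exact: nbhs_infty_ger.
rewrite ger0_norm; last by apply: sumr_ge0.
apply: le_trans (occupation_moments (expR_gt0 _) (le_trans N2 nN) m) _.
rewrite -/C ler_wpM2l // lef_pV2 ?posrE ?ltr0n ?(ltnW N1) //.
by apply: leq_trans (card_gt N1); exact: ltnW.
Unshelve. all: by end_near. Qed.

Lemma cvg_late_occupation :
  \sum_(A : {set torus d N}) `|late_law A - occupation_law la A| @[N --> \oo] --> (0 : R).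
Proof.
apply: (@cvg_total_variation R (fun N => torus d N) la (expR_ge0 _) (@late_law)
  (fun N => @occupation_law R (torus d N) la)) => //.
- by move=> N A; exact: occupation_law_ge0 (expR_gt0 _) A.
- by near=> N; rewrite ltr0n (leq_trans _ (card_gt _)) //; near: N; [exact: nbhs_infty_gt|exact: nbhs_infty_gt].
Unshelve. all: by end_near. Qed.

(** The moment of order 0 involves only the empty set, whose superset mass is the total mass; so the
    missing mass tends to 0. *)
Lemma cvg_mass (q : forall N, {set torus d N} -> R) :
  \sum_(B : {set torus d N} | #|B| == 0%N) `|superset_mass (@q N) B - (la / #|{: torus d N}|%:R) ^+ 0|
    @[N --> \oo] --> (0 : R) ->
  `|1 - \sum_(A : {set torus d N}) q N A| @[N --> \oo] --> (0 : R).
Proof.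
apply: cvg_trans; apply: near_eq_cvg; near=> N.
rewrite (eq_bigl (pred1 finset.set0)); last by move=> B; rewrite cards_eq0.
rewrite big_pred1_eq expr0 distrC; congr (`| _ - _|).
by apply: eq_bigl => A; rewrite finset.sub0set.
Unshelve. all: by end_near. Qed.

Lemma late_points_site N (w : Om N) : late_points z (X N ^~ w) = site_points (late w).
Proof. by rewrite /late_points /site_points; congr dirac_sum_pm; apply/funext => y /=; rewrite inE. Qed.

Lemma late_points_cvg_in_law : cvg_in_law P (fun N w => late_points z (fun n => X N n w)) Q (@poisson_points R d).
Proof.
move=> F cF [B FB]; have B0 : 0 <= B by apply: le_trans (FB (site_points (finset.set0 : {set torus d 2}))).
have [cgrid fn] := cvg_expectation_grid (expR_gt0 (- z)) cF FB.
pose a N := fine 'E_(P N)[(fun w => F (late_points z (fun n => X N n w)))]%E.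
pose b N := fine 'E_Q[(fun w => F (grid_points N w))]%E.
pose G N (A : {set torus d N}) := F (site_points A).
have near_late N : (2 < N)%N -> 0 <= cover_level d z N ->
    ('E_(P N)[(fun w => F (late_points z (fun n => X N n w)))] \is a fin_num)%E /\
    `|a N - \sum_A late_law A * G N A| <= B * (1 - \sum_(A : {set torus d N}) late_law A).
  move=> N3 c0; have mY o := measurable_some_late o N3 c0.
  have mF : measurable_fun setT (fun w : Om N => F (late_points z (fun n => X N n w))).
    move=> _ U mU; rewrite setTI.
    rewrite (_ : _ @^-1` _ = [set w | U (F (site_points (late w)))]); last first.
      by apply/seteqP; split => w; rewrite /= late_points_site.
    have mL A : measurable [set w : Om N | late w = A] by exact: (measurable_late d2 N3 c0 (hX (ltnW N3)) A).
    exact: (measurable_countable_rv (fun A => U (F (site_points A))) mL).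
  split; first by apply: expectation_bounded_fin_num mF _ => w; exact: FB.
  have hG w (A : {set torus d N}) : Some (late w) = Some A -> F (late_points z (X N ^~ w)) = G N A.
    by case=> <-; rewrite late_points_site.
  exact: (@expectation_fiber_dist _ _ _ (P N) _ _ mF (fun w => FB _) _ _ mY (G N) hG).
have near_grid N : (1 < N)%N ->
    `|b N - \sum_A occupation_law la A * G N A| <= B * (1 - \sum_(A : {set torus d N}) occupation_law la A).
  move=> N1; have mF := measurable_grid_points F (ltnW N1).
  have mY := @measurable_occupied R d N ^~ (ltnW N1).
  have := @expectation_fiber_dist _ _ _ Q _ _ mF (fun w => FB _) _ _ mY (G N)
    (fun w A => @grid_points_occupied _ _ F N w A cF).
  by under eq_bigr do rewrite prob_occupied //; under [in X in _ <= X]eq_bigr do rewrite prob_occupied //.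
(* Both expectations are close to sums of the same values [G N A], up to B times a missing mass; the
   two sums differ by at most B times the total variation. *)
have ab : a N - b N @[N --> \oo] --> (0 : R).
  apply: (@cvg_bounded_by _ _ (fun N => B * (`|1 - \sum_(A : {set torus d N}) late_law A| +
    `|1 - \sum_(A : {set torus d N}) occupation_law la A| +
    \sum_(A : {set torus d N}) `|late_law A - occupation_law la A|))); last first.
    rewrite (_ : nbhs (0 : R) = nbhs (B * (0 + 0 + 0) : R)); last by rewrite !addr0 mulr0.
    apply: cvgMr; apply: cvgD; last exact: cvg_late_occupation.
    apply: cvgD; first exact: (cvg_mass (late_moments 0)).
    exact: (@cvg_mass (fun N => @occupation_law R (torus d N) la) (poisson_moments 0)).
  near=> N.
  have [N3 c0 v0] : [/\ (2 < N)%N, 0 <= cover_level d z N & (0 < visits d z N)%N] by near: N; exact: large.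
  have [_ h1] := near_late N N3 c0; have h2 := near_grid N (ltnW N3).
  set s1 := \sum_A late_law A * G N A in h1; set s2 := \sum_A occupation_law la A * G N A in h2.
  have h3 : `|s1 - s2| <= B * \sum_(A : {set torus d N}) `|late_law A - occupation_law la A|.
    rewrite -sumrB mulr_sumr; apply: le_trans (ler_norm_sum _ _ _) _; apply: ler_sum => A _.
    by rewrite -mulrBl normrM mulrC ler_wpM2r //; exact: FB.
  rewrite (_ : a N - b N = (a N - s1) + (s1 - s2) - (b N - s2)); last by ring.
  apply: le_trans (ler_normB _ _) _.
  apply: le_trans (lerD (ler_normD _ _) (lexx _)) _.
  rewrite mulrDr mulrDr [leLHS]addrAC; apply: lerD => //.
  by apply: lerD; [apply: le_trans h1 _|apply: le_trans h2 _]; rewrite ler_wpM2l // ler_norm.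
rewrite -(fineK fn); apply/fine_cvgP; split.
  near=> N.
  have [N3 c0 v0] : [/\ (2 < N)%N, 0 <= cover_level d z N & (0 < visits d z N)%N] by near: N; exact: large.
  by have [] := near_late N N3 c0.
rewrite (_ : _ \o _ = fun N => (a N - b N) + b N); last by apply/funext => N; rewrite subrK.
set e := fine _; have cb : b N @[N --> \oo] --> e.
  (* Dominated convergence was established along N = n + 2, hence the two shifts. *)
  by rewrite -(cvg_shiftS b) -(cvg_shiftS (fun n => b n.+1)); exact: cgrid.
by rewrite (_ : nbhs e = nbhs (0 + e : R)); [exact: cvgD|rewrite add0r].
Unshelve. all: by end_near. Qed.

End coupling.

Theorem corollary2p2 (R : realType) (d : nat) (hd : (2 <= d)%N) (z : R)
    (disp : nat -> measure_display)
    (Om : forall N : nat, measurableType (disp N))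
    (P : forall N : nat, probability (Om N) R)
    (X : forall N : nat, nat -> Om N -> cylinder d N)
    (hX : forall N : nat, (2 <= N)%N ->
      is_srw (@cylinder_nbrs d N) (P N) (@uniform_zero_level R d N) (X N)) :
  exists (disp' : measure_display) (Om' : measurableType disp')
      (Q : probability Om' R) (eta : Om' -> point_measure R d),
    poisson_point_process Q (fun A => ((expR (- z))%:E * lebesgue_torus0 A)%E) eta /\
    cvg_in_law P (fun N w => late_points z (fun n => X N n w)) Q eta.
Proof.
exists default_measure_display, (configs (d.-tuple R)),
  (poisson_law (lebesgue_cube R d : probability (d.-tuple R) R) (expR_gt0 (- z))), (@poisson_points R d).
split; first exact: poisson_points_process.
exact: late_points_cvg_in_law.
Qed.
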